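(* Let $n\ge 2$ and let $\Omega\subset\mathbb{R}^n$ be any open, bounded, connected set with Lipschitz continuous boundary. Then $$\kappa(\Omega)\ \geq\ \kappa(\mathbb{R}^n)=\sqrt{2}.$$
   Context: $\mathbb{R}^{n\times n}$ carries the scalar product $A:B=\mathrm{tr}(A^TB)$ and the Frobenius norm $|A|^2=A:A$; $L^2$ norms of matrix fields use this norm. For $u\in W^{1,2}(\Omega,\mathbb{R}^n)$, $\nabla u=[\partial_j u^i]_{ij}$ and $D(u)=\frac12(\nabla u+(\nabla u)^T)$. $so(n)$ is the space of skew-symmetric real $n\times n$ matrices. $\vec n$ is the outward unit normal on $\partial\Omega$ (defined almost everywhere with respect to surface measure); the condition $u\cdot\vec n=0$ on $\partial\Omega$ is understood in the sense of traces. Define the linear space $$L_\Omega=\{A\in so(n);\ \exists a\in\mathbb{R}^n\ \ \forall x\in\partial\Omega\ \ (Ax+a)\cdot\vec n(x)=0\}$$ (the condition being imposed where $\vec n$ is defined). The optimal Korn constant under tangential boundary conditions is $$\kappa(\Omega)=\sup\Big\{\min_{A\in L_\Omega}\|\nabla u-A\|_{L^2(\Omega)};\ u\in W^{1,2}(\Omega,\mathbb{R}^n),\ u\cdot\vec n=0\text{ on }\partial\Omega,\ \|D(u)\|_{L^2(\Omega)}=1\Big\},$$ and the Korn constant in the whole space is $$\kappa(\mathbb{R}^n)=\sup\big\{\|\nabla u\|_{L^2(\mathbb{R}^n)};\ u\in W^{1,2}(\mathbb{R}^n,\mathbb{R}^n),\ \|D(u)\|_{L^2(\mathbb{R}^n)}=1\big\}.$$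 *)

(* Defs.v *)
From HB Require Import structures.
From mathcomp Require Import all_boot all_order all_algebra.
From mathcomp Require Import all_classical all_reals all_analysis.

Set Implicit Arguments.
Unset Strict Implicit.
Unset Printing Implicit Defensive.

Import Order.TTheory GRing.Theory Num.Theory.
Import numFieldNormedType.Exports.

Local Open Scope classical_set_scope.
Local Open Scope ring_scope.

(* Points of R^n are row vectors; the image of x under the n x n matrix A is
   therefore written x *m A^T. *)

Definition mxdot {R : realType} {p q : nat} (A B : 'M[R]_(p, q)) : R :=
  \tr (A^T *m B).

(* The norm `|A| of the library is the sup norm; this is the Frobenius norm
   (the Euclidean norm on row vectors). *)
Definition mxfrob {R : realType} {p q : nat} (A : 'M[R]_(p, q)) : R :=
  Num.sqrt (mxdot A A).

Definition sympart {R : realType} {n : nat} (A : 'M[R]_n) : 'M[R]_n :=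
  2^-1 *: (A + A^T).

Definition frontier {T : topologicalType} (A : set T) : set T :=
  closure A `\` A^°.

Section rV_measurable.
Context {R : realType} {n : nat}.

Definition rV_coord (i : 'I_n) (x : 'rV[R]_n) : measurableTypeR R := x ord0 i.

HB.instance Definition _ := @isMeasurable.Build default_measure_display
  'rV[R]_n (g_sigma_preimage rV_coord)
  (@sigma_algebra0 _ _ _) (@sigma_algebraC _ _) (@sigma_algebra_bigcup _ _ _).

Lemma measurable_rV_coord (i : 'I_n) :
  measurable_fun [set: 'rV[R]_n] (rV_coord i).
Proof.
move=> _ Y mY; rewrite setTI; apply: sub_sigma_algebra => /=.
rewrite -bigcup_seq/=; exists i => /=; first by rewrite mem_index_enum.
by exists Y => //; rewrite setTI.
Qed.

Lemma measurable_fun_rVP d (T : measurableType d) (f : T -> 'rV[R]_n) :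
  (forall i, measurable_fun [set: T] (rV_coord i \o f)) ->
  measurable_fun [set: T] f.
Proof.
move=> mf _ A mA; rewrite setTI.
pose G : set (set 'rV[R]_n) := [set B | measurable (f @^-1` B)].
suff: @measurable _ 'rV[R]_n `<=` G by apply.
apply: smallest_sub.
  split.
  - by rewrite /G /= preimage_set0.
  - by move=> B; rewrite /G /= setTD preimage_setC; exact: measurableC.
  - move=> F GF; rewrite /G /= preimage_bigcup.
    by apply: bigcup_measurable => k _; exact: GF.
rewrite -bigcup_seq => B [i _ [C mC <-]].
by rewrite /G /= !setTI -[X in measurable X]setTI; exact: mf.
Qed.

End rV_measurable.

(* Lebesgue measure on R^n, by recursion: the image of the product measure
   under R * R^n -> R^(n+1). *)
Section lebesgue_rV.
Context {R : realType}.

Definition rV_cons {n : nat} (p : measurableTypeR R * 'rV[R]_n) :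
  'rV[R]_n.+1 := \row_i oapp (p.2 ord0) (p.1 : R) (unlift ord0 i).

Lemma measurable_rV_cons {n : nat} : measurable_fun setT (@rV_cons n).
Proof.
apply: measurable_fun_rVP => i.
case: (unliftP ord0 i) => [j ->|->].
  rewrite (_ : _ \o _ =
    @rV_coord R n j \o snd).
    by apply: measurableT_comp => //; exact: measurable_rV_coord.
  by apply/funext => p /=; rewrite /rV_coord mxE liftK.
rewrite (_ : _ \o _ = fst) //.
by apply/funext => p /=; rewrite /rV_coord mxE unlift_none.
Qed.

Section step.
Context {n : nat} (mu : {sigma_finite_measure set 'rV[R]_n -> \bar R}).

Definition lebesgue_rV_step : set 'rV[R]_n.+1 -> \bar R :=
  pushforward (@lebesgue_measure R \x mu)%E (@rV_cons n).

Let step0 : lebesgue_rV_step set0 = 0%E.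
Proof. by rewrite /lebesgue_rV_step /pushforward preimage_set0 measure0. Qed.

Let step_ge0 A : (0 <= lebesgue_rV_step A)%E.
Proof. exact: (measure_ge0 (@lebesgue_measure R \x mu)%E). Qed.

Let step_sigma_additive : semi_sigma_additive lebesgue_rV_step.
Proof.
apply: (@measure_semi_sigma_additive _ _ _
  (pushforward (@lebesgue_measure R \x mu)%E (@rV_cons n))).
exact: measurable_rV_cons.
Qed.

HB.instance Definition _ := isMeasure.Build _ _ _ lebesgue_rV_step
  step0 step_ge0 step_sigma_additive.

Let rV_uncons (x : 'rV[R]_n.+1) : measurableTypeR R * 'rV[R]_n :=
  (x ord0 ord0, \row_j x ord0 (lift ord0 j)).

Let rV_consK : cancel (@rV_cons n) rV_uncons.
Proof.
move=> [a x]; congr (_, _); first by rewrite mxE unlift_none.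
by apply/rowP => j; rewrite !mxE liftK.
Qed.

Let measurable_rV_uncons : measurable_fun setT rV_uncons.
Proof.
apply: measurable_fun_pair; first exact: measurable_rV_coord.
apply: measurable_fun_rVP => i; rewrite (_ : _ \o _ =
  @rV_coord R n.+1 (lift ord0 i)).
  exact: measurable_rV_coord.
by apply/funext => x /=; rewrite /rV_coord mxE.
Qed.

Let step_sigma_finite : sigma_finite setT lebesgue_rV_step.
Proof.
have /sigma_finiteP[F [FT ndF Foo]] := sigma_finiteT (@lebesgue_measure R).
have /sigma_finiteP[G [GT ndG Goo]] := sigma_finiteT mu.
have FGT : \bigcup_k (F k `*` G k) = setT.
  rewrite -subTset => -[x y] _.
  have [i _ Fx] : (\bigcup_k F k) x by rewrite -FT.
  have [j _ Gy] : (\bigcup_k G k) y by rewrite -GT.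
  exists (maxn i j) => //; split => /=.
    by move: x Fx; exact/subsetPset/ndF/leq_maxl.
  by move: y Gy; exact/subsetPset/ndG/leq_maxr.
exists (fun k => rV_uncons @^-1` (F k `*` G k)).
  by rewrite -preimage_bigcup FGT preimage_setT.
move=> k; have [mF Fk] := Foo k; have [mG Gk] := Goo k; split.
  rewrite -[X in measurable X]setTI.
  by apply: measurable_rV_uncons => //; exact: measurableX.
rewrite /lebesgue_rV_step /pushforward -comp_preimage.
rewrite (_ : _ \o _ = id); last by apply/funext => p; exact: rV_consK.
by rewrite preimage_id product_measure1E// lte_mul_pinfty// ge0_fin_numE.
Qed.

HB.instance Definition _ := Measure_isSigmaFinite.Build _ _ _
  lebesgue_rV_step step_sigma_finite.

End step.

Fixpoint lebesgue_rV (n : nat) :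
    {sigma_finite_measure set 'rV[R]_n -> \bar R} :=
  match n with
  | 0%N => \d_ (0 : 'rV[R]_0)
  | n'.+1 => lebesgue_rV_step (lebesgue_rV n')
  end.

End lebesgue_rV.
Arguments lebesgue_rV R n : clear implicits.

(* The s-dimensional Hausdorff outer measure for the Euclidean distance.  It is
   not normalised: for s = n - 1 it is a positive constant times the surface
   measure, so it has the same null sets, L^2 space and L^2 convergence. *)
Section hausdorff.
Context {R : realType} {n : nat}.

(* 'rV[R]_n with every set measurable, so that mu_ext below is an infimum over
   countable covers by arbitrary sets. *)
Definition discrete_rV : Type := 'rV[R]_n.

HB.instance Definition _ := Pointed.on discrete_rV.
HB.instance Definition _ := @isMeasurable.Build default_measure_display
  discrete_rV [set: set discrete_rV] I (fun _ _ => I) (fun _ _ => I).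

Definition diam_le (delta : R) (U : set 'rV[R]_n) : Prop :=
  forall x y, U x -> U y -> mxfrob (x - y) <= delta.

(* (diam U)^s if diam U <= delta and +oo otherwise; set0 always weighs 0. *)
Definition hausdorff_weight (s : nat) (delta : R) (U : set discrete_rV) :
    \bar R :=
  if `[< U = set0 >] then 0%E
  else if `[< diam_le delta U >] then
    ereal_sup [set ((mxfrob (x - y) : R) ^+ s)%:E | x in U & y in U]
  else +oo%E.

Definition hausdorff (s : nat) (A : set 'rV[R]_n) : \bar R :=
  ereal_sup [set mu_ext (hausdorff_weight s delta) A | delta in [set d | 0 < d]].

Let weight0 s delta : hausdorff_weight s delta set0 = 0%E.
Proof. by rewrite /hausdorff_weight asboolT. Qed.

Let weight_ge0 s delta U : (0 <= hausdorff_weight s delta U)%E.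
Proof.
rewrite /hausdorff_weight; case: asboolP => // /eqP/set0P[x Ux].
case: asboolP => [_|_]; last exact: leey.
apply: le_ereal_sup_tmp; exists ((mxfrob (x - x)) ^+ s)%:E.
  by exists x => //; exists x.
by rewrite lee_fin exprn_ge0 // sqrtr_ge0.
Qed.

Let hausdorff_ge0 s A : (0 <= hausdorff s A)%E.
Proof.
apply: le_ereal_sup_tmp; exists (mu_ext (hausdorff_weight s 1) A).
  by exists 1; rewrite //= ltr01.
exact: (mu_ext_ge0 (weight_ge0 _ _)).
Qed.

Let hausdorff0 s : hausdorff s set0 = 0%E.
Proof.
apply/eqP; rewrite eq_le hausdorff_ge0 andbT.
apply: ge_ereal_sup => _ [delta _ <-].
by rewrite (mu_ext0 (weight0 _ _) (weight_ge0 _ _)).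
Qed.

Let le_hausdorff s : {homo hausdorff s : A B / A `<=` B >-> (A <= B)%E}.
Proof.
move=> A B AB; apply: ge_ereal_sup => _ [delta d0 <-].
apply: le_ereal_sup_tmp; exists (mu_ext (hausdorff_weight s delta) B).
  by exists delta.
exact: le_mu_ext.
Qed.

Let hausdorff_sigma_subadditive s : sigma_subadditive (hausdorff s).
Proof.
move=> F; apply: ge_ereal_sup => _ [delta d0 <-].
apply: (le_trans (mu_ext_sigma_subadditive (weight_ge0 s delta) F)).
apply: lee_nneseries => [k _ _|k _].
  exact: (mu_ext_ge0 (weight_ge0 _ _)).
by apply: ereal_sup_ubound; exists delta.
Qed.

HB.instance Definition _ s := isOuterMeasure.Build R 'rV[R]_n (hausdorff s)
  (hausdorff0 s) (hausdorff_ge0 s) (@le_hausdorff s)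
  (@hausdorff_sigma_subadditive s).

End hausdorff.
Arguments hausdorff R n s A : clear implicits.

Section L2.
Context {d : measure_display} {T : measurableType d} {R : realType}.
Variables (mu : {measure set T -> \bar R}) (D : set T).
Context {p q : nat}.
Implicit Type F : T -> 'M[R]_(p, q).

Definition L2norm F : \bar R :=
  'N[mu]_2%:E [(fun x => (mxfrob (F x))%:E) \_ D].

Definition L2 F : Prop :=
  (forall i j, measurable_fun D (fun x => F x i j)) /\ (L2norm F < +oo)%E.

End L2.

Section sobolev.
Context {R : realType} {n : nat}.
Implicit Types (f phi : 'rV[R]_n -> R) (u v g : 'rV[R]_n -> 'rV[R]_n).
Implicit Types (x e a nu : 'rV[R]_n) (gamma : 'rV[R]_n -> R).
Implicit Types (G : 'rV[R]_n -> 'M[R]_n) (Omega : set 'rV[R]_n).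

Definition partial (j : 'I_n) f : 'rV[R]_n -> R :=
  fun x => 'D_(delta_mx ord0 j) f x.

Fixpoint Ck (k : nat) f : Prop :=
  match k with
  | 0%N => continuous f
  | k'.+1 => (forall x, differentiable f x) /\ forall j, Ck k' (partial j f)
  end.

Definition smooth f : Prop := forall k, Ck k f.

Definition test_function Omega phi : Prop :=
  smooth phi /\
  exists2 K, compact K /\ K `<=` Omega & forall x, ~ K x -> phi x = 0.

(* G x i j stands for the j-th weak partial derivative of u^i. *)
Definition weak_gradient Omega u G : Prop :=
  forall phi, test_function Omega phi -> forall i j,
    (\int[lebesgue_rV R n]_(x in Omega) (u x ord0 i * partial j phi x)%:E =
     - \int[lebesgue_rV R n]_(x in Omega) (G x i j * phi x)%:E)%E.

Definition W12 Omega u G : Prop :=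
  [/\ L2 (lebesgue_rV R n) Omega u, L2 (lebesgue_rV R n) Omega G
    & weak_gradient Omega u G].

(* Omega lies, near x, strictly above the graph, in the direction of the unit
   vector e, of a Lipschitz function gamma of the coordinates orthogonal to e;
   only the values of gamma on the hyperplane orthogonal to e matter. *)
Definition graph_fun e gamma (y : 'rV[R]_n) : R :=
  gamma (y - mxdot y e *: e) - mxdot y e.

Definition lipschitz_chart Omega x e gamma : Prop :=
  [/\ mxfrob e = 1, lipschitz gamma
    & \forall y \near x, Omega y <-> graph_fun e gamma y < 0].

Definition lipschitz_boundary Omega : Prop :=
  forall x, frontier Omega x -> exists e gamma, lipschitz_chart Omega x e gamma.

(* The normal at x is defined when the local defining function of Omega is
   differentiable at x (its gradient is not zero, as its derivative along e
   is -1). *)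
Definition outer_unit_normal Omega x nu : Prop :=
  frontier Omega x /\
  exists e gamma, [/\ lipschitz_chart Omega x e gamma,
    differentiable (graph_fun e gamma) x &
    let grad := \row_j partial j (graph_fun e gamma) x in
    nu = (mxfrob grad)^-1 *: grad].

(* Surface measure on R^n, up to normalisation. *)
Definition surface_outer : {outer_measure set 'rV[R]_n -> \bar R} :=
  hausdorff R n n.-1.

Definition surface :
    {measure set (caratheodory_type surface_outer) -> \bar R} :=
  surface_outer.

(* The trace operator W^{1,2}(Omega) -> L^2(boundary) is the closure of the
   restriction map v |-> v on the boundary, v smooth up to the boundary. *)
Definition is_trace Omega u G g : Prop :=
  L2 surface (frontier Omega) g /\
  exists v : nat -> 'rV[R]_n -> 'rV[R]_n,
    [/\ forall k i, smooth (fun x => v k x ord0 i),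
        L2norm (lebesgue_rV R n) Omega (fun x => v k x - u x) @[k --> \oo] --> 0%E,
        L2norm (lebesgue_rV R n) Omega
          (fun x => (\matrix_(i, j) partial j (fun y => v k y ord0 i) x) - G x)
          @[k --> \oo] --> 0%E
      & L2norm surface (frontier Omega) (fun x => v k x - g x)
          @[k --> \oo] --> 0%E].

Definition tangential Omega u G : Prop :=
  exists2 g, is_trace Omega u G g &
    {ae surface, forall x, forall nu, outer_unit_normal Omega x nu ->
      mxdot (g x) nu = 0}.

Definition L_Omega Omega : set 'M[R]_n :=
  [set A | A^T = - A /\ exists a, forall x nu,
    outer_unit_normal Omega x nu -> mxdot (x *m A^T + a) nu = 0].

Definition is_min (S : set \bar R) (m : \bar R) : Prop := S m /\ lbound S m.

Definition kappa Omega : \bar R :=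
  ereal_sup [set m | exists u G,
    [/\ W12 Omega u G, tangential Omega u G,
        L2norm (lebesgue_rV R n) Omega (fun x => sympart (G x)) = 1%E
      & is_min [set L2norm (lebesgue_rV R n) Omega (fun x => G x - A)
               | A in L_Omega Omega] m]].

End sobolev.

Definition kappa_space (R : realType) (n : nat) : \bar R :=
  ereal_sup [set m | exists (u : 'rV[R]_n -> 'rV[R]_n) (G : 'rV[R]_n -> 'M[R]_n),
    [/\ W12 setT u G,
        L2norm (lebesgue_rV R n) setT (fun x => sympart (G x)) = 1%E
      & m = L2norm (lebesgue_rV R n) setT G]].

(* Main.v *)
Require Import Defs.
From mathcomp Require Import all_boot all_order all_algebra.
From mathcomp Require Import all_classical all_reals all_analysis.
From mathcomp Require Import measurable_realfun ring lra.
Import Order.TTheory GRing.Theory Num.Theory.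
Import numFieldNormedType.Exports.
Local Open Scope classical_set_scope.
Local Open Scope ring_scope.

(* A compactly supported solenoidal field v satisfies
   |grad v|^2 = 2 |D v|^2 in L^2, and int_Omega grad v = 0 makes A = 0 the best
   constant; such fields live in every ball, whence kappa >= sqrt 2 both for
   Omega and for R^n.  Conversely 2 |D u|^2 - |grad u|^2 = int (div u)^2 >= 0
   for u in W^{1,2}(R^n), which rests on
     int d_j u^i d_l u^k = int d_l u^i d_j u^k.
   To prove this for a weak gradient G without density theorems, pair G_ij(x)
   and G_kl(y) against a mollifier phi(y - x): moving the derivatives in x and
   in y onto phi gives - iint u^i(x) u^k(y) d_j d_l phi(y - x), symmetric in j
   and l, and the pairing tends to int G_ij G_kl as phi shrinks to a Dirac mass.
   The latter follows from iint |f(x) - f(y)| phi(y - x) -> 0 for f in L^1,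
   which is proved on the line and tensorises by the triangle inequality.  All
   mollifiers are products of one-variable bumps, so that their mixed
   derivatives commute by inspection. *)

Set Implicit Arguments.
Unset Strict Implicit.
Unset Printing Implicit Defensive.

(** * Measurability and integration in R^n *)

(** The solenoidal field is built from a stream function: for a mollifier [psi] it has components
    [partial i1 psi] and [- partial i0 psi] in two directions and zero in the others, which is where
    [2 <= n] enters. Its divergence is the difference of two mixed derivatives of [psi]. The
    obstacle in the upper bound is that a weak gradient may be tested only against smooth compactly
    supported functions, so u cannot be paired with itself; with two independent points x and y the
    kernel carries all the regularity. Lebesgue measure on R^n is an iterated image of products, so
    n-dimensional facts are reached by peeling off the first coordinate; hence product kernels, and
    boxes as supports. Translation invariance and changes of variables are avoided: kernels are only
    asked to have mass one in each variable separately, and the mass of a mollifier comes from an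
    antiderivative. The entries of G are in L^2 and not in L^1; they are truncated to where 1/(N+1)
    <= |g| <= N+1 before the L^1 statement is applied, and Young's inequality with a parameter takes
    the place of Cauchy-Schwarz. *)

Lemma measurable_rV_open (R : realType) (n : nat) (U : set 'rV[R]_n) :
  open U -> measurable U.
Proof.
move=> oU.
(* The sigma-algebra is generated by the coordinates, so [U] has to be exhausted by countably many
   boxes: the half-open grid cells of side 1/(k+1) contained in [U], enumerated through the
   countable type of their integer labels. *)
pose cell k (z : {ffun 'I_n -> int}) :=
  [set x : 'rV[R]_n | forall i, Num.floor (k.+1%:R * x ord0 i) = z i].
pose F k p : set 'rV[R]_n := if unpickle p is Some z then
  if `[< cell k z `<=` U >] then cell k z else set0 else set0.
have mcell k z : measurable (cell k z).
  have -> : cell k z = \bigcap_(i in [set: 'I_n])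
      (rV_coord i @^-1` [set t | Num.floor (k.+1%:R * t) = z i]).
    by apply/seteqP; split=> x /= => [h i _|h i]; have := h i; apply.
  apply: fin_bigcap_measurable => // i _.
  rewrite -[X in measurable X]setTI; apply: measurable_rV_coord => //.
  have -> : [set t : R | Num.floor (k.+1%:R * t) = z i] =
     `[(z i)%:~R / k.+1%:R, (z i + 1)%:~R / k.+1%:R[%classic.
    apply/seteqP; split=> t /=; rewrite in_itv/= ler_pdivrMr ?ltr_pdivlMr ?ltr0Sn//.
      by move=> <-; rewrite mulrC ge_floor floorD1_gt.
    by move=> /andP[h1 h2]; apply: Order.le_anti; rewrite floor_ge_int -ltzD1 floor_lt_int mulrC h1 h2.
  exact: measurable_itv.
have -> : U = \bigcup_k \bigcup_p F k p.
  apply/seteqP; split => [x Ux|x [k _ [p _]]]; last first.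
    by rewrite /F; case: unpickle => // z; case: asboolP => // + cx; apply.
  have /nbhs_ballP[e /= e0 eU] : nbhs x U by exact: open_nbhs_nbhs.
  pose k := Num.truncn (e^-1).
  have ke : k.+1%:R^-1 < e.
    by rewrite -[e]invrK ltf_pV2 ?posrE ?invr_gt0// truncnS_gt.
  pose z := [ffun i => Num.floor (k.+1%:R * x ord0 i)].
  exists k => //; exists (pickle z) => //; rewrite /F pickleK.
  case: asboolP => [_ i|]; first by rewrite ffunE.
  case=> y cy; apply: eU => /=; split=> // i j; rewrite (ord1 i) /=.
  have := cy j; rewrite ffunE => fe.
  have h1 := ge_floor (k.+1%:R * y ord0 j); have h2 := floorD1_gt (k.+1%:R * y ord0 j).
  have h3 := ge_floor (k.+1%:R * x ord0 j); have h4 := floorD1_gt (k.+1%:R * x ord0 j).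
  rewrite fe in h1 h2; apply: le_lt_trans ke.
  rewrite -[_^-1]mul1r ler_pdivlMr ?ltr0Sn// -[X in _ * X]ger0_norm// -normrM mulrBl.
  move: h1 h2 h3 h4; rewrite intrD ler_norml => *; lra.
apply: bigcup_measurable => k _; apply: bigcup_measurable => p _.
by rewrite /F; case: unpickle => // z; case: ifP.
Qed.

Lemma continuous_measurable_rV (R : realType) (n : nat) (f : 'rV[R]_n -> R) :
  continuous f -> measurable_fun [set: 'rV[R]_n] (f : 'rV[R]_n -> measurableTypeR R).
Proof.
move=> cf; apply: (measurability _ (measurable_realfun.RGenOpens.measurableE R)) => _ [_ [a [b ->]] <-].
rewrite setTI; apply: measurable_rV_open.
by apply: open_comp => // x _; exact: cf.
Qed.

Lemma integral_supp d (T : measurableType d) (R : realType) {mu : {measure set T -> \bar R}}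
    (D : set T) (f : T -> \bar R) :
  (forall t, ~ D t -> f t = 0%E) -> (\int[mu]_t f t = \int[mu]_(t in D) f t)%E.
Proof.
move=> f0; rewrite [RHS]integral_mkcond; apply: eq_integral => t _.
by rewrite patchE; case: ifPn => // /negP tD; rewrite f0// => Dt; apply: tD; rewrite inE.
Qed.

Section integral_rV.
Context {R : realType} {n : nat}.
Local Open Scope ereal_scope.
Notation mu1 := (@lebesgue_measure R).

(** Tonelli for the recursive construction of the measure: the first coordinate is peeled off as the
    outer variable here, as the inner one in the companion lemma. *)
Lemma ge0_integral_rV12 (f : 'rV[R]_n.+1 -> \bar R) :
  measurable_fun [set: 'rV[R]_n.+1] f -> (forall x, 0 <= f x) ->
  \int[lebesgue_rV R n.+1]_x f x =
  \int[mu1]_t \int[lebesgue_rV R n]_y f (rV_cons (t, y)).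
Proof.
move=> mf f0.
transitivity (\int[(mu1 \x lebesgue_rV R n)]_z f (rV_cons z)).
  by rewrite ge0_integral_pushforward ?preimage_setT//; exact: measurable_rV_cons.
rewrite fubini_tonelli1//.
exact: (measurableT_comp mf measurable_rV_cons).
Qed.

Lemma ge0_integral_rV21 (f : 'rV[R]_n.+1 -> \bar R) :
  measurable_fun [set: 'rV[R]_n.+1] f -> (forall x, 0 <= f x) ->
  \int[lebesgue_rV R n.+1]_x f x =
  \int[lebesgue_rV R n]_y \int[mu1]_t f (rV_cons (t, y)).
Proof.
move=> mf f0; rewrite ge0_integral_rV12//.
rewrite (fubini_tonelli (fun z => f (rV_cons z)))//.
exact: (measurableT_comp mf measurable_rV_cons).
Qed.

Lemma integrable_rV_cons (f : 'rV[R]_n.+1 -> \bar R) :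
  (lebesgue_rV R n.+1).-integrable setT f ->
  (mu1 \x lebesgue_rV R n).-integrable setT (fun z => f (rV_cons z)).
Proof.
move=> /integrableP[mf fi]; apply/integrableP; split.
  exact: (measurableT_comp mf measurable_rV_cons).
move: fi; rewrite ge0_integral_pushforward ?preimage_setT//.
- exact: measurable_rV_cons.
- exact: measurableT_comp.
Qed.

Lemma integral_rV12 (f : 'rV[R]_n.+1 -> \bar R) :
  (lebesgue_rV R n.+1).-integrable setT f ->
  \int[lebesgue_rV R n.+1]_x f x =
  \int[mu1]_t \int[lebesgue_rV R n]_y f (rV_cons (t, y)).
Proof.
move=> fi; have fci := integrable_rV_cons fi.
rewrite -[RHS]/(\int[_]_t fubini_F _ (fun z => f (rV_cons z)) t).
rewrite integral12_prod_meas1//.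
rewrite [LHS](@integral_pushforward _ _ _ _ _ _ measurable_rV_cons) ?preimage_setT//.
by case/integrableP: fi.
Qed.

Lemma integral_rV21 (f : 'rV[R]_n.+1 -> \bar R) :
  (lebesgue_rV R n.+1).-integrable setT f ->
  \int[lebesgue_rV R n.+1]_x f x =
  \int[lebesgue_rV R n]_y \int[mu1]_t f (rV_cons (t, y)).
Proof.
move=> fi; rewrite integral_rV12//.
by rewrite (Fubini (f := fun z => f (rV_cons z)))//; exact: integrable_rV_cons.
Qed.

End integral_rV.

Lemma rV_cons0 (R : realType) (n : nat) (t : R) (y : 'rV[R]_n) :
  rV_cons (t, y) ord0 ord0 = t.
Proof. by rewrite mxE unlift_none. Qed.

Lemma rV_consS (R : realType) (n : nat) (t : R) (y : 'rV[R]_n) i :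
  rV_cons (t, y) ord0 (lift ord0 i) = y ord0 i.
Proof. by rewrite mxE liftK. Qed.

Lemma integral_rV0 (R : realType) (f : 'rV[R]_0 -> \bar R) :
  measurable_fun [set: 'rV[R]_0] f ->
  (\int[lebesgue_rV R 0]_x f x = f 0%R)%E.
Proof. by move=> mf; rewrite integral_dirac// diracT mul1e. Qed.

Lemma measurable_prod_coord (R : realType) (n : nat) (h : 'I_n -> R -> R) :
  (forall i, measurable_fun setT (h i)) ->
  measurable_fun [set: 'rV[R]_n] (fun y => \prod_i h i (y ord0 i)).
Proof.
move=> mh; apply: measurable_prod => i _.
exact: (measurableT_comp (mh i) (@measurable_rV_coord _ _ i)).
Qed.

Lemma integral_prod_coord (R : realType) (n : nat) (h : 'I_n -> R -> R)
    (c : 'I_n -> R) :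
  (forall i, measurable_fun setT (h i)) -> (forall i t, 0 <= h i t) ->
  (forall i, \int[@lebesgue_measure R]_t (h i t)%:E = (c i)%:E)%E ->
  (\int[lebesgue_rV R n]_y (\prod_i h i (y ord0 i))%:E = (\prod_i c i)%:E)%E.
Proof.
elim: n h c => [|n IH] h c mh h0 hc.
  rewrite integral_rV0; first by rewrite !big_ord0.
  by apply/measurable_EFinP; exact: measurable_prod_coord.
rewrite ge0_integral_rV12; first last.
- by move=> x; rewrite lee_fin prodr_ge0.
- by apply/measurable_EFinP; exact: measurable_prod_coord.
under eq_integral => t _.
  under eq_integral => y _.
    rewrite big_ord_recl rV_cons0 EFinM.
    under eq_bigr do rewrite rV_consS.
    over.
  rewrite ge0_integralZl ?lee_fin//; first last.
  - by move=> y _; rewrite lee_fin prodr_ge0.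
  - apply/measurable_EFinP; exact: (@measurable_prod_coord _ _ (fun i => h (lift ord0 i))).
  rewrite (IH (fun i => h (lift ord0 i)) (fun i => c (lift ord0 i)))//.
  over.
have c0 i : 0 <= c i.
  by rewrite -lee_fin -hc; apply: integral_ge0 => t _; rewrite lee_fin.
rewrite ge0_integralZr//; first by rewrite hc big_ord_recl EFinM.
- exact: (measurableT_comp (@EFin_measurable R setT) (mh ord0)).
- by move=> t _; rewrite lee_fin.
- by rewrite lee_fin prodr_ge0.
Qed.

(** * Averaging kernels and approximate identities *)

Section averaging_kernel.
Context d (T : measurableType d) (R : realType).
Variable mu : {sigma_finite_measure set T -> \bar R}.
Local Open Scope ereal_scope.

(** A doubly stochastic density. Mass one in each variable separately lets either point of a pair be
    integrated out, with no group structure on [T]. *)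
Definition averaging (k : T * T -> R) : Prop :=
  [/\ measurable_fun setT k, forall z, (0 <= k z)%R,
      forall x, \int[mu]_y (k (x, y))%:E = 1
    & forall y, \int[mu]_x (k (x, y))%:E = 1].

(** An averaged L^1 modulus of continuity; it dominates the L^1 distance between f and its average
    against [k]. *)
Definition osc (k : T * T -> R) (f : T -> R) : \bar R :=
  \int[mu]_x \int[mu]_y (`|f x - f y| * k (x, y))%:E.

Lemma averaging_integral_fst (k : T * T -> R) (f : T -> R) :
  averaging k -> measurable_fun setT f -> (forall x, (0 <= f x)%R) ->
  \int[mu]_x \int[mu]_y (f x * k (x, y))%:E = \int[mu]_x (f x)%:E.
Proof.
move=> [mk k0 k1 _] mf f0; apply: eq_integral => x _.
under eq_integral do rewrite EFinM.
rewrite ge0_integralZl ?k1 ?mule1 ?lee_fin//; first last.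
- by move=> y _; rewrite lee_fin.
- apply/measurable_EFinP; exact: (measurableT_comp mk (pair1_measurable x)).
Qed.

Lemma averaging_integral_snd (k : T * T -> R) (f : T -> R) :
  averaging k -> measurable_fun setT f -> (forall x, (0 <= f x)%R) ->
  \int[mu]_x \int[mu]_y (f y * k (x, y))%:E = \int[mu]_x (f x)%:E.
Proof.
move=> [mk k0 _ k1] mf f0.
rewrite (fubini_tonelli (fun z => (f z.2 * k z)%:E))//=; first last.
- by move=> z; rewrite lee_fin mulr_ge0.
- apply/measurable_EFinP; apply: measurable_funM => //.
  exact: (measurableT_comp mf measurable_snd).
apply: eq_integral => y _; under eq_integral do rewrite EFinM.
rewrite ge0_integralZl ?k1 ?mule1 ?lee_fin//; first last.
- by move=> x _; rewrite lee_fin.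
- apply/measurable_EFinP; exact: (measurableT_comp mk (pair2_measurable y)).
Qed.

Lemma osc_integrand_measurable (k : T * T -> R) (f : T -> R) :
  averaging k -> measurable_fun setT f ->
  measurable_fun setT (fun z => (`|f z.1 - f z.2| * k z)%:E).
Proof.
move=> [mk _ _ _] mf.
apply/measurable_EFinP; apply: measurable_funM => //.
apply: (measurableT_comp (@normr_measurable R setT)).
apply: measurable_funB.
- exact: (measurableT_comp mf measurable_fst).
- exact: (measurableT_comp mf measurable_snd).
Qed.

Lemma osc_ge0 k f : averaging k -> 0 <= osc k f.
Proof.
move=> [_ k0 _ _]; apply: integral_ge0 => x _; apply: integral_ge0 => y _.
by rewrite lee_fin mulr_ge0.
Qed.

(** The triangle inequality separates the two points, and each marginal of [k] integrates to one.
    The bound is uniform in [k]: it provides dominating functions and absorbs errors that are small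
    in L^1. *)
Lemma osc_le (k : T * T -> R) (f : T -> R) :
  averaging k -> measurable_fun setT f ->
  osc k f <= \int[mu]_x `|f x|%:E + \int[mu]_x `|f x|%:E.
Proof.
move=> ak mf; have [mk k0 _ _] := ak.
have mnf : measurable_fun setT (fun x => `|f x|%R).
  exact: (measurableT_comp (@normr_measurable R setT)).
rewrite -[X in _ <= X + _](averaging_integral_fst ak mnf)//.
rewrite -[X in _ <= _ + X](averaging_integral_snd ak mnf)//.
have m1 : measurable_fun setT (fun z : T * T => (`|f z.1| * k z)%:E).
  apply/measurable_EFinP; apply: measurable_funM => //.
  exact: (measurableT_comp mnf measurable_fst).
have m2 : measurable_fun setT (fun z : T * T => (`|f z.2| * k z)%:E).
  apply/measurable_EFinP; apply: measurable_funM => //.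
  exact: (measurableT_comp mnf measurable_snd).
rewrite -ge0_integralD//; first last.
- by apply: (measurable_fun_fubini_tonelli_F _ m2) => z; rewrite lee_fin mulr_ge0.
- by move=> x _; apply: integral_ge0 => y _; rewrite lee_fin mulr_ge0.
- by apply: (measurable_fun_fubini_tonelli_F _ m1) => z; rewrite lee_fin mulr_ge0.
- by move=> x _; apply: integral_ge0 => y _; rewrite lee_fin mulr_ge0.
apply: ge0_le_integral => //.
- by move=> x _; apply: integral_ge0 => y _; rewrite lee_fin mulr_ge0.
- apply: (measurable_fun_fubini_tonelli_F _ (osc_integrand_measurable ak mf)).
  by move=> z; rewrite lee_fin mulr_ge0.
- apply: emeasurable_funD.
  + by apply: (measurable_fun_fubini_tonelli_F _ m1) => z; rewrite lee_fin mulr_ge0.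
  + by apply: (measurable_fun_fubini_tonelli_F _ m2) => z; rewrite lee_fin mulr_ge0.
- move=> x _; rewrite -ge0_integralD//; first last.
  + exact: (measurableT_comp m2 (pair1_measurable x)).
  + by move=> y _; rewrite lee_fin mulr_ge0.
  + exact: (measurableT_comp m1 (pair1_measurable x)).
  + by move=> y _; rewrite lee_fin mulr_ge0.
  apply: ge0_le_integral => //.
  + by move=> y _; rewrite lee_fin mulr_ge0.
  + exact: (measurableT_comp (osc_integrand_measurable ak mf) (pair1_measurable x)).
  + apply: emeasurable_funD.
    * exact: (measurableT_comp m1 (pair1_measurable x)).
    * exact: (measurableT_comp m2 (pair1_measurable x)).
  + move=> y _; rewrite -EFinD lee_fin -mulrDl ler_wpM2r//.
    exact: ler_normB.
Qed.

(** The definition is the L^1 convergence itself rather than concentration near the diagonal,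
    because this form passes to product kernels by the triangle inequality. *)
Definition approx_id (k : nat -> T * T -> R) : Prop :=
  (forall m, averaging (k m)) /\
  forall f, mu.-integrable setT (EFin \o f) -> osc (k m) f @[m --> \oo] --> 0.

End averaging_kernel.

(** * Tensorisation of approximate identities *)

Section averaging_rV.
Context {R : realType}.
Notation mu1 := (@lebesgue_measure R).
Local Open Scope ereal_scope.

Definition kernel_rV (n : nat) (k : R * R -> R) (w : 'rV[R]_n * 'rV[R]_n) : R :=
  (\prod_i k (w.1 ord0 i, w.2 ord0 i))%R.

Definition rV_tail {n : nat} (x : 'rV[R]_n.+1) : 'rV[R]_n :=
  \row_j x ord0 (lift ord0 j).

Lemma rV_tail_cons n (t : R) (y : 'rV[R]_n) : rV_tail (rV_cons (t, y)) = y.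
Proof. by apply/rowP => j; rewrite mxE rV_consS. Qed.

Lemma measurable_rV_tail n : measurable_fun [set: 'rV[R]_n.+1] (@rV_tail n).
Proof.
apply: measurable_fun_rVP => i.
rewrite (_ : _ \o _ = @rV_coord R n.+1 (lift ord0 i)).
  exact: measurable_rV_coord.
by apply/funext => x /=; rewrite /rV_coord mxE.
Qed.

Lemma kernel_rV_cons n k (x y : 'rV[R]_n.+1) :
  kernel_rV k (x, y) =
  (k (x ord0 ord0, y ord0 ord0) * kernel_rV k (rV_tail x, rV_tail y))%R.
Proof.
by rewrite /kernel_rV/= big_ord_recl; congr *%R; apply: eq_bigr => i _; rewrite !mxE.
Qed.

Lemma measurable_kernel_rV n k : measurable_fun setT k ->
  measurable_fun setT (@kernel_rV n k).
Proof.
move=> mk; apply: measurable_prod => i _; apply: (measurableT_comp mk).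
apply: measurable_fun_pair; apply: (measurableT_comp (@measurable_rV_coord R n i)).
- exact: measurable_fst.
- exact: measurable_snd.
Qed.

Lemma averaging_rV n k : averaging mu1 k -> averaging (lebesgue_rV R n) (@kernel_rV n k).
Proof.
move=> [mk k0 k1 k2]; split.
- exact: measurable_kernel_rV.
- by move=> z; rewrite prodr_ge0.
- move=> x; rewrite (integral_prod_coord (h := fun i t => k (x ord0 i, t))
    (c := fun=> 1%R)) ?big1//.
  by move=> i; exact: (measurableT_comp mk (pair1_measurable _)).
- move=> y; rewrite (integral_prod_coord (h := fun i t => k (t, y ord0 i))
    (c := fun=> 1%R)) ?big1//.
  by move=> i; exact: (measurableT_comp mk (pair2_measurable _)).
Qed.

Lemma measurable_rV_cons2 n d (T : measurableType d) (a : T -> R) (b : T -> 'rV[R]_n) :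
  measurable_fun setT (a : T -> measurableTypeR R) -> measurable_fun setT b ->
  measurable_fun setT (fun z => rV_cons (a z, b z)).
Proof.
by move=> ma mb; exact: (measurableT_comp measurable_rV_cons (measurable_fun_pair ma mb)).
Qed.

(** The path from x to y is broken at the hybrid point that takes its first coordinate from y and
    its tail from x, so that each leg moves only one block of coordinates. *)
Lemma osc_rVS n k (f : 'rV[R]_n.+1 -> R) :
  averaging mu1 k -> measurable_fun setT f ->
  osc (lebesgue_rV R n.+1) (@kernel_rV n.+1 k) f <=
  \int[lebesgue_rV R n]_p osc mu1 k (fun t => f (rV_cons (t, p))) +
  \int[mu1]_t osc (lebesgue_rV R n) (@kernel_rV n k) (fun p => f (rV_cons (t, p))).
Proof.
move=> ak mf; have [mk k0 k1 k2] := ak.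
have [mK K0 K1 K2] := averaging_rV n ak.
have [mL L0 L1 L2] := averaging_rV n.+1 ak.
pose A (z : 'rV[R]_n.+1 * 'rV[R]_n.+1) :=
  (`|f z.1 - f (rV_cons (z.2 ord0 ord0, rV_tail z.1))| * kernel_rV k z)%:E.
pose B (z : 'rV[R]_n.+1 * 'rV[R]_n.+1) :=
  (`|f (rV_cons (z.2 ord0 ord0, rV_tail z.1)) - f z.2| * kernel_rV k z)%:E.
have mabs := measurableT_comp (@normr_measurable R setT).
have mf1 : measurable_fun setT (fun z : 'rV[R]_n.+1 * 'rV[R]_n.+1 => f z.1).
  exact: (measurableT_comp mf measurable_fst).
have mf2 : measurable_fun setT (fun z : 'rV[R]_n.+1 * 'rV[R]_n.+1 => f z.2).
  exact: (measurableT_comp mf measurable_snd).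
have mf3 : measurable_fun setT (fun z : 'rV[R]_n.+1 * 'rV[R]_n.+1 =>
    f (rV_cons (z.2 ord0 ord0, rV_tail z.1))).
  apply: (measurableT_comp mf); apply: measurable_rV_cons2.
  - exact: (measurableT_comp (@measurable_rV_coord R n.+1 ord0) measurable_snd).
  - exact: (measurableT_comp (@measurable_rV_tail n) measurable_fst).
have mA : measurable_fun setT A.
  apply/measurable_EFinP; apply: measurable_funM => //.
  by apply: mabs; exact: measurable_funB.
have mB : measurable_fun setT B.
  apply/measurable_EFinP; apply: measurable_funM => //.
  by apply: mabs; exact: measurable_funB.
have A0 z : 0 <= A z by rewrite lee_fin mulr_ge0.
have B0 z : 0 <= B z by rewrite lee_fin mulr_ge0.
(* In [A] the tail of y occurs only in the kernel, whose tail factor integrates to one. *)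
have -> : \int[lebesgue_rV R n]_p osc mu1 k (fun t => f (rV_cons (t, p))) =
    \int[lebesgue_rV R n.+1]_x \int[lebesgue_rV R n.+1]_y A (x, y).
  rewrite ge0_integral_rV21; first last.
  - by move=> x; exact: integral_ge0.
  - exact: measurable_fun_fubini_tonelli_F.
  apply: eq_integral => p _; apply: eq_integral => s _.
  rewrite ge0_integral_rV12//; last first.
    exact: (measurableT_comp mA (pair1_measurable _)).
  apply: eq_integral => t _.
  rewrite /A/=; under eq_integral do
    rewrite !rV_cons0 rV_tail_cons kernel_rV_cons !rV_cons0 !rV_tail_cons mulrA EFinM.
  rewrite ge0_integralZl ?K1 ?mule1 ?lee_fin ?mulr_ge0//.
  - by apply/measurable_EFinP; exact: (measurableT_comp mK (pair1_measurable _)).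
  - by move=> q _; rewrite lee_fin.
(* In [B] it is the first coordinate of x that occurs only in the kernel; the integrals are
   reordered to make it innermost. *)
have -> : \int[mu1]_t osc (lebesgue_rV R n) (@kernel_rV n k) (fun p => f (rV_cons (t, p)))
    = \int[lebesgue_rV R n.+1]_x \int[lebesgue_rV R n.+1]_y B (x, y).
  rewrite (fubini_tonelli B)// ge0_integral_rV12; first last.
  - by move=> x; exact: integral_ge0.
  - exact: measurable_fun_fubini_tonelli_G.
  apply: eq_integral => t _; rewrite /osc.
  rewrite (fubini_tonelli (fun z => (`|f (rV_cons (t, z.1)) - f (rV_cons (t, z.2))| *
    kernel_rV k z)%:E))/=; first last.
  - by move=> z; rewrite lee_fin mulr_ge0.
  - apply/measurable_EFinP; apply: measurable_funM => //; apply: mabs.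
    apply: measurable_funB; apply: (measurableT_comp mf); exact: measurable_rV_cons2.
  apply: eq_integral => q _.
  rewrite ge0_integral_rV21//; last first.
    exact: (measurableT_comp mB (pair2_measurable _)).
  apply: eq_integral => p _.
  rewrite /B/=; under eq_integral do
    rewrite !rV_cons0 rV_tail_cons kernel_rV_cons !rV_cons0 !rV_tail_cons
      mulrA mulrAC EFinM.
  rewrite ge0_integralZl ?k2 ?mule1 ?lee_fin ?mulr_ge0//.
  - by apply/measurable_EFinP; exact: (measurableT_comp mk (pair2_measurable _)).
  - by move=> q' _; rewrite lee_fin.
rewrite -ge0_integralD//; first last.
- exact: measurable_fun_fubini_tonelli_F.
- by move=> x _; exact: integral_ge0.
- exact: measurable_fun_fubini_tonelli_F.
- by move=> x _; exact: integral_ge0.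
apply: ge0_le_integral => //.
- by move=> x _; apply: integral_ge0 => y _; rewrite lee_fin mulr_ge0.
- apply: (measurable_fun_fubini_tonelli_F _ (osc_integrand_measurable (averaging_rV n.+1 ak) mf)).
  by move=> z; rewrite lee_fin mulr_ge0.
- by apply: emeasurable_funD; exact: measurable_fun_fubini_tonelli_F.
- move=> x _; rewrite -ge0_integralD//; first last.
  + exact: (measurableT_comp mB (pair1_measurable x)).
  + exact: (measurableT_comp mA (pair1_measurable x)).
  apply: ge0_le_integral => //.
  + by move=> y _; rewrite lee_fin mulr_ge0.
  + exact: (measurableT_comp (osc_integrand_measurable (averaging_rV n.+1 ak) mf) (pair1_measurable x)).
  + apply: emeasurable_funD.
    * exact: (measurableT_comp mA (pair1_measurable x)).
    * exact: (measurableT_comp mB (pair1_measurable x)).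
  + move=> y _; rewrite -EFinD lee_fin -mulrDl ler_wpM2r//.
    exact: ler_distD.
Qed.

End averaging_rV.

Section approx_id_rV.
Context {R : realType}.
Notation mu1 := (@lebesgue_measure R).
Local Open Scope ereal_scope.

Lemma measurable_osc_param d d' (S : measurableType d) (T : measurableType d')
    (mu : {sigma_finite_measure set T -> \bar R}) (k : T * T -> R)
    (f : S * T -> R) : averaging mu k -> measurable_fun setT f ->
  measurable_fun setT (fun s => osc mu k (fun t => f (s, t))).
Proof.
move=> [mk k0 _ _] mf.
pose G (w : (S * T) * T) := (`|f w.1 - f (w.1.1, w.2)| * k (w.1.2, w.2))%:E.
have mG : measurable_fun setT G.
  apply/measurable_EFinP; apply: measurable_funM.
    apply: (measurableT_comp (@normr_measurable R setT)); apply: measurable_funB.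
      exact: (measurableT_comp mf measurable_fst).
    apply: (measurableT_comp mf); apply: measurable_fun_pair => //.
    exact: (measurableT_comp measurable_fst measurable_fst).
  apply: (measurableT_comp mk); apply: measurable_fun_pair => //.
  exact: (measurableT_comp measurable_snd measurable_fst).
have G0 z : 0 <= G z by rewrite lee_fin mulr_ge0.
apply: (measurable_fun_fubini_tonelli_F (fun z => \int[mu]_y G (z, y))).
- exact: measurable_fun_fubini_tonelli_F.
- by move=> z; exact: integral_ge0.
Qed.

(** Almost every slice of f is integrable, so the integrand tends to zero for almost every s; by
    [osc_le] it is dominated by twice the L^1 norm of the slice, which is integrable in s. *)
Lemma osc_integral_cvg0 d d' (S : measurableType d) (T : measurableType d')
    (nu : {sigma_finite_measure set S -> \bar R})
    (mu : {sigma_finite_measure set T -> \bar R}) (k : nat -> T * T -> R)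
    (f : S * T -> R) : approx_id mu k -> (nu \x mu).-integrable setT (EFin \o f) ->
  \int[nu]_s osc mu (k m) (fun t => f (s, t)) @[m --> \oo] --> 0.
Proof.
move=> [ak kcvg] fi; have /integrableP[/measurable_EFinP mf fioo] := fi.
pose g s := \int[mu]_t `|(f (s, t))%:E|.
have mnf : measurable_fun setT (fun z => `|(f z)%:E|).
  by apply: (measurableT_comp (@abse_measurable R setT)); exact/measurable_EFinP.
have gi : nu.-integrable setT g.
  apply/integrableP; split; first exact: (measurable_fun_fubini_tonelli_F _ mnf).
  under eq_integral do rewrite gee0_abs ?integral_ge0//.
  by rewrite -(fubini_tonelli1 (fun z => `|(f z)%:E|)).
have cvg0 : {ae nu, forall s, setT s ->
    osc mu (k m) (fun t => f (s, t)) @[m --> \oo] --> (cst 0 : S -> \bar R) s}.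
  have := ae_integrable1 fi; apply: filterS => s sf _; exact: kcvg.
have dom : {ae nu, forall s m, setT s ->
    `|osc mu (k m) (fun t => f (s, t))| <= (g \+ g) s}.
  apply: aeW => s m _; rewrite gee0_abs ?osc_ge0//.
  apply: osc_le => //; exact: (measurableT_comp mf (pair1_measurable s)).
have [_ _] := @dominated_convergence _ _ _ nu setT measurableT
  (fun m s => osc mu (k m) (fun t => f (s, t))) (cst 0) (g \+ g)
  (fun m => measurable_osc_param (ak m) mf) (measurable_cst _) cvg0
  (integrableD measurableT gi gi) dom.
by rewrite integral_cst// mul0e.
Qed.

(** Induction through [osc_rVS], whose two terms are integrals of oscillations of slices. The base
    case holds because R^0 is a single point. *)
Lemma approx_id_rV n (k : nat -> R * R -> R) : approx_id mu1 k ->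
  approx_id (lebesgue_rV R n) (fun m => @kernel_rV R n (k m)).
Proof.
move=> ak; split; first by move=> m; apply: averaging_rV; case: ak.
elim: n => [f fi|n IH f fi].
  rewrite (_ : (fun m => _) = cst 0); first exact: cvg_cst.
  apply/funext => m; rewrite /osc integral0_eq// => x _; rewrite integral0_eq// => y _.
  by rewrite (thinmx0 x) (thinmx0 y) subrr normr0 mul0r.
have mf : measurable_fun setT f by case/integrableP: fi => /measurable_EFinP.
apply: (@squeeze_cvge _ _ _ _ (cst 0) _ (fun m =>
  \int[lebesgue_rV R n]_p osc mu1 (k m) (fun t => f (rV_cons (t, p))) +
  \int[mu1]_t osc (lebesgue_rV R n) (@kernel_rV R n (k m)) (fun p => f (rV_cons (t, p))))).
- apply: nearW => m; rewrite osc_ge0/=; last by apply: averaging_rV; case: ak.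
  by apply: osc_rVS => //; case: ak.
- exact: cvg_cst.
- have fci := integrable_rV_cons fi.
  rewrite -[X in _ --> X]adde0; apply: cvgeD => //.
  + apply: (osc_integral_cvg0 (f := fun z => f (rV_cons (z.2, z.1)))) => //.
    have /integrableP[mfc fcoo] := fci.
    apply/(integrable21ltyP _ _ _).2.
      apply: (measurableT_comp mfc); exact: measurable_fun_pair.
    move: fcoo; rewrite (fubini_tonelli1 (fun z => `|(EFin \o f) (rV_cons z)|))//.
    exact: (measurableT_comp (@abse_measurable R setT)).
  + apply: (osc_integral_cvg0 (f := fun z => f (rV_cons z))) => //.
    by split; [move=> m; apply: averaging_rV; case: ak|].
Qed.

End approx_id_rV.

Lemma ge0_cvge0P (R : realType) (u : nat -> \bar R) : (forall m, 0 <= u m)%E ->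
  (u m @[m --> \oo] --> 0)%E <->
  (forall e : R, 0 < e -> \forall m \near \oo, (u m <= e%:E)%E).
Proof.
move=> u0; split.
  move=> /fine_cvgP[uf /cvgrPdist_le uc] e e0.
  move: (uc e e0) uf; apply: filterS2 => m + fm.
  by rewrite sub0r normrN -lee_fin /= => /(le_trans _) -> //; rewrite -[leLHS]fineK// lee_fin ler_norm.
move=> h; apply/fine_cvgP; split.
  apply: filterS (h 1 ltr01) => m um; rewrite ge0_fin_numE//.
  by apply: le_lt_trans um _; rewrite ltry.
apply/cvgrPdist_le => e e0; apply: filterS (h e e0) => m um /=.
rewrite sub0r normrN ger0_norm ?fine_ge0// -lee_fin fineK// ge0_fin_numE//.
by apply: le_lt_trans um _; rewrite ltry.
Qed.

Lemma ge0_cvge0_le (R : realType) (u : nat -> \bar R) (e : R) :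
  (u m @[m --> \oo] --> 0)%E -> (forall m, 0 <= u m)%E -> 0 < e ->
  exists N, forall m, (N <= m)%N -> (u m <= e%:E)%E.
Proof. by move=> uc u0 e0; have [N _ hN] := (ge0_cvge0P u0).1 uc e e0; exists N. Qed.

Lemma measurable_patch d (T : measurableType d) (R : realType) (A : set T) (f : T -> R) :
  measurable A -> measurable_fun setT f -> measurable_fun setT (f \_ A).
Proof. by move=> mA mf; apply/(measurable_restrictT f mA).1; exact: measurable_funTS. Qed.

Lemma emeasurable_patch d (T : measurableType d) (R : realType) (A : set T) (f : T -> \bar R) :
  measurable A -> measurable_fun setT f -> measurable_fun setT (f \_ A).
Proof. by move=> mA mf; apply/(measurable_restrictT f mA).1; exact: measurable_funTS. Qed.

Section osc_add.
Context d (T : measurableType d) (R : realType).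
Variable mu : {sigma_finite_measure set T -> \bar R}.
Local Open Scope ereal_scope.

Lemma osc_triangle (k : T * T -> R) (f g : T -> R) :
  averaging mu k -> measurable_fun setT f -> measurable_fun setT g ->
  osc mu k f <= osc mu k g + osc mu k (f \- g)%R.
Proof.
move=> ak mf mg; have [mk k0 _ _] := ak.
have mfg : measurable_fun setT (f \- g)%R by exact: measurable_funB.
have M (h : T -> R) : measurable_fun setT h -> measurable_fun setT (fun x : T => \int[mu]_y (`|h x - h y| * k (x, y))%:E).
  move=> mh; apply: (measurable_fun_fubini_tonelli_F _ (osc_integrand_measurable ak mh)).
  by move=> z; rewrite lee_fin mulr_ge0.
have M1 (h : T -> R) x : measurable_fun setT h -> measurable_fun setT (fun y : T => (`|h x - h y| * k (x, y))%:E).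
  by move=> mh; exact: (measurableT_comp (osc_integrand_measurable ak mh) (pair1_measurable x)).
rewrite -ge0_integralD//; first last.
- exact: M.
- by move=> x _; apply: integral_ge0 => y _; rewrite lee_fin mulr_ge0.
- exact: M.
- by move=> x _; apply: integral_ge0 => y _; rewrite lee_fin mulr_ge0.
apply: ge0_le_integral => //.
- by move=> x _; apply: integral_ge0 => y _; rewrite lee_fin mulr_ge0.
- exact: M.
- by apply: emeasurable_funD; exact: M.
- move=> x _; rewrite -ge0_integralD//; first last.
  + exact: M1.
  + by move=> y _; rewrite lee_fin mulr_ge0.
  + exact: M1.
  + by move=> y _; rewrite lee_fin mulr_ge0.
  apply: ge0_le_integral => //.
  + by move=> y _; rewrite lee_fin mulr_ge0.
  + exact: M1.
  + by apply: emeasurable_funD; exact: M1.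
  + move=> y _; rewrite -EFinD lee_fin -mulrDl ler_wpM2r//=.
    have -> : (f x - f y = (g x - g y) + ((f x - g x) - (f y - g y)))%R by ring.
    exact: ler_normD.
Qed.
End osc_add.

(** * Approximate identities on the line *)

Section approx_id_line.
Context {R : realType}.
Notation mu1 := (@lebesgue_measure R).

Lemma lebesgue_itv_lty (a b : R) : (mu1 `[a, b]%classic < +oo)%E.
Proof. by rewrite lebesgue_measure_itv/=; case: ifP => _; rewrite ?ltry. Qed.

Lemma integrable_tail_small (f : R -> R) (e : R) :
  mu1.-integrable setT (EFin \o f) -> 0 < e ->
  exists N : nat, (\int[mu1]_x `|(f x)%:E - ((f \_ `[- N%:R, N%:R]) x)%:E| <= e%:E)%E.
Proof.
move=> fi e0.
have mf : measurable_fun setT f by case/integrableP: fi => /measurable_EFinP.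
pose f_ (N : nat) := f \_ `[- N%:R : R, N%:R].
have mf_ N : measurable_fun setT (f_ N).
  exact: measurable_patch.
have cvgf : {ae mu1, forall x, setT x -> (f_ N x)%:E @[N --> \oo] --> (f x)%:E}.
  apply: aeW => x _; apply: cvg_near_cst.
  have [N _ hN] : \forall N \near \oo, `|x| <= N%:R by exact: nbhs_infty_ger.
  exists N => // M /= NM; rewrite /f_ patchE mem_set//= in_itv/= -ler_norml.
  exact: hN.
have dom : {ae mu1, forall x N, setT x -> (`|(f_ N x)%:E| <= (abse \o (EFin \o f)) x)%E}.
  by apply: aeW => x N _; rewrite /= lee_fin /f_ patchE; case: ifP => // _; rewrite normr0.
have [_ + _] := @dominated_convergence _ _ _ mu1 setT measurableT
  (fun N x => (f_ N x)%:E) (EFin \o f) (abse \o (EFin \o f))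
  (fun N => (measurable_EFinP _ _).2 (mf_ N)) ((measurable_EFinP _ _).2 mf) cvgf
  (integrable_abse fi) dom.
move=> /ge0_cvge0_le/(_ _ e0)[|N /(_ N (leqnn _)) h].
  by move=> N; apply: integral_ge0.
exists N; apply: le_trans h.
rewrite (_ : (\int[_]_x _)%E = (\int[mu1]_x `|(f_ N x)%:E - (EFin \o f) x|)%E)//.
by apply: eq_integral => x _ /=; rewrite distrC.
Qed.

(** Cutting a continuous function off outside [a, b] creates jumps at a and b only, so dominated
    convergence applies to the inner integrals. *)
Lemma osc_patch_continuous_cvg0 (k : nat -> R * R -> R) (g : R -> R) (a b : R) :
  (forall m, averaging mu1 (k m)) ->
  (forall e, 0 < e -> \forall m \near \oo, forall s t, e <= `|s - t| -> k m (s, t) = 0) ->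
  continuous g -> osc mu1 (k m) (g \_ `[a, b]) @[m --> \oo] --> 0%E.
Proof.
move=> ak ksupp cg; set h := g \_ `[a, b].
(* From [m0] on the kernel vanishes at distance at least 1, so the inner integral vanishes outside
   [a - 1, b + 1]; the sequence is shifted by [m0] to be dominated from its first term. *)
have [m0 _ hm0] := ksupp 1 ltr01.
have [M M0 hM] : exists2 M, 0 <= M & forall x, `|h x| <= M.
  have [c [_ hc]] : bounded_set (g @` `[a, b]).
    apply: compact_bounded; apply: continuous_compact; last exact: segment_compact.
    exact: continuous_subspaceT.
  exists (`|c| + 1) => [|x]; first by rewrite addr_ge0.
  rewrite /h patchE; case: ifPn => [xab|_]; last by rewrite normr0 addr_ge0.
  apply: (hc (`|c| + 1)); first by rewrite (le_lt_trans (ler_norm c))// ltrDl.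
  by exists x => //; rewrite inE in xab.
have mh : measurable_fun setT h.
  by apply: measurable_patch => //; exact: continuous_measurable_fun.
pose F m x := (\int[mu1]_y (`|h x - h y| * k m (x, y))%:E)%E.
have F0 m x : (0 <= F m x)%E.
  by have [_ k0 _ _] := ak m; apply: integral_ge0 => y _; rewrite lee_fin mulr_ge0.
have mF m : measurable_fun setT (F m).
  apply: (measurable_fun_fubini_tonelli_F _ (osc_integrand_measurable (ak m) mh)).
  by have [_ k0 _ _] := ak m; move=> z; rewrite lee_fin mulr_ge0.
have Fle m x c : 0 <= c -> (forall y, `|h x - h y| * k m (x, y) <= c * k m (x, y)) ->
    (F m x <= c%:E)%E.
  move=> c0 hc; have [mk k0 k1 _] := ak m.
  have mkx : measurable_fun setT (fun y => (k m (x, y))%:E).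
    by apply/measurable_EFinP; exact: (measurableT_comp mk (pair1_measurable x)).
  rewrite -[leRHS]mule1 -(k1 x) -ge0_integralZl//; last first.
    by move=> y _; rewrite lee_fin.
  apply: ge0_le_integral => //.
  - by move=> y _; rewrite lee_fin mulr_ge0.
  - exact: (measurableT_comp (osc_integrand_measurable (ak m) mh) (pair1_measurable x)).
  - exact: emeasurable_funM.
  - by move=> y _; rewrite -EFinM lee_fin.
have ind0 x : (0 <= (\1_(`[(a - 1), (b + 1)] : set R) x)%:E :> \bar R)%E by rewrite lee_fin.
pose G x := ((2 * M)%:E * (\1_(`[(a - 1), (b + 1)] : set R) x)%:E)%E.
have Gi : mu1.-integrable setT G.
  by apply: integrableZl => //; exact: integrable_indic_itv.
have dom : {ae mu1, forall x m, setT x -> (`|F (m + m0)%N x| <= G x)%E}.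
  apply: aeW => x m _; rewrite gee0_abs//.
  have [xab|xab] := boolP (x \in `[(a - 1), (b + 1)]).
    rewrite /G indicE mem_set// mule1; apply: Fle => [|y].
      by rewrite mulr_ge0.
    have [_ k0 _ _] := ak (m + m0)%N.
    rewrite ler_wpM2r// (le_trans (ler_normB _ _))// mulr_natl mulr2n.
    by rewrite lerD.
  rewrite /G indicE memNset ?mule0//; last by move/negP: xab.
  apply: Fle => // y; rewrite mul0r.
  have [yab|yab] := boolP (y \in `[a, b]); last first.
    rewrite /h !patchE !memNset; first by rewrite subrr normr0 mul0r.
    - by move=> /= yab'; rewrite yab' in yab.
    - move=> /= xab'; move/negP: xab; apply; move: xab'.
      by rewrite !in_itv/= => /andP[? ?]; apply/andP; split; lra.
  rewrite (hm0 (m + m0)%N) ?mulr0//; first exact: leq_addl.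
  move: xab yab; rewrite !in_itv/= negb_and -!ltNge => xab /andP[? ?].
  have := ler_norm (x - y); have := ler_norm (y - x); rewrite (distrC y x).
  by case/orP: xab => *; lra.
(* The two endpoints form a null set; at any other point [h] is continuous, and the kernel
   eventually sees only a neighbourhood on which [h] varies by at most e. *)
have cvg0 : {ae mu1, forall x, setT x -> F (m + m0)%N x @[m --> \oo] --> (cst 0 : R -> \bar R) x}.
  have : mu1.-negligible [set a; b].
    apply/negligibleP; first exact: measurableU.
    apply: countable_lebesgue_measure0; by apply: finite_set_countable; exact: finite_set2.
  apply: negligibleS => x /= /not_implyP[_ nx]; apply: contrapT => xab; apply: nx.
  rewrite (@cvg_shiftn m0 _ (F ^~ x)).
  apply/ge0_cvge0P => // e e0.
  have [dl dl0 hdl] : exists2 dl : R, 0 < dl & forall y, `|x - y| < dl -> `|h x - h y| <= e.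
    suff /nbhs_ballP[dl dl0 hdl] : \forall y \near x, `|h x - h y| <= e.
      by exists dl => // y xy; exact: hdl.
    have [xa|xa] := ltP x a.
      near=> y; have ya : y < a by near: y; exact: lt_nbhsl.
      rewrite /h !patchE !memNset ?subrr ?normr0 ?(ltW e0)//=;
      by rewrite in_itv/= leNgt ?xa ?ya.
    have [xb|xb] := ltP b x.
      near=> y; have yb : b < y by near: y; exact: lt_nbhsr.
      rewrite /h !patchE !memNset ?subrr ?normr0 ?(ltW e0)//=;
      by rewrite in_itv/= [_ <= b]leNgt ?xb ?yb andbF.
    have xabo : x \in `]a, b[.
      rewrite in_itv/= !lt_neqAle xa xb !andbT; apply/andP; split; apply/eqP => xx; apply: xab; rewrite /= xx; tauto.
    move: (cg x) => /cvgrPdist_le/(_ e e0) cgx.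
    near=> y; rewrite /h !patchE !mem_set//=; first by near: y.
    - apply: subset_itv_oo_cc; near: y; exact: near_in_itvoo.
    - exact: subset_itv_oo_cc.
  apply: filterS (ksupp dl dl0) => m km; apply: Fle; first exact: ltW.
  move=> y; have [_ k0 _ _] := ak m; have [xy|xy] := ltP `|x - y| dl.
    by rewrite ler_wpM2r// hdl.
  by rewrite km// !mulr0.
have [_ _] := @dominated_convergence _ _ _ mu1 setT measurableT
  (fun m => F (m + m0)%N) (cst 0%E) G (fun m => mF _) (measurable_cst _) cvg0 Gi dom.
rewrite integral_cst// mul0e => hc.
by rewrite -(@cvg_shiftn m0).
Unshelve. all: by end_near. Qed.

(** Truncation to a bounded interval and density of continuous functions in L^1 there reduce the
    claim to [osc_patch_continuous_cvg0]. *)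
Lemma approx_id_line (k : nat -> R * R -> R) :
  (forall m, averaging mu1 (k m)) ->
  (forall e, 0 < e -> \forall m \near \oo, forall s t, e <= `|s - t| -> k m (s, t) = 0) ->
  approx_id mu1 k.
Proof.
move=> ak ksupp; split => // f fi.
have mf : measurable_fun setT f by case/integrableP: fi => /measurable_EFinP.
apply/ge0_cvge0P => [m|e e0]; first exact: osc_ge0.
(* The error f - h consists of a tail and an approximation error, each at most e/8, and [osc_le]
   counts it twice: e/2 in all, which leaves e/2 for the oscillation of h. *)
have e8 : 0 < e / 8 by rewrite divr_gt0.
have [N hN] := integrable_tail_small fi e8.
pose E := `[- N%:R : R, N%:R]%classic.
have fiE : mu1.-integrable E (EFin \o f).
  apply: (integrableS measurableT _ _ fi); [exact: measurable_itv|exact: subsetT].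
have [] := @approximation_continuous_integrable R E f _ _ fiE => //.
- exact: measurable_itv.
- exact: lebesgue_itv_lty.
move=> g_ [cg gi].
move=> /ge0_cvge0_le/(_ _ e8)[|p]; first by move=> m; exact: integral_ge0.
move=> /(_ p (leqnn _)) hp.
pose h := g_ p \_ E.
have mg : measurable_fun setT (g_ p) by apply: continuous_measurable_fun; exact: cg.
have mE : measurable (E : set (measurableTypeR R)) by exact: measurable_itv.
have mh : measurable_fun setT h by exact: (measurable_patch mE mg).
have mfE : measurable_fun setT (f \_ E) by exact: (measurable_patch mE mf).
have e2 : 0 < e / 2 by rewrite divr_gt0.
have := osc_patch_continuous_cvg0 (- N%:R) N%:R ak ksupp (cg p).
move=> /ge0_cvge0_le/(_ _ e2)[|n0 hn0]; first by move=> m; exact: osc_ge0.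
exists n0 => // m /hn0 hm /=.
have mabs (u v : R -> R) : measurable_fun setT u -> measurable_fun setT v ->
    measurable_fun setT (fun x => `|u x - v x|%:E).
  move=> mu mv; apply/measurable_EFinP.
  by apply: (measurableT_comp (@normr_measurable R setT)); exact: measurable_funB.
have m2 : measurable_fun setT ((fun x => `|f x - g_ p x|%:E) \_ E).
  exact: (emeasurable_patch mE (mabs _ _ mf mg)).
have fh : (\int[mu1]_x `|(f \- h) x|%:E <= (e / 4)%:E)%E.
  rewrite (_ : e / 4 = e / 8 + e / 8); last by field.
  rewrite EFinD.
  apply: (@le_trans _ _ (\int[mu1]_x `|(f x)%:E - ((f \_ E) x)%:E| +
     \int[mu1]_(x in E) `|(f x - g_ p x)%:E|)%E); last exact: leeD.
  rewrite [X in (_ <= _ + X)%E]integral_mkcond -ge0_integralD//; first last.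
  - by move=> x _; apply: erestrict_ge0 => y _.
  - exact: mabs.
  apply: ge0_le_integral => //.
  - exact: mabs.
  - by apply: emeasurable_funD => //; exact: mabs.
  - move=> x _; rewrite /h/= !patchE; case: ifP => _.
      by rewrite subrr normr0 add0e.
    by rewrite adde0.
apply: (le_trans (osc_triangle (ak m) mf mh)).
rewrite (_ : e = e / 2 + (e / 4 + e / 4)); last by field.
rewrite !EFinD leeD//.
apply: (le_trans (osc_le (ak m) _)); first exact: measurable_funB.
exact: leeD.
Qed.

End approx_id_line.

(** * Pairing square-integrable functions through a kernel *)

Section square_integrable.
Context d (T : measurableType d) (R : realType).
Variable mu : {sigma_finite_measure set T -> \bar R}.
Local Open Scope ereal_scope.

Definition sqint (f : T -> R) : Prop :=
  measurable_fun setT f /\ \int[mu]_x (f x ^+ 2)%:E < +oo.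

(** The hypotheses of the Schur test. They cover derivatives of mollifiers, which change sign and
    are not [averaging]. *)
Definition schur (C : R) (psi : T * T -> R) : Prop :=
  [/\ measurable_fun setT psi, (0 <= C)%R,
      forall x, \int[mu]_y `|psi (x, y)|%:E <= C%:E
    & forall y, \int[mu]_x `|psi (x, y)|%:E <= C%:E].

Lemma averaging_schur k : averaging mu k -> schur 1 k.
Proof.
move=> [mk k0 k1 k2]; split => // [x|y].
- by under eq_integral do rewrite ger0_norm//; rewrite k1.
- by under eq_integral do rewrite ger0_norm//; rewrite k2.
Qed.

Lemma schur_weight_fst C psi (a : T -> R) : schur C psi ->
  measurable_fun setT a -> (forall x, (0 <= a x)%R) ->
  \int[mu \x mu]_z (a z.1 * `|psi z|)%:E <= C%:E * \int[mu]_x (a x)%:E.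
Proof.
move=> sp ma a0; have [mp C0 h1 _] := sp.
have mn : measurable_fun setT (fun z => `|psi z|%R).
  exact: (measurableT_comp (@normr_measurable R setT)).
have m1 : measurable_fun setT (fun z : T * T => (a z.1 * `|psi z|)%:E).
  apply/measurable_EFinP; apply: measurable_funM => //.
  exact: (measurableT_comp ma measurable_fst).
rewrite (fubini_tonelli1 (fun z => (a z.1 * `|psi z|)%:E))//; last first.
  by move=> z; rewrite lee_fin mulr_ge0.
have ma' : measurable_fun setT (EFin \o a) by exact/measurable_EFinP.
rewrite -ge0_integralZl//; last by move=> x _; rewrite lee_fin.
apply: ge0_le_integral => //.
- by move=> x _; apply: integral_ge0 => y _; rewrite lee_fin mulr_ge0.
- by apply: (measurable_fun_fubini_tonelli_F _ m1) => z; rewrite lee_fin mulr_ge0.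
- exact: emeasurable_funM.
- move=> x _; rewrite /fubini_F/=; under eq_integral do rewrite EFinM.
  rewrite ge0_integralZl ?lee_fin//; first by rewrite muleC lee_wpmul2r ?lee_fin.
  + by apply/measurable_EFinP; exact: (measurableT_comp mn (pair1_measurable x)).
Qed.

Lemma schur_weight_snd C psi (a : T -> R) : schur C psi ->
  measurable_fun setT a -> (forall x, (0 <= a x)%R) ->
  \int[mu \x mu]_z (a z.2 * `|psi z|)%:E <= C%:E * \int[mu]_x (a x)%:E.
Proof.
move=> sp ma a0; have [mp C0 _ h2] := sp.
have mn : measurable_fun setT (fun z => `|psi z|%R).
  exact: (measurableT_comp (@normr_measurable R setT)).
have m1 : measurable_fun setT (fun z : T * T => (a z.2 * `|psi z|)%:E).
  apply/measurable_EFinP; apply: measurable_funM => //.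
  exact: (measurableT_comp ma measurable_snd).
rewrite (fubini_tonelli2 (fun z => (a z.2 * `|psi z|)%:E))//; last first.
  by move=> z; rewrite lee_fin mulr_ge0.
have ma' : measurable_fun setT (EFin \o a) by exact/measurable_EFinP.
rewrite -ge0_integralZl//; last by move=> x _; rewrite lee_fin.
apply: ge0_le_integral => //.
- by move=> y _; apply: integral_ge0 => x _; rewrite lee_fin mulr_ge0.
- by apply: (measurable_fun_fubini_tonelli_G _ m1) => z; rewrite lee_fin mulr_ge0.
- exact: emeasurable_funM.
- move=> y _; rewrite /fubini_G/=; under eq_integral do rewrite EFinM.
  rewrite ge0_integralZl ?lee_fin//; first by rewrite muleC lee_wpmul2r ?lee_fin.
  + by apply/measurable_EFinP; exact: (measurableT_comp mn (pair2_measurable y)).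
Qed.

(** Each of the two squares depends on one point only, so the other point is integrated out of |psi|
    at the cost of a factor C. *)
Lemma schur_integrable C psi (u : T * T -> R) (a b : T -> R) : schur C psi ->
  measurable_fun setT u -> sqint a -> sqint b ->
  (forall z, `|u z| <= (a z.1 ^+ 2 + b z.2 ^+ 2) * `|psi z|)%R ->
  (mu \x mu).-integrable setT (EFin \o u).
Proof.
move=> sp mu_ [ma ai] [mb bi] hu; have [mp C0 _ _] := sp.
have mn : measurable_fun setT (fun z => `|psi z|%R).
  exact: (measurableT_comp (@normr_measurable R setT)).
have ma2 : measurable_fun setT (fun x => a x ^+ 2)%R by exact: measurable_funX.
have mb2 : measurable_fun setT (fun x => b x ^+ 2)%R by exact: measurable_funX.
have m1 : measurable_fun setT (fun z : T * T => (a z.1 ^+ 2 * `|psi z|)%:E).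
  apply/measurable_EFinP; apply: measurable_funM => //.
  exact: (measurableT_comp ma2 measurable_fst).
have m2 : measurable_fun setT (fun z : T * T => (b z.2 ^+ 2 * `|psi z|)%:E).
  apply/measurable_EFinP; apply: measurable_funM => //.
  exact: (measurableT_comp mb2 measurable_snd).
apply/integrableP; split; first exact/measurable_EFinP.
apply: (@le_lt_trans _ _ (\int[mu \x mu]_z ((a z.1 ^+ 2 * `|psi z|)%:E + (b z.2 ^+ 2 * `|psi z|)%:E))).
  apply: ge0_le_integral => //.
  - apply/measurable_EFinP; exact: (measurableT_comp (@normr_measurable R setT)).
  - exact: emeasurable_funD.
  - by move=> z _; rewrite -EFinD lee_fin -mulrDl.
rewrite ge0_integralD//; first last.
- by move=> z _; rewrite lee_fin mulr_ge0// sqr_ge0.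
- by move=> z _; rewrite lee_fin mulr_ge0// sqr_ge0.
apply: lte_add_pinfty.
- apply: (le_lt_trans (schur_weight_fst sp ma2 _)) => [x|]; first exact: sqr_ge0.
  by apply: lte_mul_pinfty; rewrite ?lee_fin ?fin_numE.
- apply: (le_lt_trans (schur_weight_snd sp mb2 _)) => [x|]; first exact: sqr_ge0.
  by apply: lte_mul_pinfty; rewrite ?lee_fin ?fin_numE.
Qed.

Lemma ler_normM_sqr (a b : R) : (`|a * b| <= a ^+ 2 + b ^+ 2)%R.
Proof.
rewrite normrM -(real_normK (num_real a)) -(real_normK (num_real b)).
have := normr_ge0 a; have := normr_ge0 b; nra.
Qed.

Lemma schur_integrable_cross C psi f g : schur C psi -> sqint f -> sqint g ->
  (mu \x mu).-integrable setT (fun z => (f z.1 * g z.2 * psi z)%:E).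
Proof.
move=> sp sf sg; have [mp _ _ _] := sp; have [mf _] := sf; have [mg _] := sg.
apply: (schur_integrable sp _ sf sg).
- apply: measurable_funM => //; apply: measurable_funM.
  + exact: (measurableT_comp mf measurable_fst).
  + exact: (measurableT_comp mg measurable_snd).
- by move=> z; rewrite normrM ler_wpM2r// ler_normM_sqr.
Qed.

Lemma sqint_integrableM f g : sqint f -> sqint g ->
  mu.-integrable setT (fun x => (f x * g x)%:E).
Proof.
move=> [mf fi] [mg gi]; apply/integrableP; split.
  by apply/measurable_EFinP; exact: measurable_funM.
apply: (@le_lt_trans _ _ (\int[mu]_x ((f x ^+ 2)%:E + (g x ^+ 2)%:E))).
  apply: ge0_le_integral => //.
  - apply/measurable_EFinP; apply: (measurableT_comp (@normr_measurable R setT)).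
    exact: measurable_funM.
  - by apply: emeasurable_funD; apply/measurable_EFinP; exact: measurable_funX.
  - by move=> x _; rewrite -EFinD lee_fin ler_normM_sqr.
rewrite ge0_integralD//.
- exact: lte_add_pinfty.
- by move=> x _; rewrite lee_fin sqr_ge0.
- by apply/measurable_EFinP; exact: measurable_funX.
- by move=> x _; rewrite lee_fin sqr_ge0.
- by apply/measurable_EFinP; exact: measurable_funX.
Qed.

End square_integrable.

Section approx_id_sqint.
Context d (T : measurableType d) (R : realType).
Variable mu : {sigma_finite_measure set T -> \bar R}.
Local Open Scope ereal_scope.

Definition osc2 (k : T * T -> R) (g : T -> R) : \bar R :=
  \int[mu \x mu]_z ((g z.1 - g z.2) ^+ 2 * k z)%:E.

Lemma osc2_ge0 k g : averaging mu k -> 0 <= osc2 k g.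
Proof.
move=> [_ k0 _ _]; apply: integral_ge0 => z _.
by rewrite lee_fin mulr_ge0 ?sqr_ge0.
Qed.

Lemma measurable_diff (g : T -> R) : measurable_fun setT g ->
  measurable_fun setT (fun z : T * T => g z.1 - g z.2)%R.
Proof.
move=> mg; apply: measurable_funB.
- exact: (measurableT_comp mg measurable_fst).
- exact: (measurableT_comp mg measurable_snd).
Qed.

(** On the bounded part (h x - h y)^2 <= 2 N |h x - h y|, which turns a quadratic oscillation into a
    linear one; the remainder costs only its L^2 norm. The factors 4 come from two uses of (a + b)^2
    <= 2 a^2 + 2 b^2. *)
Lemma osc2_le k (h r : T -> R) (N : R) : averaging mu k ->
  measurable_fun setT h -> measurable_fun setT r -> (forall x, `|h x| <= N)%R ->
  (0 <= N)%R ->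
  osc2 k (h \+ r)%R <= (4 * N)%:E * osc mu k h +
    (4%:E * \int[mu]_x (r x ^+ 2)%:E + 4%:E * \int[mu]_x (r x ^+ 2)%:E).
Proof.
move=> ak mh mr hN N0; have [mk k0 _ _] := ak.
have sk := averaging_schur ak.
have mr2 : measurable_fun setT (fun x => 4 * r x ^+ 2)%R.
  by apply: measurable_funM => //; exact: measurable_funX.
have r20 x : (0 <= 4 * r x ^+ 2)%R by rewrite mulr_ge0// sqr_ge0.
have E4 : 4%:E * \int[mu]_x (r x ^+ 2)%:E = \int[mu]_x (4 * r x ^+ 2)%:E.
  rewrite -ge0_integralZl ?lee_fin//.
  - by apply/measurable_EFinP; exact: measurable_funX.
  - by move=> x _; rewrite lee_fin sqr_ge0.
have m1 : measurable_fun setT (fun z : T * T => (4 * N * (`|h z.1 - h z.2| * k z))%:E).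
  apply/measurable_EFinP; apply: measurable_funM => //; apply: measurable_funM => //.
  apply: (measurableT_comp (@normr_measurable R setT)); exact: measurable_diff.
have m2 : measurable_fun setT (fun z : T * T => (4 * r z.1 ^+ 2 * `|k z|)%:E).
  apply/measurable_EFinP; apply: measurable_funM.
    exact: (measurableT_comp mr2 measurable_fst).
  exact: (measurableT_comp (@normr_measurable R setT)).
have m3 : measurable_fun setT (fun z : T * T => (4 * r z.2 ^+ 2 * `|k z|)%:E).
  apply/measurable_EFinP; apply: measurable_funM.
    exact: (measurableT_comp mr2 measurable_snd).
  exact: (measurableT_comp (@normr_measurable R setT)).
apply: (@le_trans _ _ (\int[mu \x mu]_z ((4 * N * (`|h z.1 - h z.2| * k z))%:E +
    ((4 * r z.1 ^+ 2 * `|k z|)%:E + (4 * r z.2 ^+ 2 * `|k z|)%:E)))).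
  apply: ge0_le_integral => //.
  - by move=> z _; rewrite lee_fin mulr_ge0 ?sqr_ge0.
  - apply/measurable_EFinP; apply: measurable_funM => //; apply: measurable_funX.
    by apply: measurable_diff; exact: measurable_funD.
  - by apply: emeasurable_funD => //; exact: emeasurable_funD.
  - move=> z _; rewrite -!EFinD lee_fin (ger0_norm (k0 z)).
    have -> : (4 * N * (`|h z.1 - h z.2| * k z) + (4 * r z.1 ^+ 2 * k z + 4 * r z.2 ^+ 2 * k z)
      = (4 * N * `|h z.1 - h z.2| + 4 * r z.1 ^+ 2 + 4 * r z.2 ^+ 2) * k z)%R by ring.
    apply: ler_wpM2r => //=.
    have hh : ((h z.1 - h z.2) ^+ 2 <= 2 * N * `|h z.1 - h z.2|)%R.
      rewrite -real_normK ?num_real// expr2 ler_wpM2r//.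
      rewrite (le_trans (ler_normB _ _))// mulrDl !mul1r lerD//; exact: hN.
    have := sqr_ge0 ((h z.1 - h z.2) - (r z.1 - r z.2))%R.
    have := sqr_ge0 (r z.1 + r z.2)%R.
    move: hh; nra.
have nn1 z : 0 <= (4 * N * (`|h z.1 - h z.2| * k z))%:E by rewrite lee_fin !mulr_ge0.
have nn2 z : 0 <= (4 * r z.1 ^+ 2 * `|k z|)%:E by rewrite lee_fin mulr_ge0.
have nn3 z : 0 <= (4 * r z.2 ^+ 2 * `|k z|)%:E by rewrite lee_fin mulr_ge0.
rewrite ge0_integralD//; first last.
- exact: emeasurable_funD.
- by move=> z _; rewrite adde_ge0.
rewrite ge0_integralD//; apply: leeD; last first.
  rewrite E4; apply: leeD.
  - by apply: (le_trans (schur_weight_fst sk mr2 r20)); rewrite mul1e.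
  - by apply: (le_trans (schur_weight_snd sk mr2 r20)); rewrite mul1e.
under eq_integral do rewrite EFinM.
rewrite ge0_integralZl ?lee_fin ?mulr_ge0//; first last.
- by move=> z _; rewrite lee_fin mulr_ge0.
- exact: (osc_integrand_measurable ak mh).
rewrite (fubini_tonelli1 (fun z => (`|h z.1 - h z.2| * k z)%:E))//.
- exact: (osc_integrand_measurable ak mh).
- by move=> z; rewrite lee_fin mulr_ge0.
Qed.

(** The upper cut makes a square-integrable g bounded; the lower one makes it integrable, since |g|
    <= (N + 1) g^2 wherever |g| >= 1/(N + 1). *)
Definition band (g : T -> R) (N : nat) : set T :=
  [set x | N.+1%:R^-1 <= `|g x| <= N.+1%:R]%R.

Lemma measurable_band (g : T -> R) N : measurable_fun setT g -> measurable (band g N).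
Proof.
move=> mg; rewrite (_ : band g N = setT `&` (fun x => `|g x|%R) @^-1` [set` `[N.+1%:R^-1, N.+1%:R]%R]).
  by apply: (measurableT_comp (@normr_measurable R setT) mg) => //; exact: measurable_itv.
by rewrite setTI; apply/seteqP; split => x /=; rewrite in_itv.
Qed.

Lemma band_integrable (g : T -> R) N : sqint mu g -> mu.-integrable setT (EFin \o (g \_ (band g N))).
Proof.
move=> [mg gi]; have mb := measurable_band N mg.
apply/integrableP; split.
  by apply/measurable_EFinP; exact: measurable_patch.
apply: (@le_lt_trans _ _ (\int[mu]_x (N.+1%:R%:E * (g x ^+ 2)%:E))).
  apply: ge0_le_integral => //.
  - apply/measurable_EFinP; apply: (measurableT_comp (@normr_measurable R setT)).
    exact: measurable_patch.
  - by apply: emeasurable_funM => //; apply/measurable_EFinP; exact: measurable_funX.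
  - move=> x _; rewrite -EFinM lee_fin patchE; case: ifPn => [|_]; last first.
      by rewrite normr0 mulr_ge0// sqr_ge0.
    rewrite inE => -[/andP[h1 _]]; rewrite -real_normK ?num_real// expr2 mulrA.
    rewrite ler_peMl// -[leLHS](@mulfV _ N.+1%:R)// ler_wpM2l//.
rewrite ge0_integralZl ?lee_fin//.
- by apply: lte_mul_pinfty; rewrite ?lee_fin ?fin_numE.
- by apply/measurable_EFinP; exact: measurable_funX.
- by move=> x _; rewrite lee_fin sqr_ge0.
Qed.

Lemma band_sq_cvg0 (g : T -> R) : sqint mu g ->
  \int[mu]_x ((g \- (g \_ (band g N)))%R x ^+ 2)%:E @[N --> \oo] --> 0.
Proof.
move=> [mg gi].
have mg2 : measurable_fun setT (fun x => (g x ^+ 2)%:E).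
  by apply/measurable_EFinP; exact: measurable_funX.
have gi2 : mu.-integrable setT (fun x => (g x ^+ 2)%:E).
  apply/integrableP; split => //.
  by under eq_integral do rewrite gee0_abs ?lee_fin ?sqr_ge0//.
have mr N : measurable_fun setT (fun x => ((g \- (g \_ (band g N)))%R x ^+ 2)%:E).
  apply/measurable_EFinP; apply: measurable_funX; apply: measurable_funB => //.
  by apply: measurable_patch => //; exact: measurable_band.
have cvg : {ae mu, forall x, setT x ->
   ((g \- (g \_ (band g N)))%R x ^+ 2)%:E @[N --> \oo] --> (cst 0 : T -> \bar R) x}.
  apply: aeW => x _; apply: cvg_near_cst.
  have [gx0|gx0] := eqVneq (g x) 0%R.
    by apply: nearW => N; rewrite /= patchE gx0; case: ifP; rewrite subrr expr0n.
  have ng0 : (0 < `|g x|)%R by rewrite normr_gt0.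
  have [N1 _ hN1] : \forall N \near \oo, (`|g x| <= N%:R)%R by exact: nbhs_infty_ger.
  have [N2 _ hN2] : \forall N \near \oo, (`|g x|^-1 <= N%:R)%R by exact: nbhs_infty_ger.
  exists (maxn N1 N2) => // N; rewrite /= geq_max => /andP[NN1 NN2].
  rewrite patchE mem_set ?subrr ?expr0n//; apply/andP; split.
    rewrite -[leRHS]invrK lef_pV2 ?posrE ?invr_gt0//.
    by apply: hN2; exact: leqW.
  by apply: hN1; exact: leqW.
have dom : {ae mu, forall x N, setT x ->
    `|((g \- (g \_ (band g N)))%R x ^+ 2)%:E| <= (g x ^+ 2)%:E}.
  apply: aeW => x N _; rewrite gee0_abs ?lee_fin ?sqr_ge0//= patchE.
  by case: ifP => _; rewrite ?subrr ?subr0// expr0n sqr_ge0.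
have [_ _] := @dominated_convergence _ _ _ mu setT measurableT _ _ _ mr (measurable_cst _)
  cvg gi2 dom.
by rewrite integral_cst// mul0e.
Qed.

Lemma osc2_cvg0 k (g : T -> R) : approx_id mu k -> sqint mu g ->
  osc2 (k m) g @[m --> \oo] --> 0.
Proof.
move=> [ak kc] sg; have [mg gi] := sg.
apply/ge0_cvge0P => [m|e e0]; first exact: osc2_ge0.
(* The tolerances e/16 for the remainder and e/(8(N+1)) for the truncated part are calibrated to
   [osc2_le] with bound N + 1: the latter contributes e/2 and the remainder 8 e/16 = e/2. *)
have e16 : (0 < e / 16)%R by rewrite divr_gt0.
have [|N /(_ N (leqnn _)) hN] := ge0_cvge0_le (band_sq_cvg0 sg) _ e16.
  by move=> N; apply: integral_ge0 => x _; rewrite lee_fin sqr_ge0.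
pose h := g \_ (band g N).
have e8 : (0 < e / (8 * N.+1%:R))%R by rewrite divr_gt0// mulr_gt0.
have [|m0 hm0] := ge0_cvge0_le (kc _ (band_integrable N sg)) _ e8.
  by move=> m; exact: osc_ge0.
exists m0 => // m /hm0 hm /=.
have mh : measurable_fun setT h by apply: measurable_patch => //; exact: measurable_band.
have hb x : (`|h x| <= N.+1%:R)%R.
  by rewrite /h patchE; case: ifPn => [|_]; rewrite ?normr0// inE => -[/andP[]].
rewrite (_ : g = h \+ (g \- h))%R; last by apply/funext => x /=; ring.
apply: (le_trans (osc2_le (ak m) mh _ hb _)) => //; first exact: measurable_funB.
rewrite (_ : e = (4 * N.+1%:R) * (e / (8 * N.+1%:R)) + (4 * (e / 16) + 4 * (e / 16)))%R; last first.
  have : (N.+1%:R != 0 :> R)%R by rewrite pnatr_eq0.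
  by move: (N.+1%:R : R)%R => a a0; field.
rewrite !EFinD; apply: leeD; last apply: leeD;
  by rewrite [leRHS]EFinM lee_wpmul2l ?lee_fin ?mulr_ge0.
Qed.

Lemma approx_id_pairing_cvg k (f g : T -> R) : approx_id mu k ->
  sqint mu f -> sqint mu g ->
  \int[mu \x mu]_z (f z.1 * g z.2 * k m z)%:E @[m --> \oo] -->
  \int[mu]_x (f x * g x)%:E.
Proof.
move=> ka sf sg; have [ak _] := ka; have [mf fi] := sf; have [mg gi] := sg.
have isfg := sqint_integrableM sf sg.
have mf1 : measurable_fun setT (fun z : T * T => f z.1) by exact: (measurableT_comp mf measurable_fst).
have mg1 : measurable_fun setT (fun z : T * T => g z.1) by exact: (measurableT_comp mg measurable_fst).
have mg2 : measurable_fun setT (fun z : T * T => g z.2) by exact: (measurableT_comp mg measurable_snd).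
have mf2 : measurable_fun setT (fun x => f x ^+ 2)%R by exact: measurable_funX.
have int1 m : (mu \x mu).-integrable setT (fun z => (f z.1 * g z.2 * k m z)%:E).
  exact: schur_integrable_cross (averaging_schur (ak m)) sf sg.
have int2 m : (mu \x mu).-integrable setT (fun z => (f z.1 * g z.1 * k m z)%:E).
  have [mk k0 _ _] := ak m.
  (* Both factors now sit at the first point, whereas [schur_integrable] wants one function of each
     point; |f| + |g| serves in both slots. *)
  have sfg : sqint mu (fun x => `|f x| + `|g x|)%R.
    split.
      by apply: measurable_funD; exact: (measurableT_comp (@normr_measurable R setT)).
    apply: (@le_lt_trans _ _ (\int[mu]_x ((2 * f x ^+ 2)%:E + (2 * g x ^+ 2)%:E))).
      apply: ge0_le_integral => //.
      - apply/measurable_EFinP; apply: measurable_funX; apply: measurable_funD;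
        exact: (measurableT_comp (@normr_measurable R setT)).
      - by apply: emeasurable_funD; apply/measurable_EFinP; apply: measurable_funM => //; exact: measurable_funX.
      - move=> x _; rewrite -EFinD lee_fin -(real_normK (num_real (f x))) -(real_normK (num_real (g x))).
        have := sqr_ge0 (`|f x| - `|g x|)%R; nra.
    rewrite ge0_integralD//.
    - apply: lte_add_pinfty; (under eq_integral do rewrite EFinM);
      rewrite ge0_integralZl ?lee_fin//; try (by apply: lte_mul_pinfty; rewrite ?lee_fin ?fin_numE);
      try (by move=> x _; rewrite lee_fin sqr_ge0);
      by apply/measurable_EFinP; exact: measurable_funX.
    - by move=> x _; rewrite lee_fin mulr_ge0// sqr_ge0.
    - by apply/measurable_EFinP; apply: measurable_funM => //; exact: measurable_funX.
    - by move=> x _; rewrite lee_fin mulr_ge0// sqr_ge0.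
    - by apply/measurable_EFinP; apply: measurable_funM => //; exact: measurable_funX.
  apply: (schur_integrable (averaging_schur (ak m)) _ sfg sfg).
    by apply: measurable_funM => //; exact: measurable_funM.
  move=> z; rewrite !normrM ler_wpM2r//.
  have := sqr_ge0 (`|f z.2| + `|g z.2|)%R.
  have := normr_ge0 (f z.1); have := normr_ge0 (g z.1); nra.
(* With both factors at the first point the kernel integrates out exactly, so the limit value is
   available for every m and only f(x) (g(y) - g(x)) remains to be estimated. *)
have diag m : \int[mu \x mu]_z (f z.1 * g z.1 * k m z)%:E = \int[mu]_x (f x * g x)%:E.
  have [mk k0 k1 _] := ak m.
  rewrite -(integral12_prod_meas1 (int2 m)); apply: eq_integral => x _.
  rewrite /fubini_F/=; under eq_integral do rewrite EFinM.
  rewrite integralZl//; first by rewrite k1 mule1.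
  have mkx : measurable_fun setT (fun y => (k m (x, y))%:E).
    by apply/measurable_EFinP; exact: (measurableT_comp mk (pair1_measurable x)).
  apply/integrableP; split => //.
  by under eq_integral do rewrite gee0_abs ?lee_fin//; rewrite k1 ltry.
have Ifin : \int[mu]_x (f x * g x)%:E \is a fin_num by apply: integrable_fin_num.
apply/(sube_cvg0 _ Ifin)/cvg_abse0P/ge0_cvge0P => [m|e e0]; first exact: abse_ge0.
pose F := fine (\int[mu]_x (f x ^+ 2)%:E).
have FE : \int[mu]_x (f x ^+ 2)%:E = F%:E.
  rewrite fineK// ge0_fin_numE//; apply: integral_ge0 => x _.
  by rewrite lee_fin sqr_ge0.
have F0 : (0 <= F)%R.
  by apply: fine_ge0; apply: integral_ge0 => x _; rewrite lee_fin sqr_ge0.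
(* The parameter of Young's inequality |a b| <= dl a^2 + b^2 / dl. The first term integrates to at
   most dl F <= e/2, and the second is at most e/2 once the quadratic oscillation is below dl e/2.
   The 1 in F + 1 keeps the denominator positive when F = 0. *)
pose dl := (e / (2 * (F + 1)))%R.
have dl0 : (0 < dl)%R by rewrite divr_gt0// mulr_gt0// ltr_wpDl.
have ed : (0 < dl * e / 2)%R by rewrite divr_gt0// mulr_gt0.
have [|m0 hm0] := ge0_cvge0_le (osc2_cvg0 ka sg) _ ed.
  by move=> m; exact: osc2_ge0.
exists m0 => // m /hm0 hm /=; have [mk k0 _ _] := ak m.
rewrite -(diag m) -integralB//.
apply: (le_trans (le_abse_integral _ _ _)) => //.
  by apply/measurable_EFinP; apply: measurable_funB; apply: measurable_funM => //; exact: measurable_funM.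
have m1 : measurable_fun setT (fun z : T * T => (dl * f z.1 ^+ 2 * `|k m z|)%:E).
  apply/measurable_EFinP; apply: measurable_funM.
    by apply: measurable_funM => //; exact: measurable_funX.
  exact: (measurableT_comp (@normr_measurable R setT)).
have m2 : measurable_fun setT (fun z : T * T => ((g z.1 - g z.2) ^+ 2 * k m z)%:E).
  apply/measurable_EFinP; apply: measurable_funM => //; apply: measurable_funX.
  exact: measurable_diff.
apply: (@le_trans _ _ (\int[mu \x mu]_z ((dl * f z.1 ^+ 2 * `|k m z|)%:E +
    (dl^-1)%:E * ((g z.1 - g z.2) ^+ 2 * k m z)%:E))).
  apply: ge0_le_integral => //.
  - apply/measurable_EFinP; apply: (measurableT_comp (@normr_measurable R setT)).
    by apply: measurable_funB; apply: measurable_funM => //; exact: measurable_funM.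
  - by apply: emeasurable_funD => //; exact: emeasurable_funM.
  - move=> z _; rewrite -EFinM -EFinD lee_fin (ger0_norm (k0 z)).
    have -> : (dl * f z.1 ^+ 2 * k m z + dl^-1 * ((g z.1 - g z.2) ^+ 2 * k m z) =
      (dl * f z.1 ^+ 2 + dl^-1 * (g z.1 - g z.2) ^+ 2) * k m z)%R by ring.
    have -> : (f z.1 * g z.2 * k m z - f z.1 * g z.1 * k m z =
      f z.1 * (g z.2 - g z.1) * k m z)%R by ring.
    rewrite normrM (ger0_norm (k0 z)) ler_wpM2r// normrM.
    rewrite -(real_normK (num_real (f z.1))) -(real_normK (num_real (g z.1 - g z.2)%R)).
    rewrite (distrC (g z.2)); set a := `|f z.1|%R; set b := `|_ - _|%R.
    rewrite -(ler_pM2l dl0) mulrDr [(dl * (dl^-1 * _))%R]mulrA mulfV ?gt_eqF// mul1r.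
    have := sqr_ge0 (dl * a - b)%R; have : (0 <= a)%R by exact: normr_ge0.
    have : (0 <= b)%R by exact: normr_ge0.
    nra.
rewrite ge0_integralD//; first last.
- exact: emeasurable_funM.
- move=> z _; rewrite mule_ge0// lee_fin ?invr_ge0 ?(ltW dl0)//.
  by rewrite mulr_ge0// sqr_ge0.
- move=> z _; rewrite lee_fin; apply: mulr_ge0 => //; apply: mulr_ge0; [exact: ltW|exact: sqr_ge0].
rewrite ge0_integralZl//; first last.
- by rewrite lee_fin invr_ge0 ltW.
- by move=> z _; rewrite lee_fin mulr_ge0// sqr_ge0.
rewrite (_ : e = e / 2 + dl^-1 * (dl * e / 2))%R; last by field; rewrite gt_eqF.
rewrite EFinD; apply: leeD; last first.
  by rewrite EFinM lee_wpmul2l// lee_fin invr_ge0 ltW.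
apply: (le_trans (schur_weight_fst (averaging_schur (ak m)) (a := fun x => dl * f x ^+ 2)%R _ _)).
- by apply: measurable_funM.
- by move=> x; rewrite mulr_ge0 ?sqr_ge0// ltW.
- rewrite mul1e; under eq_integral do rewrite EFinM.
  rewrite ge0_integralZl ?lee_fin ?(ltW dl0)//; first last.
  + by move=> x _; rewrite lee_fin sqr_ge0.
  + exact/measurable_EFinP.
  rewrite FE -EFinM lee_fin.
  rewrite (_ : e / 2 = dl * (F + 1))%R; last first.
    by rewrite /dl; field; rewrite gt_eqF// ltr_wpDl.
  by apply: ler_wpM2l; [exact: ltW|rewrite lerDl].
Qed.

End approx_id_sqint.

(** * Smooth bumps on the line *)

Section flat.
Context {R : realType}.

(** Used at the junction t = 0 of the flat functions, where no formula for the derivative is at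
    hand. *)
Lemma is_derive0_sqr (f : R -> R) (C : R) :
  (forall h, `|f h| <= C * h ^+ 2) -> is_derive (0 : R) 1 f 0.
Proof.
move=> fC.
have f0 : f 0 = 0.
  by apply/normr0_eq0/le_anti; rewrite normr_ge0 andbT (le_trans (fC 0))// expr0n mulr0.
have C0 : 0 <= C by have := fC 1; rewrite expr1n mulr1; apply: le_trans.
have cvg : (fun h : R => h^-1 *: (f (h *: (1 : R) + 0) - f 0)) @ 0^' --> (0 : R).
  apply/cvgrPdist_le => e e0.
  have eC : 0 < e / (C + 1) by rewrite divr_gt0// ltr_wpDl.
  near=> h; rewrite sub0r normrN f0 subr0 addr0 /=.
  have hn0 : h != 0 by near: h; exact: nbhs_dnbhs_neq.
  have hs : `|h| <= e / (C + 1).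
    by near: h; apply: dnbhs0_le.
  rewrite [h *: _]mulr1 normrM normfV ler_pdivrMl ?normr_gt0//.
  apply: (le_trans (fC h)); rewrite -real_normK ?num_real// expr2 mulrA mulrC ler_wpM2l//.
  apply: (@le_trans _ _ ((C + 1) * `|h|)); first by rewrite ler_wpM2r// lerDl.
  by rewrite mulrC -ler_pdivlMr// ltr_wpDl.
apply: DeriveDef; first by apply/cvg_ex; exists 0.
by apply/cvg_lim.
Unshelve. all: by end_near. Qed.

(** The classical exp(-1/t) extended by zero, times a polynomial in 1/t: a family closed under
    differentiation, so that smoothness follows by induction on the order. *)
Definition flat (P : {poly R}) (t : R) : R :=
  if 0 < t then P.[t^-1] * expR (- t^-1) else 0.

(** One term of the exponential series, x^(n+1) / (n+1)! <= exp x. The spare power of x becomes the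
    factor t in [flat_le] when x = 1/t. *)
Lemma expr_expRN_le (x : R) n : 0 < x -> x ^+ n * expR (- x) <= (n.+1)`!%:R * x^-1.
Proof.
move=> x0; rewrite expRN ler_pdivrMr ?expR_gt0// -mulrA mulrCA ler_pdivlMl//.
rewrite -exprS mulrC -ler_pdivrMr ?ltr0n ?fact_gt0//.
by apply: le_trans (expR_ge1Dxn n (ltW x0)); rewrite lerDr.
Qed.

Lemma flat_le (P : {poly R}) : exists C, forall t, `|flat P t| <= C * `|t|.
Proof.
exists (\sum_(i < size P) `|P`_i| * (i.+1)`!%:R) => t; rewrite /flat.
case: ifPn => [t0|_]; last first.
  by rewrite normr0 mulr_ge0//; apply: sumr_ge0 => i _; rewrite mulr_ge0.
rewrite horner_coef mulr_suml mulr_suml; apply: le_trans (ler_norm_sum _ _ _) _.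
apply: ler_sum => i _; rewrite !normrM -!mulrA ler_wpM2l//.
have ti0 : 0 < t^-1 by rewrite invr_gt0.
rewrite (ger0_norm (expR_ge0 _)) (gtr0_norm t0) ger0_norm ?exprn_ge0 ?(ltW ti0)//.
by apply: le_trans (expr_expRN_le i ti0) _; rewrite invrK.
Qed.

(** Trades one degree of the polynomial for a factor t: the linear bound of [flat_le] for [P * 'X]
    becomes the quadratic bound for [P] that [is_derive0_sqr] asks for. *)
Lemma flat_mulX (P : {poly R}) t : flat P t = t * flat (P * 'X) t.
Proof.
rewrite /flat; case: ifPn => [t0|_]; last by rewrite mulr0.
rewrite hornerMX; set p := P.[_]; set E := expR _; field; exact: lt0r_neq0.
Qed.

(** In the variable s = 1/t, d/dt is - s^2 d/ds, applied to P(s) exp(-s). *)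
Definition flat_deriv (P : {poly R}) : {poly R} := (P - P^`()) * 'X^2.

Lemma is_derive_flat (P : {poly R}) t :
  is_derive t (1 : R) (flat P) (flat (flat_deriv P) t).
Proof.
have [t0|t0|->] := ltgtP t 0.
- have -> : flat (flat_deriv P) t = 0 by rewrite /flat ltNge (ltW t0).
  apply: (near_eq_is_derive _ (is_derive_cst (0 : R) t 1)).
  near=> s; rewrite /flat; have s0 : s < 0 by near: s; exact: lt_nbhsl.
  by rewrite ltNge (ltW s0).
- have tn0 : t != 0 by rewrite gt_eqF.
  have dV : is_derive t (1 : R) (fun s : R => s^-1) (- t ^- 2).
    by apply: is_derive_eq (@is_deriveV R id t 1 1 tn0 (is_derive_id _ _)) _; rewrite [_ *: _]mulr1.
  have dNV : is_derive t (1 : R) (fun s : R => - s^-1) (t ^- 2).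
    by apply: is_derive_eq (is_deriveN dV) _; rewrite opprK.
  have d1 := is_derive1_comp (is_derive_poly P t^-1) dV.
  have d2 := @is_derive1_comp R expR (fun s => - s^-1) t _ _ (is_derive_expR (- t^-1)) dNV.
  have d3 : is_derive t (1 : R) (fun s => P.[s^-1] * expR (- s^-1)) (flat (flat_deriv P) t).
    apply: is_derive_eq (is_deriveM d1 d2) _.
    rewrite /flat t0 /flat_deriv !hornerE /= -!exprVn /GRing.scale/=; ring.
  apply: (near_eq_is_derive _ d3).
  near=> s; rewrite /flat; have s0 : 0 < s by near: s; exact: lt_nbhsr.
  by rewrite s0.
- have [C hC] := flat_le (P * 'X).
  have -> : flat (flat_deriv P) (0 : R) = 0 by rewrite /flat ltxx.
  apply: (is_derive0_sqr (C := C)) => h.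
  rewrite flat_mulX normrM -(real_normK (num_real h)) expr2 mulrA [C * _]mulrC -mulrA.
  by rewrite ler_wpM2l.
Unshelve. all: by end_near. Qed.

End flat.

Section smooth_line.
Context {R : realType}.

(** One-variable counterpart of [Ck]; the derivative is a witness, so that explicit formulas can be
    fed into the induction. *)
Fixpoint Ck1 (k : nat) (h : R -> R) : Prop :=
  match k with
  | 0%N => continuous h
  | k'.+1 => exists2 h', forall t, is_derive t (1 : R) h (h' t) & Ck1 k' h'
  end.

Definition smooth1 (h : R -> R) : Prop := forall k, Ck1 k h.

Lemma is_derive_continuous (h : R -> R) (t l : R) : is_derive t (1 : R) h l ->
  {for t, continuous h}.
Proof.
move=> dh; apply: differentiable_continuous; apply/derivable1_diffP.
exact: ex_derive.
Qed.

Lemma Ck1_pred k h : Ck1 k.+1 h -> Ck1 k h.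
Proof.
elim: k h => [h [h' dh _] t|k IH h [h' dh ch]]; first exact: is_derive_continuous (dh t).
by exists h' => //; exact: IH.
Qed.

Lemma Ck1_cst k c : Ck1 k (cst c).
Proof.
elim: k c => [c|k IH c]; first exact: cst_continuous.
by exists (cst 0) => // t; exact: is_derive_cst.
Qed.

Lemma Ck1D k h g : Ck1 k h -> Ck1 k g -> Ck1 k (h \+ g).
Proof.
elim: k h g => [h g ch cg t|k IH h g [h' dh ch] [g' dg cg]].
  by apply: continuousD; [exact: ch|exact: cg].
by exists (h' \+ g'); [move=> t; exact: is_deriveD|exact: IH].
Qed.

Lemma Ck1M k h g : Ck1 k h -> Ck1 k g -> Ck1 k (h \* g).
Proof.
elim: k h g => [h g ch cg t|k IH h g hC gC].
  by apply: continuousM; [exact: ch|exact: cg].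
have [h' dh ch] := hC; have [g' dg cg] := gC.
exists ((h \* g') \+ (g \* h')) => [t|]; first exact: is_deriveM.
by apply: Ck1D; apply: IH => //; exact: Ck1_pred.
Qed.

Lemma is_derive_affine (h h' : R -> R) (a b t : R) :
  (forall t, is_derive t (1 : R) h (h' t)) ->
  is_derive t (1 : R) (fun t => h (a * t + b)) (a * h' (a * t + b)).
Proof.
move=> dh.
have da : is_derive t (1 : R) (fun t => a * t + b) a.
  apply: is_derive_eq (is_deriveD (is_deriveZ a (is_derive_id t 1)) (is_derive_cst b t 1)) _.
  by rewrite addr0 [_ *: _]mulr1.
by apply: is_derive_eq (is_derive1_comp (dh _) da) _; rewrite mulrC.
Qed.

Lemma Ck1_affine k h a b : Ck1 k h -> Ck1 k (fun t => h (a * t + b)).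
Proof.
elim: k h => [h ch t|k IH h [h' dh ch]].
  apply: continuous_comp; last exact: ch.
  by apply: continuousD; [exact: mulrl_continuous|exact: cst_continuous].
exists (fun t => a * h' (a * t + b)) => [t|]; first exact: is_derive_affine.
by apply: (@Ck1M k (cst a)); [exact: Ck1_cst|exact: IH].
Qed.

Lemma smooth1_continuous h : smooth1 h -> continuous h.
Proof. by move=> /(_ 0%N). Qed.

Lemma smooth1_is_derive h t : smooth1 h -> is_derive t (1 : R) h (h^`()%classic t).
Proof.
move=> /(_ 1%N)[h' dh _]; rewrite derive1E.
by have := dh t => dht; rewrite derive_val.
Qed.

Lemma smooth1_derive1 h : smooth1 h -> smooth1 (h^`()%classic).
Proof.
move=> sh k; have [h' dh ch] := sh k.+1.
rewrite (_ : h^`()%classic = h')//; apply/funext => t.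
by rewrite derive1E; have := dh t => dht; rewrite derive_val.
Qed.

Lemma smooth1_affine h a b : smooth1 h -> smooth1 (fun t => h (a * t + b)).
Proof. by move=> sh k; exact: Ck1_affine. Qed.

Lemma smooth1M h g : smooth1 h -> smooth1 g -> smooth1 (h \* g).
Proof. by move=> sh sg k; exact: Ck1M. Qed.

Lemma smooth1_flat P : smooth1 (@flat R P).
Proof.
move=> k; elim: k P => [P t|k IH P]; first exact: is_derive_continuous (is_derive_flat P t).
by exists (flat (flat_deriv P)) => // t; exact: is_derive_flat.
Qed.

End smooth_line.

Section bump.
Context {R : realType}.
Notation mu1 := (@lebesgue_measure R).

(** On ]-1, 1[ this is exp(-1/(1+t)) exp(-1/(1-t)). The redundant coefficients put both factors in
    the shape of [smooth1_affine]. *)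
Definition bump (t : R) : R := flat 1 (1 * t + 1) * flat 1 ((-1) * t + 1).

Lemma smooth1_bump : smooth1 bump.
Proof. by apply: (smooth1M (h := fun t => flat 1 (1 * t + 1))); apply: smooth1_affine; exact: smooth1_flat. Qed.

Lemma flat1_ge0 (t : R) : 0 <= flat 1 t.
Proof. by rewrite /flat; case: ifP => // _; rewrite hornerC mul1r expR_ge0. Qed.

Lemma bump_ge0 t : 0 <= bump t. Proof. by rewrite mulr_ge0// flat1_ge0. Qed.

Lemma bumpN t : bump (- t) = bump t.
Proof. by rewrite /bump mulrC !mulN1r !mul1r opprK. Qed.

Lemma bump_eq0 t : 1 <= `|t| -> bump t = 0.
Proof.
rewrite /bump /flat mul1r mulN1r ler_normr => /orP[t1|t1].
  by rewrite [X in _ * X]ifF ?mulr0//; apply/negbTE; rewrite -leNgt; lra.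
by rewrite [X in X * _]ifF ?mul0r//; apply/negbTE; rewrite -leNgt; lra.
Qed.

(** Both affine arguments are at least 1/2 there, so each factor is at least exp(-2). This makes the
    total mass positive. *)
Lemma bump_lb t : t \in `[(-2^-1), (2^-1)] -> expR (- 4) <= bump t.
Proof.
rewrite in_itv/= => /andP[t1 t2].
have h s : 2^-1 <= s -> expR (-2) <= flat 1 s.
  move=> s2; have s0 : 0 < s by apply: lt_le_trans s2; rewrite invr_gt0.
  rewrite /flat s0 hornerC mul1r ler_expR lerN2 -[leRHS]invrK lef_pV2 ?posrE//.
rewrite (_ : -4 = -2 + -2 :> R); last by ring.
rewrite expRD; apply: ler_pM; rewrite ?expR_ge0//; apply: h; lra.
Qed.

Lemma continuous_integrable_itv (f : R -> R) a b : continuous f ->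
  mu1.-integrable `[a, b] (EFin \o f).
Proof.
move=> cf; apply: continuous_compact_integrable; first exact: segment_compact.
exact: continuous_subspaceT.
Qed.

Lemma continuous_bump : continuous bump.
Proof. exact: smooth1_continuous smooth1_bump. Qed.

Definition bump_mass : R := (\int[mu1]_(t in `[(-1)%R, 1%R]) bump t)%R.

Lemma bump_massE : (\int[mu1]_(t in `[(-1)%R, 1%R]) (bump t)%:E = bump_mass%:E)%E.
Proof.
rewrite /bump_mass /Rintegral fineK//; apply: integrable_fin_num => //.
exact: continuous_integrable_itv continuous_bump.
Qed.

Lemma bump_mass_gt0 : 0 < bump_mass.
Proof.
rewrite -lte_fin -bump_massE.
apply: (@lt_le_trans _ _ (expR (-4))%:E); first by rewrite lte_fin expR_gt0.
apply: (@le_trans _ _ (\int[mu1]_(t in `[(- 2^-1)%R, (2^-1)%R]) (expR (-4))%:E)%E).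
  rewrite integral_cst//= lebesgue_measure_itv/= lte_fin ifT; last by lra.
  by rewrite -EFinD -EFinM lee_fin (_ : 2^-1 - - 2^-1 = 1) ?mulr1//; field.
have mb A : measurable A -> measurable_fun A (fun t => (bump t)%:E).
  by move=> mA; apply/measurable_EFinP; exact: (measurable_funTS (continuous_measurable_fun continuous_bump)).
apply: (@le_trans _ _ (\int[mu1]_(t in `[(- 2^-1)%R, (2^-1)%R]) (bump t)%:E)%E).
  apply: ge0_le_integral => //.
  - exact: mb.
  - by move=> t tI; rewrite lee_fin bump_lb.
apply: ge0_subset_integral => //.
- exact: mb.
- by move=> t _; rewrite lee_fin bump_ge0.
- by move=> t /=; rewrite !in_itv/= => /andP[? ?]; apply/andP; split; lra.
Qed.

Definition mollifier (N : R) (t : R) : R := N / bump_mass * bump (N * t).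

Lemma mollifier_ge0 N t : 0 <= N -> 0 <= mollifier N t.
Proof. by move=> N0; rewrite mulr_ge0 ?bump_ge0// divr_ge0// ltW// bump_mass_gt0. Qed.

Lemma mollifierN N t : mollifier N (- t) = mollifier N t.
Proof. by rewrite /mollifier mulrN bumpN. Qed.

Lemma mollifier_eq0 N t : 1 <= N * `|t| -> 0 <= N -> mollifier N t = 0.
Proof. by move=> Nt N0; rewrite /mollifier bump_eq0 ?mulr0// normrM (ger0_norm N0). Qed.

Lemma smooth1_mollifier N : smooth1 (mollifier N).
Proof.
rewrite /mollifier; apply: (smooth1M (h := cst (N / bump_mass))).
  by move=> k; exact: Ck1_cst.
have -> : (fun t => bump (N * t)) = (fun t => bump (N * t + 0)).
  by apply/funext => t; rewrite addr0.
by apply: smooth1_affine; exact: smooth1_bump.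
Qed.

(* An antiderivative of the bump on a neighbourhood of its support gives the
   total mass of every rescaled translate without a change of variables. *)
Lemma bump_primitive : exists H : R -> R, H 1 - H (-1) = bump_mass /\
  forall t, `|t| <= 1 -> is_derive t (1 : R) H (bump t).
Proof.
pose H x := (\int[mu1]_(t in `[(-2)%R, x]) bump t)%R.
have dH t : `|t| <= 1 -> is_derive t (1 : R) H (bump t).
  rewrite ler_norml => /andP[t1 t2].
  have t22 : t < 2 by lra.
  have tN2 : -2 < t by lra.
  have [dHt eHt] := continuous_FTC1_closed t22 (continuous_integrable_itv (-2) 2 continuous_bump)
    tN2 (@continuous_bump t).
  by apply: DeriveDef => //; rewrite -derive1E.
exists H; split => //; apply: EFin_inj; rewrite -bump_massE EFinB.
have cH t : `|t| <= 1 -> {for t, continuous H}.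
  by move=> t1; exact: is_derive_continuous (dH t t1).
rewrite (continuous_FTC2 (F := H))//.
- by apply: continuous_subspaceT; exact: continuous_bump.
- split.
  + move=> t; rewrite in_itv/= => /andP[t1 t2].
    have t11 : `|t| <= 1 by rewrite ler_norml !ltW.
    by have := dH t t11 => dHt; exact: ex_derive.
  + by apply: cvg_at_right_filter; apply: cH; rewrite normrN normr1.
  + by apply: cvg_at_left_filter; apply: cH; rewrite normr1.
- move=> t; rewrite in_itv/= => /andP[t1 t2].
  have t11 : `|t| <= 1 by rewrite ler_norml !ltW.
  by rewrite derive1E; have := dH t t11 => dHt; rewrite derive_val.
Qed.

Lemma mollifier_integral N s : 0 < N ->
  (\int[mu1]_t (mollifier N (t - s))%:E = 1)%E.
Proof.
move=> N0; have [H [H1 dH]] := bump_primitive.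
have m0 := bump_mass_gt0; have Ni : 0 < N^-1 by rewrite invr_gt0.
have mn0 : bump_mass != 0 by rewrite gt_eqF.
have Nn0 : N != 0 by rewrite gt_eqF.
have arg t : N * (t - s) = N * t + - (N * s) by ring.
have cm : continuous (fun t => mollifier N (t - s)).
  have -> : (fun t => mollifier N (t - s)) = (fun t => mollifier N (1 * t + - s)).
    by apply/funext => t; rewrite mul1r.
  by apply: smooth1_continuous; apply: smooth1_affine; exact: smooth1_mollifier.
pose F t := bump_mass^-1 * H (N * t + - (N * s)).
have dF t : `|N * (t - s)| <= 1 -> is_derive t (1 : R) F (mollifier N (t - s)).
  rewrite arg => /dH dHt.
  have da : is_derive t (1 : R) (fun t => N * t + - (N * s)) N.
    apply: is_derive_eq (is_deriveD (is_deriveZ N (is_derive_id t 1)) (is_derive_cst (- (N * s)) t 1)) _.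
    by rewrite addr0 [_ *: _]mulr1.
  apply: is_derive_eq (is_deriveZ bump_mass^-1 (@is_derive1_comp R H (fun t => N * t + - (N * s)) t _ _ dHt da)) _.
  by rewrite /mollifier arg /GRing.scale/=; ring.
have cF t : `|N * (t - s)| <= 1 -> {for t, continuous F}.
  by move=> t1; exact: is_derive_continuous (dF t t1).
have inI t : s - N^-1 <= t <= s + N^-1 -> `|N * (t - s)| <= 1.
  move=> /andP[t1 t2]; rewrite normrM gtr0_norm// -ler_pdivlMl// mulr1 ler_norml; apply/andP; split; lra.
rewrite (@integral_supp _ _ R mu1 `[s - N^-1, s + N^-1]%classic); last first.
  move=> t /= tI; rewrite mollifier_eq0 ?(ltW N0)//.
  rewrite leNgt; apply/negP => lt1; apply: tI; rewrite in_itv/=.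
  move: lt1; rewrite mulrC -ltr_pdivlMr// div1r ltr_norml => /andP[? ?]; apply/andP; split; lra.
rewrite (continuous_FTC2 (F := F)).
- rewrite -EFinB /F -mulrBr; congr EFin.
  have -> : N * (s + N^-1) + - (N * s) = 1 by field.
  have -> : N * (s - N^-1) + - (N * s) = -1 by field.
  by rewrite H1 mulVf.
- by lra.
- exact: continuous_subspaceT.
- split.
  + move=> t; rewrite in_itv/= => /andP[t1 t2].
    have t11 : `|N * (t - s)| <= 1 by apply: inI; rewrite !ltW.
    by have := dF t t11 => dFt; exact: ex_derive.
  + by apply: cvg_at_right_filter; apply: cF; apply: inI; rewrite lexx/=; lra.
  + by apply: cvg_at_left_filter; apply: cF; apply: inI; rewrite lexx andbT; lra.
- move=> t; rewrite in_itv/= => /andP[t1 t2].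
  have t11 : `|N * (t - s)| <= 1 by apply: inI; rewrite !ltW.
  by rewrite derive1E; have := dF t t11 => dFt; rewrite derive_val.
Qed.

Definition mollifier_kernel (m : nat) (w : R * R) : R := mollifier m.+1%:R (w.2 - w.1).

Lemma mollifier_kernel_approx_id : approx_id mu1 mollifier_kernel.
Proof.
apply: approx_id_line => [m|e e0].
  split.
  - have mm : measurable_fun setT (mollifier m.+1%:R).
      by apply: continuous_measurable_fun; apply: smooth1_continuous; exact: smooth1_mollifier.
    by apply: (measurableT_comp mm); apply: measurable_funB.
  - by move=> z; exact: mollifier_ge0.
  - by move=> x; exact: mollifier_integral.
  (* Evenness of the mollifier reduces the mass in the first variable to that in the second. *)
  - move=> y; under eq_integral do rewrite /mollifier_kernel -mollifierN opprB.
    exact: mollifier_integral.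
have [N _ hN] : \forall N \near \oo, (e^-1 <= N%:R) by exact: nbhs_infty_ger.
exists N => // m /= Nm s t est; rewrite /mollifier_kernel mollifier_eq0// distrC.
rewrite [leLHS](_ : 1 = e^-1 * e); last by rewrite mulVf ?gt_eqF.
apply: ler_pM => //; first by rewrite invr_ge0 ltW.
  exact: ltW.
by apply: hN => /=; exact: leqW.
Qed.

End bump.

(** * Smooth functions and tensor kernels in R^n *)

(** A directional derivative sees only the restriction to a line. This transports partial
    derivatives to functions of one variable and to slices in lower dimension. *)
Lemma eq_quotient_line (R : realType) (V W : normedModType R) (f : V -> R) (g : W -> R)
    (x v : V) (y w : W) : (forall h, f (h *: v + x) = g (h *: w + y)) ->
  'D_v f x = 'D_w g y /\ (derivable f x v <-> derivable g y w).
Proof.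
move=> fg; have f0 : f x = g y by have := fg 0; rewrite !scale0r !add0r.
suff E : (fun h : R => h^-1 *: ((f \o shift x) (h *: v) - f x)) =
         (fun h : R => h^-1 *: ((g \o shift y) (h *: w) - g y)).
  by rewrite /derivable /derive E.
by apply/funext => h /=; rewrite fg f0.
Qed.

Section Ck_rV.
Context {R : realType} {n : nat}.
Implicit Types (f g : 'rV[R]_n -> R) (x : 'rV[R]_n).

Lemma partial_ext_line (j : 'I_n) f (g : R -> R) x :
  (forall s, f (s *: delta_mx ord0 j + x) = g (s + x ord0 j)) ->
  partial j f x = 'D_1 g (x ord0 j).
Proof.
move=> fg; apply: (proj1 (@eq_quotient_line _ _ R^o f g x _ (x ord0 j) 1 _)) => h.
by rewrite fg [h *: 1]mulr1.
Qed.

Lemma Ck_pred k f : Ck k.+1 f -> Ck k f.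
Proof.
elim: k f => [f [df _] x|k IH f [df cf]]; first exact: differentiable_continuous.
by split => // j; exact: IH.
Qed.

Lemma partial_cst (c : R) (j : 'I_n) : partial j (cst c) = cst 0.
Proof. by apply/funext => x; rewrite /partial derive_cst. Qed.

Lemma Ck_cst k (c : R) : Ck k (cst c : 'rV[R]_n -> R).
Proof.
elim: k c => [c|k IH c]; first exact: cst_continuous.
by split => [x|j]; [exact: differentiable_cst|rewrite partial_cst].
Qed.

Lemma partialD (j : 'I_n) f g : (forall x, differentiable f x) ->
  (forall x, differentiable g x) ->
  partial j (f \+ g) = partial j f \+ partial j g.
Proof.
by move=> df dg; apply/funext => x; rewrite /partial deriveD//; exact: diff_derivable.
Qed.

Lemma CkD k f g : Ck k f -> Ck k g -> Ck k (f \+ g).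
Proof.
elim: k f g => [f g cf cg x|k IH f g [df cf] [dg cg]].
  by apply: continuousD; [exact: cf|exact: cg].
split => [x|j]; first by apply: differentiableD; [exact: df|exact: dg].
rewrite (partialD j df dg); apply: IH; [exact: cf|exact: cg].
Qed.

Lemma partialM (j : 'I_n) f g : (forall x, differentiable f x) ->
  (forall x, differentiable g x) ->
  partial j (f \* g) = (f \* partial j g) \+ (g \* partial j f).
Proof.
move=> df dg; apply/funext => x; rewrite /partial.
by have /= -> := deriveM (diff_derivable (df x)) (diff_derivable (dg x)).
Qed.

Lemma CkM k f g : Ck k f -> Ck k g -> Ck k (f \* g).
Proof.
elim: k f g => [f g cf cg x|k IH f g fC gC].
  by apply: continuousM; [exact: cf|exact: cg].
have [df cf] := fC; have [dg cg] := gC.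
split => [x|j]; first exact: differentiableM.
by rewrite partialM//; apply: CkD; apply: IH; [exact: Ck_pred|exact: cg|exact: Ck_pred|exact: cf].
Qed.

Lemma partial_coord (h : R -> R) (i j : 'I_n) :
  partial j (fun x => h (x ord0 i)) =
  cst (i == j)%:R \* (fun x => (h^`()%classic) (x ord0 i)).
Proof.
apply/funext => x /=; case: eqVneq => [->|ij].
  rewrite mul1r derive1E; apply: partial_ext_line => s.
  by rewrite !mxE !eqxx/= mulr1.
rewrite mul0r (@partial_ext_line j _ (cst (h (x ord0 i)))) ?derive_cst// => s.
by rewrite !mxE (negbTE ij) andbF mulr0 add0r.
Qed.

Lemma Ck_coord k (h : R -> R) (i : 'I_n) : smooth1 h -> Ck k (fun x => h (x ord0 i)).
Proof.
elim: k h => [h sh x|k IH h sh].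
  apply: (@continuous_comp _ _ _ (fun x : 'rV[R]_n => x ord0 i) h).
    exact: coord_continuous.
  exact: smooth1_continuous.
split => [x|j]; last first.
  rewrite partial_coord; apply: CkM; first exact: Ck_cst.
  by apply: IH; exact: smooth1_derive1.
apply: (@differentiable_comp _ _ _ _ (fun x : 'rV[R]_n => x ord0 i) h).
  exact: differentiable_coord.
apply/derivable1_diffP; have := smooth1_is_derive (x ord0 i) sh => dh.
exact: ex_derive.
Qed.

Lemma smooth_prod_coord (h : 'I_n -> R -> R) : (forall i, smooth1 (h i)) ->
  smooth (fun x : 'rV[R]_n => \prod_i h i (x ord0 i)).
Proof.
move=> sh k; rewrite -[X in Ck k X]/(fun x : 'rV[R]_n => \prod_(i <- index_enum _) h i (x ord0 i)).
elim: (index_enum _) => [|i s IH].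
  rewrite (_ : (fun x => _) = cst 1); first exact: Ck_cst.
  by apply/funext => x; rewrite big_nil.
have -> : (fun x : 'rV[R]_n => \prod_(j <- i :: s) h j (x ord0 j)) =
    (fun x => h i (x ord0 i)) \* (fun x => \prod_(j <- s) h j (x ord0 j)).
  by apply/funext => x; rewrite big_cons.
exact: CkM (Ck_coord k i (sh i)) IH.
Qed.

Lemma smooth_partial f j : smooth f -> smooth (partial j f).
Proof. by move=> sf k; have [_ h] := sf k.+1; exact: h. Qed.

Lemma smoothM f g : smooth f -> smooth g -> smooth (f \* g).
Proof. by move=> sf sg k; exact: CkM. Qed.

Lemma smoothZ c f : smooth f -> smooth (fun x => c * f x).
Proof. by move=> sf k; apply: (@CkM k (cst c)) => //; exact: Ck_cst. Qed.

Lemma smooth_cst c : smooth (cst c : 'rV[R]_n -> R).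
Proof. by move=> k; exact: Ck_cst. Qed.

Lemma smooth_continuous f : smooth f -> continuous f.
Proof. by move=> /(_ 0%N). Qed.

Lemma smooth_differentiable f x : smooth f -> differentiable f x.
Proof. by move=> /(_ 1%N)[]. Qed.

(** The affine argument lets one formula serve both derivatives of a kernel in y - x: a = 1 for y
    and a = -1 for x. *)
Lemma partial_prod_affine (e : 'I_n -> R -> R) (a : R) (b : 'I_n -> R) j x :
  (forall i, smooth1 (e i)) ->
  partial j (fun x : 'rV[R]_n => \prod_i e i (a * x ord0 i + b i)) x =
  a * \prod_i (if i == j then (e i)^`()%classic else e i) (a * x ord0 i + b i).
Proof.
move=> se; pose C := \prod_(i | i != j) e i (a * x ord0 i + b i).
rewrite (@partial_ext_line j _ (fun s => C * e j (a * s + b j))); last first.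
  move=> s; rewrite (bigD1 j)//= mulrC !mxE !eqxx/= mulr1; congr (_ * _).
  by apply: eq_bigr => i ij; rewrite !mxE (negbTE ij) andbF mulr0 add0r.
have dj := is_derive_affine a (b j) (x ord0 j) (fun t => smooth1_is_derive t (se j)).
have dC := is_deriveZ C dj.
rewrite (@derive_val _ _ _ _ _ _ _ dC) (bigD1 j)//= eqxx.
rewrite [LHS]mulrC -mulrA; congr (_ * (_ * _)).
by apply: eq_bigr => i ij; rewrite (negbTE ij).
Qed.

Lemma compact_box (a b : 'I_n -> R) :
  compact [set x : 'rV[R]_n | forall i, a i <= x ord0 i <= b i].
Proof.
have := @rV_compact R n (fun i => `[a i, b i]%classic) (fun i => @segment_compact R _ _).
congr compact; apply/seteqP; split => x /= h i; have := h i; by rewrite in_itv.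
Qed.

End Ck_rV.

Section tensor_kernel.
Context {R : realType} {n : nat}.
Notation mu1 := (@lebesgue_measure R).
Notation mun := (lebesgue_rV R n).

(** The strict inequality makes the region of vanishing open, so derivatives vanish there too and
    the class is closed under differentiation. *)
Definition bump_like (e : R -> R) : Prop :=
  smooth1 e /\ forall t, 1 < `|t| -> e t = 0.

Lemma bump_like_derive1 e : bump_like e -> bump_like (e^`()%classic).
Proof.
move=> [se e0]; split; first exact: smooth1_derive1.
move=> t t1; rewrite derive1E.
rewrite (@near_eq_derive _ _ _ e (cst 0)) ?derive_cst//.
near=> s; rewrite e0//; near: s.
have cn : {for t, continuous (fun s : R => `|s|)} by exact: norm_continuous.
exact: (cvgr_gt _ cn).
Unshelve. all: by end_near. Qed.

(** Domination by a multiple of an indicator, whose products over coordinates [integral_prod_coord]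
    evaluates explicitly. *)
Lemma bump_like_bounded e : bump_like e ->
  exists B, 0 <= B /\ forall t s, `|e (t - s)| <= B * \1_(`[s - 1, s + 1] : set R) t.
Proof.
move=> [se e0].
have [c [_ hc]] : bounded_set (e @` `[(-1), 1 : R]).
  apply: compact_bounded; apply: continuous_compact; last exact: segment_compact.
  by apply: continuous_subspaceT; exact: smooth1_continuous.
exists (`|c| + 1); split => [|t s]; first by rewrite addr_ge0.
rewrite indicE; have [ts|ts] := boolP (t \in `[(s - 1), (s + 1)]).
  rewrite mem_set//= mulr1; apply: (hc (`|c| + 1)).
    by rewrite (le_lt_trans (ler_norm c))// ltrDl.
  exists (t - s) => //=; move: ts; rewrite !in_itv/= => /andP[? ?]; apply/andP; split; lra.
rewrite memNset ?mulr0; last by move/negP: ts.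
rewrite e0 ?normr0//; move: ts; rewrite in_itv/= negb_and -!ltNge ltr_normr => /orP[ts|ts]; apply/orP.
  by right; lra.
by left; lra.
Qed.

Lemma bump_like_mollifier (N : R) : 1 <= N -> bump_like (mollifier N).
Proof.
move=> N1; have N0 : 0 <= N by apply: le_trans N1.
split; first exact: smooth1_mollifier.
move=> t t1; apply: mollifier_eq0 => //.
by rewrite -[leLHS]mulr1; apply: ler_pM => //; exact: ltW.
Qed.

Lemma integral_indic_itv (B s : R) : 0 <= B ->
  (\int[mu1]_t (B * \1_(`[s - 1, s + 1] : set R) t)%:E = (B * 2)%:E)%E.
Proof.
move=> B0; under eq_integral do rewrite EFinM.
rewrite ge0_integralZl ?lee_fin//; first last.
- by apply/measurable_EFinP; apply: measurable_indic; exact: measurable_itv.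
rewrite integral_indic//= setIT lebesgue_measure_itv/= lte_fin ifT; last by lra.
by rewrite -EFinB -EFinM; congr (_ * _)%:E; ring.
Qed.

(** Each coordinate has its own profile because a partial derivative changes a single factor; this
    keeps the family closed under [derive_at]. *)
Definition tensor_kernel (e : 'I_n -> R -> R) (w : 'rV[R]_n * 'rV[R]_n) : R :=
  \prod_i e i (w.2 ord0 i - w.1 ord0 i).

Definition derive_at (j : 'I_n) (e : 'I_n -> R -> R) (i : 'I_n) : R -> R :=
  if i == j then (e i)^`()%classic else e i.

Lemma bump_like_derive_at j e : (forall i, bump_like (e i)) ->
  forall i, bump_like (derive_at j e i).
Proof. by move=> be i; rewrite /derive_at; case: ifP => // _; exact: bump_like_derive1. Qed.

Lemma derive_atC j l e : derive_at j (derive_at l e) = derive_at l (derive_at j e).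
Proof. by apply/funext => i; rewrite /derive_at; case: eqVneq => // _; case: eqVneq. Qed.

Lemma measurable_tensor_kernel e : (forall i, bump_like (e i)) ->
  measurable_fun setT (tensor_kernel e).
Proof.
move=> be; apply: measurable_prod => i _.
have me : measurable_fun setT (e i).
  by apply: continuous_measurable_fun; apply: smooth1_continuous; case: (be i).
apply: (measurableT_comp me); apply: measurable_funB.
- exact: (measurableT_comp (@measurable_rV_coord R n i) measurable_snd).
- exact: (measurableT_comp (@measurable_rV_coord R n i) measurable_fst).
Qed.

Lemma tensor_kernel_schur e : (forall i, bump_like (e i)) ->
  exists C, schur mun C (tensor_kernel e) /\ forall z, `|tensor_kernel e z| <= C.
Proof.
move=> be.
have [B hB] := choice (fun i => bump_like_bounded (be i)).
have B0 i : 0 <= B i by case: (hB i).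
have le1 z : `|tensor_kernel e z| <=
    \prod_i (B i * \1_(`[z.1 ord0 i - 1, z.1 ord0 i + 1] : set R) (z.2 ord0 i)).
  rewrite normr_prod; apply: ler_prod => i _; rewrite normr_ge0/=.
  by have [_ ->] := hB i.
(* The support condition |x_i - y_i| <= 1 is symmetric, so the same majorant can be centred at
   either point and bounds both marginals by the same constant. *)
have le2 z : `|tensor_kernel e z| <=
    \prod_i (B i * \1_(`[z.2 ord0 i - 1, z.2 ord0 i + 1] : set R) (z.1 ord0 i)).
  apply: le_trans (le1 z) _; apply: ler_prod => i _.
  rewrite mulr_ge0//= ler_wpM2l// !indicE.
  set a := z.1 ord0 i; set b := z.2 ord0 i.
  rewrite (_ : (b \in _) = (a \in `[b - 1, b + 1]%classic))//.
  by rewrite !mem_setE !in_itv/=; apply/andP/andP => -[? ?]; split; lra.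
have mB (i : 'I_n) (s : R) : measurable_fun setT (fun t => B i * \1_(`[s - 1, s + 1] : set R) t).
  by apply: measurable_funM => //; apply: measurable_indic; exact: measurable_itv.
have nB (i : 'I_n) (s t : R) : 0 <= B i * \1_(`[s - 1, s + 1] : set R) t by rewrite mulr_ge0.
have mt := measurable_tensor_kernel be.
have mnt := measurableT_comp (@normr_measurable R setT) mt.
exists (\prod_i (B i * 2)); split; first split => //.
- by apply: prodr_ge0 => i _; rewrite mulr_ge0.
- move=> x; rewrite -(@integral_prod_coord R n _ _ (fun i => mB i (x ord0 i))
    (fun i => nB i (x ord0 i)) (fun i => integral_indic_itv (x ord0 i) (B0 i))).
  apply: ge0_le_integral => //.
  + by apply/measurable_EFinP; exact: (measurableT_comp mnt (pair1_measurable x)).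
  + by apply/measurable_EFinP; exact: (@measurable_prod_coord R n _ (fun i => mB i (x ord0 i))).
  + by move=> y _; rewrite lee_fin; exact: (le1 (x, y)).
- move=> y; rewrite -(@integral_prod_coord R n _ _ (fun i => mB i (y ord0 i))
    (fun i => nB i (y ord0 i)) (fun i => integral_indic_itv (y ord0 i) (B0 i))).
  apply: ge0_le_integral => //.
  + by apply/measurable_EFinP; exact: (measurableT_comp mnt (pair2_measurable y)).
  + by apply/measurable_EFinP; exact: (@measurable_prod_coord R n _ (fun i => mB i (y ord0 i))).
  + by move=> x _; rewrite lee_fin; exact: (le2 (x, y)).
- move=> z; apply: le_trans (le1 z) _; apply: ler_prod => i _.
  rewrite mulr_ge0//= ler_wpM2l// indicE; case: (_ \in _) => /=; lra.
Qed.

Lemma tensor_kernelE_snd e (x y : 'rV[R]_n) :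
  tensor_kernel e (x, y) = \prod_i e i (1 * y ord0 i + - x ord0 i).
Proof. by apply: eq_bigr => i _; rewrite mul1r. Qed.

Lemma tensor_kernelE_fst e (x y : 'rV[R]_n) :
  tensor_kernel e (x, y) = \prod_i e i ((-1) * x ord0 i + y ord0 i).
Proof. by apply: eq_bigr => i _; rewrite mulN1r addrC. Qed.

Lemma partial_tensor_kernel_snd e (l : 'I_n) x y : (forall i, bump_like (e i)) ->
  partial l (fun y => tensor_kernel e (x, y)) y = tensor_kernel (derive_at l e) (x, y).
Proof.
move=> be; rewrite [X in partial _ X _](funext (tensor_kernelE_snd e x)).
rewrite (partial_prod_affine 1 (fun i => - x ord0 i)); last by move=> i; case: (be i).
by rewrite mul1r tensor_kernelE_snd.
Qed.

Lemma partial_tensor_kernel_fst e (l : 'I_n) x y : (forall i, bump_like (e i)) ->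
  partial l (fun x => tensor_kernel e (x, y)) x = - tensor_kernel (derive_at l e) (x, y).
Proof.
move=> be; rewrite [X in partial _ X _](funext (fun x => tensor_kernelE_fst e x y)).
rewrite (partial_prod_affine (-1) (fun i => y ord0 i)); last by move=> i; case: (be i).
by rewrite mulN1r tensor_kernelE_fst.
Qed.

Lemma tensor_kernel_eq0 e (x y : 'rV[R]_n) : (forall i, bump_like (e i)) ->
  ~ (forall i, x ord0 i - 1 <= y ord0 i <= x ord0 i + 1) -> tensor_kernel e (x, y) = 0.
Proof.
move=> be /existsNP[i hi]; rewrite /tensor_kernel (bigD1 i)//=.
have [_ ->] := be i; rewrite ?mul0r// ltNge ler_norml; apply/negP => /andP[h1 h2]; apply: hi.
by apply/andP; split; lra.
Qed.

Lemma test_tensor_kernel_snd e (x : 'rV[R]_n) : (forall i, bump_like (e i)) ->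
  test_function setT (fun y => tensor_kernel e (x, y)).
Proof.
move=> be; split.
  rewrite (funext (tensor_kernelE_snd e x)).
  apply: (smooth_prod_coord (h := fun i t => e i (1 * t + - x ord0 i))) => i.
  by apply: smooth1_affine; case: (be i).
exists [set y : 'rV[R]_n | forall i, x ord0 i - 1 <= y ord0 i <= x ord0 i + 1].
  by split => //; exact: compact_box.
by move=> y hy; exact: tensor_kernel_eq0.
Qed.

Lemma test_tensor_kernel_fst e (y : 'rV[R]_n) : (forall i, bump_like (e i)) ->
  test_function setT (fun x => tensor_kernel e (x, y)).
Proof.
move=> be; split.
  rewrite (funext (fun x => tensor_kernelE_fst e x y)).
  apply: (smooth_prod_coord (h := fun i t => e i ((-1) * t + y ord0 i))) => i.
  by apply: smooth1_affine; case: (be i).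
exists [set x : 'rV[R]_n | forall i, y ord0 i - 1 <= x ord0 i <= y ord0 i + 1].
  by split => //; exact: compact_box.
move=> x hx; apply: tensor_kernel_eq0 => // h; apply: hx => i.
by have /andP[h1 h2] := h i; apply/andP; split; lra.
Qed.

(** From psi^2 <= C |psi|. Square-integrable slices make the inner integrals of a pairing absolutely
    convergent, so that constants can be moved across them. *)
Lemma sqint_tensor_kernel e : (forall i, bump_like (e i)) ->
  (forall x, sqint mun (fun y => tensor_kernel e (x, y))) /\
  (forall y, sqint mun (fun x => tensor_kernel e (x, y))).
Proof.
move=> be; have [C [[mt C0 h1 h2] hC]] := tensor_kernel_schur be.
have mnt := measurableT_comp (@normr_measurable R setT) mt.
split => [x|y].
- split; first exact: (measurableT_comp mt (pair1_measurable x)).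
  apply: (@le_lt_trans _ _ (\int[mun]_y (C%:E * `|tensor_kernel e (x, y)|%:E))%E).
    apply: ge0_le_integral => //.
    + by move=> y _; rewrite lee_fin sqr_ge0.
    + apply/measurable_EFinP; apply: measurable_funX.
      exact: (measurableT_comp mt (pair1_measurable x)).
    + apply: emeasurable_funM => //; apply/measurable_EFinP.
      exact: (measurableT_comp mnt (pair1_measurable x)).
    + by move=> y _; rewrite -EFinM lee_fin -real_normK ?num_real// expr2 ler_wpM2r.
  rewrite ge0_integralZl ?lee_fin//; first last.
  + by apply/measurable_EFinP; exact: (measurableT_comp mnt (pair1_measurable x)).
  by apply: lte_mul_pinfty; rewrite ?lee_fin ?fin_numE// (le_lt_trans (h1 x))// ltry.
- split; first exact: (measurableT_comp mt (pair2_measurable y)).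
  apply: (@le_lt_trans _ _ (\int[mun]_x (C%:E * `|tensor_kernel e (x, y)|%:E))%E).
    apply: ge0_le_integral => //.
    + by move=> x _; rewrite lee_fin sqr_ge0.
    + apply/measurable_EFinP; apply: measurable_funX.
      exact: (measurableT_comp mt (pair2_measurable y)).
    + apply: emeasurable_funM => //; apply/measurable_EFinP.
      exact: (measurableT_comp mnt (pair2_measurable y)).
    + by move=> x _; rewrite -EFinM lee_fin -real_normK ?num_real// expr2 ler_wpM2r.
  rewrite ge0_integralZl ?lee_fin//; first last.
  + by apply/measurable_EFinP; exact: (measurableT_comp mnt (pair2_measurable y)).
  by apply: lte_mul_pinfty; rewrite ?lee_fin ?fin_numE// (le_lt_trans (h2 y))// ltry.
Qed.

End tensor_kernel.

(** * Weak gradients *)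

Section weak_gradient_swap.
Context {R : realType} {n : nat}.
Notation mun := (lebesgue_rV R n).
Local Open Scope ereal_scope.

Definition pairing (f g : 'rV[R]_n -> R) (psi : 'rV[R]_n * 'rV[R]_n -> R) : \bar R :=
  \int[mun \x mun]_z (f z.1 * g z.2 * psi z)%:E.

Lemma pairing12 f g e : sqint mun f -> sqint mun g -> (forall i, bump_like (e i)) ->
  pairing f g (tensor_kernel e) =
  \int[mun]_x ((f x)%:E * \int[mun]_y (g y * tensor_kernel e (x, y))%:E).
Proof.
move=> sf sg be; have [C [sc _]] := tensor_kernel_schur be.
rewrite /pairing -(integral12_prod_meas1 (schur_integrable_cross sc sf sg)).
apply: eq_integral => x _; rewrite /fubini_F/= -integralZl//; last first.
  by apply: sqint_integrableM => //; have [h _] := sqint_tensor_kernel be; exact: h.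
by apply: eq_integral => y _; rewrite -EFinM mulrA.
Qed.

Lemma pairing21 f g e : sqint mun f -> sqint mun g -> (forall i, bump_like (e i)) ->
  pairing f g (tensor_kernel e) =
  \int[mun]_y ((g y)%:E * \int[mun]_x (f x * tensor_kernel e (x, y))%:E).
Proof.
move=> sf sg be; have [C [sc _]] := tensor_kernel_schur be.
rewrite /pairing -(integral21_prod_meas1 (schur_integrable_cross sc sf sg)).
apply: eq_integral => y _; rewrite /fubini_G/= -integralZl//; last first.
  by apply: sqint_integrableM => //; have [_ h] := sqint_tensor_kernel be; exact: h.
by apply: eq_integral => x _; rewrite -EFinM mulrA (mulrC (f x)).
Qed.

Lemma pairing12_integrable f g e : sqint mun f -> sqint mun g -> (forall i, bump_like (e i)) ->
  mun.-integrable setT (fun x => (f x)%:E * \int[mun]_y (g y * tensor_kernel e (x, y))%:E).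
Proof.
move=> sf sg be; have [C [sc _]] := tensor_kernel_schur be.
have := integrable_fubini_F (schur_integrable_cross sc sf sg).
congr (mun.-integrable setT _); apply/funext => x; rewrite /fubini_F/= -integralZl//; last first.
  by apply: sqint_integrableM => //; have [h _] := sqint_tensor_kernel be; exact: h.
by apply: eq_integral => y _; rewrite -EFinM mulrA.
Qed.

Variables (u : 'rV[R]_n -> 'rV[R]_n) (G : 'rV[R]_n -> 'M[R]_n).
Hypothesis su : forall i, sqint mun (fun x => u x ord0 i).
Hypothesis sG : forall i j, sqint mun (fun x => G x i j).
Hypothesis wG : weak_gradient setT u G.

Let weakE phi i j : test_function setT phi ->
  \int[mun]_x (G x i j * phi x)%:E = (-1)%:E * \int[mun]_x (u x ord0 i * partial j phi x)%:E.
Proof. by move=> tphi; rewrite (wG tphi i j) mulN1e oppeK. Qed.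

Lemma pairing_swap e i j k l : (forall i, bump_like (e i)) ->
  pairing (fun x => G x i j) (fun x => G x k l) (tensor_kernel e) =
  (-1)%:E * pairing (fun x => u x ord0 i) (fun x => u x ord0 k)
    (tensor_kernel (derive_at j (derive_at l e))).
Proof.
move=> be; have bel := bump_like_derive_at l be.
(* The derivative l is moved first, in y with x frozen: each slice of the kernel is an admissible
   test function. *)
transitivity ((-1)%:E * pairing (fun x => G x i j) (fun x => u x ord0 k)
    (tensor_kernel (derive_at l e))).
  rewrite !pairing12// -integralZl//; last exact: pairing12_integrable.
  apply: eq_integral => x _; rewrite weakE; last exact: test_tensor_kernel_snd.
  rewrite muleCA; congr (_ * (_ * _)); apply: eq_integral => y _.
  by rewrite partial_tensor_kernel_snd.
(* No further sign arises in x: the minus of the weak derivative cancels the minus of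
   differentiating a function of y - x with respect to x. *)
apply: (congr1 (mule (-1)%:E)).
rewrite (pairing21 (sG i j) (su k) bel) (pairing21 (su i) (su k) (bump_like_derive_at j bel)).
apply: eq_integral => y _; apply: congr1.
rewrite weakE; last exact: test_tensor_kernel_fst.
rewrite -integralZl//; last first.
  apply: sqint_integrableM => //.
  rewrite (funext (fun x => partial_tensor_kernel_fst j x y bel)).
  have [_ /(_ y)[h1 h2]] := sqint_tensor_kernel (bump_like_derive_at j bel).
  split; first exact: measurable_funN.
  by under eq_integral do rewrite sqrrN.
apply: eq_integral => x _; rewrite partial_tensor_kernel_fst//.
by rewrite -EFinM mulrN mulN1r opprK.
Qed.

Lemma weak_gradient_swap i j k l :
  \int[mun]_x (G x i j * G x k l)%:E = \int[mun]_x (G x i l * G x k j)%:E.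
Proof.
have ka := approx_id_rV n (@mollifier_kernel_approx_id R).
have bm m i' : bump_like ((fun _ : 'I_n => mollifier m.+1%:R) i' : R -> R).
  by apply: bump_like_mollifier; rewrite ler1n.
have c1 := approx_id_pairing_cvg ka (sG i j) (sG k l).
have c2 := approx_id_pairing_cvg ka (sG i l) (sG k j).
(* The two pairings agree for every m, by [pairing_swap] and [derive_atC], so their limits do. The
   kernels of [c1] and [c2] are [tensor_kernel] of the mollifier by conversion. *)
apply: (cvg_unique _ c1); first exact: ereal_hausdorff.
apply: cvg_trans c2; apply: near_eq_cvg; apply: nearW => m.
have := pairing_swap i j k l (bm m); rewrite derive_atC -(pairing_swap i l k j (bm m)).
by move=> h; exact: esym h.
Qed.

End weak_gradient_swap.

(** * Integration by parts *)

Section compact_support.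
Context {R : realType}.
Notation mu1 := (@lebesgue_measure R).

(** Compact support in a form inherited by coordinate slices and, thanks to the strict inequality,
    by partial derivatives. *)
Definition supp_box n (M : R) (f : 'rV[R]_n -> R) : Prop :=
  forall (x : 'rV[R]_n) i, M < `|x ord0 i| -> f x = 0.

Lemma compact_supp_box n (K : set 'rV[R]_n) : compact K ->
  exists M, 0 < M /\ forall f : 'rV[R]_n -> R, (forall x, ~ K x -> f x = 0) -> supp_box M f.
Proof.
move=> /compact_bounded[c [_ hc]].
exists (`|c| + 1); split => [|f f0 x i xi]; first by rewrite ltr_wpDl.
apply: f0 => Kx; move: xi; apply/negP; rewrite -leNgt.
apply: le_trans (hc (`|c| + 1) _ x Kx); last by rewrite (le_lt_trans (ler_norm c))// ltrDl.
rewrite [leRHS]mx_normrE.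
exact: (le_bigmax _ (fun ij : 'I_1 * 'I_n => `|x ij.1 ij.2|) (ord0, i)).
Qed.

Lemma continuous_supp_box_bounded n (M : R) (f : 'rV[R]_n -> R) : 0 < M ->
  continuous f -> supp_box M f ->
  exists B, 0 <= B /\ forall x, `|f x| <= B * \prod_i \1_(`[(- M), M] : set R) (x ord0 i).
Proof.
move=> M0 cf sf.
have [c [_ hc]] : bounded_set (f @` [set x : 'rV[R]_n | forall i, - M <= x ord0 i <= M]).
  apply: compact_bounded; apply: continuous_compact; last exact: (@compact_box R n (fun=> - M) (fun=> M)).
  exact: continuous_subspaceT.
exists (`|c| + 1); split => [|x]; first by rewrite addr_ge0.
have [xM|/existsNP[i xi]] := pselect (forall i, - M <= x ord0 i <= M).
  rewrite big1 ?mulr1; last by move=> i _; rewrite indicE mem_set//= in_itv/=.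
  apply: (hc (`|c| + 1)); last by exists x.
  by rewrite (le_lt_trans (ler_norm c))// ltrDl.
rewrite (sf x i) ?normr0; last by rewrite ltNge ler_norml; apply/negP.
by rewrite mulr_ge0 ?addr_ge0// prodr_ge0.
Qed.

Lemma supp_box_integrable n (M : R) (f : 'rV[R]_n -> R) : 0 < M ->
  continuous f -> supp_box M f -> (lebesgue_rV R n).-integrable setT (EFin \o f).
Proof.
move=> M0 cf sf; have [B [B0 hB]] := continuous_supp_box_bounded M0 cf sf.
have mi (i : 'I_n) : measurable_fun setT (\1_(`[(- M), M] : set R) : R -> R).
  by apply: measurable_indic; exact: measurable_itv.
have i0 (i : 'I_n) (t : R) : 0 <= (\1_(`[(- M), M] : set R) : R -> R) t by [].
have hi (i : 'I_n) : (\int[mu1]_t ((\1_(`[(- M), M] : set R) : R -> R) t)%:E = (M + M)%:E)%E.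
  rewrite integral_indic//= setIT lebesgue_measure_itv/= lte_fin ifT; last by lra.
  by rewrite -EFinB opprK.
have mp := measurable_prod_coord mi.
apply/integrableP; split; first by apply/measurable_EFinP; exact: continuous_measurable_rV.
apply: (@le_lt_trans _ _ (\int[lebesgue_rV R n]_x (B%:E * (\prod_i (\1_(`[(- M), M] : set R) : R -> R) (x ord0 i))%:E))%E).
  apply: ge0_le_integral => //.
  - apply: (measurableT_comp (@abse_measurable R setT)); apply/measurable_EFinP; exact: continuous_measurable_rV.
  - by apply: emeasurable_funM => //; exact/measurable_EFinP.
  - by move=> x _; rewrite -EFinM lee_fin.
rewrite ge0_integralZl ?lee_fin//.
- by rewrite (integral_prod_coord mi i0 hi) -EFinM ltry.
- exact/measurable_EFinP.
- by move=> x _; rewrite lee_fin prodr_ge0.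
Qed.

Lemma supp_box_partial n (M : R) (f : 'rV[R]_n -> R) j : supp_box M f -> supp_box M (partial j f).
Proof.
move=> sf x i xi; rewrite /partial.
rewrite (@near_eq_derive _ _ _ f (cst 0)) ?derive_cst//.
near=> y; rewrite (sf y i)//; near: y.
have cn : {for x, continuous (fun y : 'rV[R]_n => `|y ord0 i|)}.
  apply: (@continuous_comp _ _ _ (fun y : 'rV[R]_n => y ord0 i) (fun t : R => `|t|)).
    exact: coord_continuous.
  exact: norm_continuous.
exact: (cvgr_gt _ cn).
Unshelve. all: by end_near. Qed.

Lemma shift_coord n (h : R) (j i : 'I_n) (z : 'rV[R]_n) :
  (h *: delta_mx ord0 j + z) ord0 i = h * (i == j)%:R + z ord0 i.
Proof. by rewrite !mxE eqxx. Qed.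

Lemma rV_cons_shift0 n (h t : R) (y : 'rV[R]_n) :
  rV_cons (h + t, y) = h *: delta_mx ord0 ord0 + rV_cons (t, y).
Proof.
apply/rowP => i; rewrite shift_coord.
case: (unliftP ord0 i) => [k ->|->].
  by rewrite !rV_consS (_ : (lift ord0 k == ord0) = false) ?mulr0 ?add0r.
by rewrite !rV_cons0 eqxx mulr1.
Qed.

Lemma rV_cons_shiftS n (h t : R) (j : 'I_n) (y : 'rV[R]_n) :
  rV_cons (t, h *: delta_mx ord0 j + y) = h *: delta_mx ord0 (lift ord0 j) + rV_cons (t, y).
Proof.
apply/rowP => i; rewrite shift_coord.
case: (unliftP ord0 i) => [k ->|->].
  by rewrite !rV_consS shift_coord (inj_eq lift_inj).
by rewrite !rV_cons0 (_ : (ord0 == lift ord0 j) = false) ?mulr0 ?add0r.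
Qed.

Lemma continuous_rV_consl n (y : 'rV[R]_n) : continuous (fun t : R => rV_cons (t, y)).
Proof.
move=> t A /nbhs_ballP[e /= e0 eA].
suff : nbhs t ((fun t : R => rV_cons (t, y)) @^-1` A) by [].
apply: (filterS _ (nbhsx_ballx t e e0)) => s ts; apply: eA; split => // i j; rewrite (ord1 i).
by case: (unliftP ord0 j) => [k ->|->]; rewrite ?rV_consS ?rV_cons0//; exact: ballxx.
Qed.

Lemma continuous_rV_consr n (t : R) : continuous (fun y : 'rV[R]_n => rV_cons (t, y)).
Proof.
move=> y A /nbhs_ballP[e /= e0 eA].
suff : nbhs y ((fun y : 'rV[R]_n => rV_cons (t, y)) @^-1` A) by [].
apply: (filterS _ (nbhsx_ballx y e e0)) => z [_ yz]; apply: eA; split => // i j; rewrite (ord1 i).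
by case: (unliftP ord0 j) => [k ->|->]; rewrite ?rV_consS ?rV_cons0//; exact: ballxx.
Qed.

(** If j is the first direction, Fubini puts it innermost and the fundamental theorem of calculus
    gives zero on each line; otherwise the first coordinate is frozen and the induction hypothesis
    applies to the slice. *)
Lemma integral_partial_eq0 n (M : R) (f : 'rV[R]_n -> R) j : 0 < M ->
  (forall x, derivable f x (delta_mx ord0 j)) -> continuous (partial j f) ->
  supp_box M f -> (\int[lebesgue_rV R n]_x (partial j f x)%:E = 0)%E.
Proof.
move=> M0; elim: n f j => [f []//|n IH f j df cf sf].
have gi := supp_box_integrable M0 cf (supp_box_partial j sf).
move: df cf sf gi; case: (unliftP ord0 j) => [k ->|->] df cf sf gi.
  rewrite (integral_rV12 gi) integral0_eq// => t _ /=.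
  have line (y : 'rV[R]_n) := @eq_quotient_line _ _ _ (fun y : 'rV[R]_n => f (rV_cons (t, y))) f y (delta_mx ord0 (k : 'I_n))
    (rV_cons (t, y)) (delta_mx ord0 (lift ord0 k))
    (fun h => congr1 f (rV_cons_shiftS h t k y)).
  have pE : partial (k : 'I_n) (fun y : 'rV[R]_n => f (rV_cons (t, y))) =
      (fun y : 'rV[R]_n => partial (lift ord0 k) f (rV_cons (t, y))).
    by apply/funext => y; exact: (line y).1.
  suff : (\int[lebesgue_rV R n]_y (partial (k : 'I_n) (fun y : 'rV[R]_n => f (rV_cons (t, y))) y)%:E = 0)%E.
    by rewrite pE.
  apply: IH.
  - by move=> y; apply/(line y).2; exact: df.
  - rewrite pE => y; apply: continuous_comp; last exact: cf.
    exact: continuous_rV_consr.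
  - by move=> y i yi; apply: (sf _ (lift ord0 i)); rewrite rV_consS.
rewrite (integral_rV21 gi) integral0_eq// => y _ /=.
pose F t := f (rV_cons (t, y)).
have line t := @eq_quotient_line _ R^o _ F f t 1 (rV_cons (t, y)) (delta_mx ord0 ord0)
  (fun h => congr1 f (etrans (congr1 (fun s => rV_cons (s + t, y)) (mulr1 h)) (rV_cons_shift0 h t y))).
have dF t : is_derive t (1 : R) F (partial ord0 f (rV_cons (t, y))).
  apply: DeriveDef; last exact: (line t).1.
  by apply/(line t).2; exact: df.
have F0 t : M < `|t| -> F t = 0 by move=> tM; apply: (sf _ ord0); rewrite rV_cons0.
(* The interval exceeds [-M, M] because [supp_box] gives vanishing only strictly beyond M, and [F]
   has to vanish at both endpoints. *)
rewrite (@integral_supp _ _ R mu1 `[(- (M + 1)), M + 1]%classic); last first.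
  move=> t /= tI; rewrite (supp_box_partial ord0 sf (i := ord0))// rV_cons0 ltNge; apply/negP.
  by move=> tM; apply: tI; rewrite in_itv/=; move: tM; rewrite ler_norml => /andP[? ?]; apply/andP; split; lra.
have cF t : {for t, continuous F} by exact: is_derive_continuous (dF t).
rewrite (continuous_FTC2 (F := F)).
- by rewrite !F0 ?subee// ?normrN gtr0_norm; lra.
- by lra.
- apply: continuous_subspaceT => t; apply: (@continuous_comp _ _ _ (fun t => rV_cons (t, y))); last exact: cf.
  exact: continuous_rV_consl.
- split.
  + by move=> t _; have := dF t => dFt; exact: ex_derive.
  + by apply: cvg_at_right_filter; exact: cF.
  + by apply: cvg_at_left_filter; exact: cF.
- by move=> t _; rewrite derive1E; have := dF t => dFt; rewrite derive_val.
Qed.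

End compact_support.

(** * The Korn identity *)

Lemma mxdotE (R : realType) p q (A B : 'M[R]_(p, q)) :
  mxdot A B = \sum_i \sum_j A i j * B i j.
Proof.
rewrite /mxdot /mxtrace exchange_big; apply: eq_bigr => j _.
by rewrite mxE; apply: eq_bigr => i _; rewrite mxE.
Qed.

Lemma mxdot_ge0 (R : realType) p q (A : 'M[R]_(p, q)) : 0 <= mxdot A A.
Proof.
rewrite mxdotE; apply: sumr_ge0 => i _; apply: sumr_ge0 => j _.
by rewrite -expr2 sqr_ge0.
Qed.

Lemma mxdot_entry_le (R : realType) p q (A : 'M[R]_(p, q)) i j : A i j ^+ 2 <= mxdot A A.
Proof.
rewrite mxdotE (bigD1 i)//= (bigD1 j)//= -expr2 -addrA lerDl addr_ge0//.
  by apply: sumr_ge0 => k _; rewrite -expr2 sqr_ge0.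
by apply: sumr_ge0 => k _; apply: sumr_ge0 => l _; rewrite -expr2 sqr_ge0.
Qed.

Section L2norm_facts.
Context d (T : measurableType d) (R : realType) (mu : {measure set T -> \bar R}).
Context {p q : nat}.
Implicit Types (F : T -> 'M[R]_(p, q)) (D : set T).
Local Open Scope ereal_scope.

Definition sqnorm D F : \bar R := \int[mu]_(x in D) (mxdot (F x) (F x))%:E.

Lemma sqnorm_ge0 D F : 0 <= sqnorm D F.
Proof. by apply: integral_ge0 => x _; rewrite lee_fin mxdot_ge0. Qed.

Lemma L2normE D F : L2norm mu D F = sqrte (sqnorm D F).
Proof.
rewrite /L2norm unlock -poweR12_sqrt ?sqnorm_ge0//; congr (_ `^ _).
rewrite /sqnorm [RHS]integral_mkcond; apply: eq_integral => x _ /=.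
rewrite !patchE; case: ifP => _; last by rewrite abse0 poweR0r// gt_eqF.
rewrite gee0_abs ?lee_fin ?sqrtr_ge0// poweR_EFin powR_mulrn ?sqrtr_ge0//.
by rewrite sqr_sqrtr// mxdot_ge0.
Qed.

Lemma L2norm_le D D' F (F' : T -> 'M[R]_(p, q)) :
  sqnorm D F <= sqnorm D' F' -> L2norm mu D F <= L2norm mu D' F'.
Proof. by move=> h; rewrite !L2normE lee_sqrt// sqnorm_ge0. Qed.

Lemma L2norm_fin_sqnorm D F r : (0 <= r)%R ->
  sqnorm D F = r%:E <-> L2norm mu D F = (Num.sqrt r)%:E.
Proof.
move=> r0; rewrite L2normE; split=> [->//|].
have := sqnorm_ge0 D F; case: (sqnorm D F) => [s| |]//=.
rewrite lee_fin => s0 [/eqP]; rewrite eqr_sqrt// => /eqP -> //.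
Qed.

Lemma L2norm_lty D F : L2norm mu D F < +oo <-> sqnorm D F < +oo.
Proof.
rewrite L2normE; have := sqnorm_ge0 D F.
by case: (sqnorm D F) => [s| |]//= _; rewrite ?ltry.
Qed.

Lemma sqnorm_supp D F : (forall x, ~ D x -> F x = 0%R) -> sqnorm D F = sqnorm setT F.
Proof.
move=> F0; rewrite /sqnorm [LHS]integral_mkcond; apply: eq_integral => x _.
rewrite patchE; case: ifPn => // /negP xD; rewrite F0; first by rewrite mxdotE !big1// => i _; rewrite big1// => j _; rewrite mxE mul0r.
by move=> Dx; apply: xD; rewrite inE.
Qed.

End L2norm_facts.

Section korn_identity.
Context {R : realType} {n : nat}.
Notation mun := (lebesgue_rV R n).
Variables (u : 'rV[R]_n -> 'rV[R]_n) (G : 'rV[R]_n -> 'M[R]_n).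

Lemma sqnorm_entry_le p q (F : 'rV[R]_n -> 'M[R]_(p, q)) i j :
  (forall i j, measurable_fun setT (fun x => F x i j)) ->
  (\int[mun]_x (F x i j ^+ 2)%:E <= sqnorm mun setT F)%E.
Proof.
move=> mF; apply: ge0_le_integral => //.
- by move=> x _; rewrite lee_fin sqr_ge0.
- by apply/measurable_EFinP; apply: measurable_funX; exact: mF.
- apply/measurable_EFinP; under eq_fun do rewrite mxdotE.
  by apply: measurable_sum => k; apply: measurable_sum => l; apply: measurable_funM; exact: mF.
- by move=> x _; rewrite lee_fin mxdot_entry_le.
Qed.

Lemma L2_sqint p q (F : 'rV[R]_n -> 'M[R]_(p, q)) : L2 mun setT F ->
  forall i j, sqint mun (fun x => F x i j).
Proof.
move=> [mF /L2norm_lty Foo] i j; split; first exact: mF.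
exact: le_lt_trans (sqnorm_entry_le i j mF) Foo.
Qed.

(** The double sum is tr(A^2); it is replaced by (tr A)^2 only under the integral. *)
Lemma two_sympart (A : 'M[R]_n) :
  2 * mxdot (sympart A) (sympart A) = mxdot A A + \sum_i \sum_j A i j * A j i.
Proof.
have E1 : mxdot (sympart A) (sympart A) =
    \sum_i \sum_j (4^-1 * (A i j * A i j) + 2^-1 * (A i j * A j i) + 4^-1 * (A j i * A j i)).
  rewrite mxdotE; apply: eq_bigr => i _; apply: eq_bigr => j _.
  by rewrite !mxE; field.
have E2 : \sum_i \sum_j A j i * A j i = mxdot A A by rewrite exchange_big mxdotE.
rewrite E1.
under eq_bigr do rewrite !big_split/= -!mulr_sumr.
by rewrite !big_split/= -!mulr_sumr E2 -mxdotE; field.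
Qed.

Hypothesis Lu : L2 mun setT u.
Hypothesis LG : L2 mun setT G.
Hypothesis wG : weak_gradient setT u G.

Let sG := L2_sqint LG.
Let mG i j : measurable_fun setT (fun x => G x i j) := (sG i j).1.

Let iGG i j k l : mun.-integrable setT (fun x => (G x i j * G x k l)%:E).
Proof. exact: sqint_integrableM. Qed.

Lemma integral_sum2 (a : 'I_n -> 'I_n -> 'rV[R]_n -> R) :
  (forall i j, mun.-integrable setT (EFin \o a i j)) ->
  (\int[mun]_x (\sum_i \sum_j a i j x)%:E = \sum_i \sum_j \int[mun]_x (a i j x)%:E)%E.
Proof.
move=> ia; under eq_integral do rewrite -sumEFin.
rewrite integral_sum//=; last first.
  move=> i; under eq_fun do rewrite -sumEFin.
  by apply: integrable_sum => //= j _; exact: ia.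
apply: eq_bigr => i _; under eq_integral do rewrite -sumEFin.
rewrite integral_sum//= => j; exact: ia.
Qed.

(** Exchanging the two derivative indices in G_ij G_ji yields G_ii G_jj. *)
Lemma integral_transpose_product :
  (\int[mun]_x (\sum_i \sum_j G x i j * G x j i)%:E = \int[mun]_x ((\tr (G x)) ^+ 2)%:E)%E.
Proof.
have trE x : (\tr (G x)) ^+ 2 = \sum_i \sum_j G x i i * G x j j.
  by rewrite expr2 /mxtrace mulr_suml; apply: eq_bigr => i _; rewrite mulr_sumr.
under [RHS]eq_integral do rewrite trE.
rewrite (integral_sum2 (a := fun i j x => G x i j * G x j i)); last by move=> i j; exact: iGG.
rewrite (integral_sum2 (a := fun i j x => G x i i * G x j j)); last by move=> i j; exact: iGG.
apply: eq_bigr => i _; apply: eq_bigr => j _.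
by apply: (weak_gradient_swap (u := u)) => // k; exact: (L2_sqint Lu).
Qed.

Lemma korn_identity :
  (2%:E * sqnorm mun setT (fun x => sympart (G x)) =
   sqnorm mun setT G + \int[mun]_x ((\tr (G x)) ^+ 2)%:E)%E.
Proof.
have mGG : measurable_fun setT (fun x => mxdot (G x) (G x)).
  under eq_fun do rewrite mxdotE.
  by apply: measurable_sum => k; apply: measurable_sum => l; exact: measurable_funM.
have mSS : measurable_fun setT (fun x => mxdot (sympart (G x)) (sympart (G x))).
  under eq_fun do rewrite mxdotE.
  apply: measurable_sum => k; apply: measurable_sum => l.
  under eq_fun do rewrite !mxE.
  apply: measurable_funM; apply: measurable_funM => //; exact: measurable_funD.
rewrite -integral_transpose_product /sqnorm -ge0_integralZl//; first last.
- by move=> x _; rewrite lee_fin mxdot_ge0.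
- exact/measurable_EFinP.
under eq_integral do rewrite -EFinM two_sympart EFinD.
rewrite integralD//; last first.
  under eq_fun do rewrite -sumEFin.
  apply: integrable_sum => // i _; under eq_fun do rewrite -sumEFin.
  by apply: integrable_sum => // j _.
under eq_fun do rewrite mxdotE -sumEFin.
apply: integrable_sum => // i _; under eq_fun do rewrite -sumEFin.
by apply: integrable_sum => // j _.
Qed.

Lemma korn_le : (sqnorm mun setT G <= 2%:E * sqnorm mun setT (fun x => sympart (G x)))%E.
Proof.
by rewrite korn_identity leeDl//; apply: integral_ge0 => x _; rewrite lee_fin sqr_ge0.
Qed.

End korn_identity.

(** * Smooth compactly supported fields and their gradients *)

Section smooth_fields.
Context {R : realType} {n : nat}.
Notation mun := (lebesgue_rV R n).

Lemma smooth_supp_box_integrable (M : R) (f g : 'rV[R]_n -> R) : 0 < M ->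
  continuous f -> continuous g -> supp_box M f ->
  mun.-integrable setT (fun x => (f x * g x)%:E).
Proof.
move=> M0 cf cg sf; apply: (supp_box_integrable (M := M) (f := f \* g)) => //.
  by move=> x; apply: continuousM; [exact: cf|exact: cg].
by move=> x i xi /=; rewrite (sf x i)// mul0r.
Qed.

(** The derivative of f g integrates to zero. Compact support is placed on f alone, so that g may be
    a test function on a larger set or a polynomial. *)
Lemma integration_by_parts_rV (M : R) (f g : 'rV[R]_n -> R) j : 0 < M ->
  smooth f -> smooth g -> supp_box M f ->
  (\int[mun]_x (f x * partial j g x)%:E = - \int[mun]_x (partial j f x * g x)%:E)%E.
Proof.
move=> M0 sf sg bf.
have df x := smooth_differentiable x sf; have dg x := smooth_differentiable x sg.
have pM := partialM j df dg.
have bfg : supp_box M (f \* g) by move=> x i xi /=; rewrite (bf x i)// mul0r.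
have := @integral_partial_eq0 R n M (f \* g) j M0.
have -> : partial j (f \* g) = (fun x => f x * partial j g x + partial j f x * g x).
  by rewrite pM; apply/funext => x /=; rewrite [g x * _]mulrC.
have i1 := smooth_supp_box_integrable M0 (smooth_continuous sf)
  (smooth_continuous (smooth_partial j sg)) bf.
have i2 := smooth_supp_box_integrable M0 (smooth_continuous (smooth_partial j sf))
  (smooth_continuous sg) (supp_box_partial j bf).
under eq_integral do rewrite EFinD.
rewrite integralD// => h.
have fin := integrable_fin_num measurableT i2.
rewrite -[LHS]adde0 -(subee fin) addeA h ?add0e//.
- move=> x; apply: diff_derivable; exact: differentiableM.
- move=> x; apply: (@continuousD _ _ _ (f \* partial j g) (partial j f \* g)); apply: continuousM.
  + exact: smooth_continuous.
  + exact: smooth_continuous (smooth_partial j sg) x.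
  + exact: smooth_continuous (smooth_partial j sf) x.
  + exact: smooth_continuous.
Qed.

Definition grad_mx (v : 'rV[R]_n -> 'rV[R]_n) (x : 'rV[R]_n) : 'M[R]_n :=
  \matrix_(i, j) partial j (fun y => v y ord0 i) x.

Lemma partial_eq0_off (K : set 'rV[R]_n) (f : 'rV[R]_n -> R) j : compact K ->
  (forall x, ~ K x -> f x = 0) -> forall x, ~ K x -> partial j f x = 0.
Proof.
move=> cK f0 x Kx; rewrite /partial (@near_eq_derive _ _ _ f (cst 0)) ?derive_cst//.
have clK : closed K by apply: compact_closed => //; exact: norm_hausdorff.
have : nbhs x (~` K) by apply: open_nbhs_nbhs; split => //; exact: closed_openC.
by apply: filterS => y Ky; rewrite f0.
Qed.

Lemma L2_continuous p q (M : R) (D : set 'rV[R]_n) (F : 'rV[R]_n -> 'M[R]_(p, q)) : 0 < M ->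
  (forall i j, continuous (fun x => F x i j)) -> (forall i j, supp_box M (fun x => F x i j)) ->
  (forall x, ~ D x -> F x = 0) -> L2 mun D F.
Proof.
move=> M0 cF sF F0; split.
  by move=> i j; apply: measurable_funTS; exact: continuous_measurable_rV.
apply/L2norm_lty; rewrite sqnorm_supp// /sqnorm.
have : mun.-integrable setT (fun x => (mxdot (F x) (F x))%:E).
  under eq_fun do rewrite mxdotE -sumEFin.
  apply: integrable_sum => //= i _; under eq_fun do rewrite -sumEFin.
  by apply: integrable_sum => //= j _; exact: (smooth_supp_box_integrable M0).
move=> /integrableP[_]; congr (_ < _)%E; apply: eq_integral => x _.
by rewrite gee0_abs// lee_fin mxdot_ge0.
Qed.

Section smooth_field.
Variables (D K : set 'rV[R]_n) (v : 'rV[R]_n -> 'rV[R]_n).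
Hypothesis sv : forall i, smooth (fun x => v x ord0 i).
Hypothesis cK : compact K.
Hypothesis KD : K `<=` D.
Hypothesis v0 : forall x, ~ K x -> v x = 0.

Let vi0 i x : ~ K x -> v x ord0 i = 0. Proof. by move=> /v0 ->; rewrite mxE. Qed.

Lemma grad_mx_off x : ~ D x -> grad_mx v x = 0.
Proof.
move=> Dx; apply/matrixP => i j; rewrite !mxE; apply: (partial_eq0_off j cK).
  exact: vi0.
by move=> /KD.
Qed.

Lemma field_off x : ~ D x -> v x = 0. Proof. by move=> Dx; apply: v0 => /KD. Qed.

Lemma W12_smooth_field : W12 D v (grad_mx v).
Proof.
have [M [M0 hM]] := compact_supp_box cK.
split.
- apply: (L2_continuous M0) => [i j|i j|]; last exact: field_off.
    by rewrite (ord1 i); exact: smooth_continuous.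
  by rewrite (ord1 i); apply: hM; exact: vi0.
- apply: (L2_continuous M0) => [i j|i j|]; last exact: grad_mx_off.
    rewrite (_ : (fun x => _) = partial j (fun y => v y ord0 i)).
      exact: smooth_continuous (smooth_partial j (sv i)).
    by apply/funext => x; rewrite mxE.
  rewrite (_ : (fun x => _) = partial j (fun y => v y ord0 i)).
    by apply: supp_box_partial; apply: hM; exact: vi0.
  by apply/funext => x; rewrite mxE.
- move=> phi [sphi _] i j.
  have uD x : ~ D x -> (v x ord0 i * partial j phi x)%:E = 0%E.
    by move=> Dx; rewrite field_off// mxE mul0r.
  have GD x : ~ D x -> (grad_mx v x i j * phi x)%:E = 0%E.
    by move=> Dx; rewrite grad_mx_off// mxE mul0r.
  rewrite -(integral_supp uD) -(integral_supp GD).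
  have bv : supp_box M (fun x => v x ord0 i) by apply: hM; exact: vi0.
  rewrite (integration_by_parts_rV j M0 (sv i) sphi bv).
  by congr (- _)%E; apply: eq_integral => x _; rewrite mxE.
Qed.

Lemma integrable_grad_mx i j : mun.-integrable setT (fun x => (grad_mx v x i j)%:E).
Proof.
have [M [M0 hM]] := compact_supp_box cK.
have bv : supp_box M (fun x => v x ord0 i) by apply: hM; exact: vi0.
rewrite (_ : (fun x => _) = EFin \o partial j (fun y => v y ord0 i)).
  apply: (supp_box_integrable M0 _ (supp_box_partial j bv)).
  exact: smooth_continuous (smooth_partial j (sv i)).
by apply/funext => x /=; rewrite mxE.
Qed.

Lemma integral_grad_mx_eq0 i j : (\int[mun]_(x in D) (grad_mx v x i j)%:E = 0)%E.
Proof.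
have [M [M0 hM]] := compact_supp_box cK.
have GD x : ~ D x -> (grad_mx v x i j)%:E = 0%E.
  by move=> Dx; rewrite grad_mx_off// mxE.
rewrite -(integral_supp GD).
have bv : supp_box M (fun x => v x ord0 i) by apply: hM; exact: vi0.
rewrite -[RHS](integral_partial_eq0 (j := j) M0 _ _ bv).
- by apply: eq_integral => x _; rewrite mxE.
- by move=> x; apply: diff_derivable; exact: smooth_differentiable.
- exact: smooth_continuous (smooth_partial j (sv i)).
Qed.

End smooth_field.
End smooth_fields.

(** * The extremal field *)

Section extremal_field.
Context {R : realType} {n : nat}.
Notation mun := (lebesgue_rV R n).

Lemma smooth1_id : smooth1 (id : R -> R).
Proof.
move=> [t|k]; first exact: cvg_id.
by exists (cst 1) => [t|]; [exact: is_derive_id|exact: Ck1_cst].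
Qed.

Lemma partial_coord_id (i : 'I_n) :
  partial i (fun x : 'rV[R]_n => x ord0 i) = cst 1.
Proof.
apply/funext => x; rewrite (partial_coord id i i) eqxx /= mul1r.
by rewrite derive1E (@derive_val _ _ _ _ _ _ _ (is_derive_id _ _)).
Qed.

Lemma partial_coord_sqr (i : 'I_n) :
  partial i (fun x : 'rV[R]_n => x ord0 i * x ord0 i) = (fun x => 2 * x ord0 i).
Proof.
have di x : differentiable (fun x : 'rV[R]_n => x ord0 i) x by exact: differentiable_coord.
have E := partialM i di di; rewrite partial_coord_id in E.
apply: (etrans E); apply/funext => x /=; rewrite /cst; ring.
Qed.

(* Testing against [x_i ^ 2]: two integrations by parts turn the second
   derivative of [f] back into [f]. *)
Lemma second_partial_integral_neq0 (M : R) (f : 'rV[R]_n -> R) (i : 'I_n) : 0 < M ->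
  smooth f -> supp_box M f -> (\int[mun]_x (f x)%:E = 1)%E ->
  (\int[mun]_x ((partial i (partial i f) x) ^+ 2)%:E != 0)%E.
Proof.
move=> M0 sf bf f1; apply/eqP => h0.
have sc : smooth (fun x : 'rV[R]_n => x ord0 i).
  by move=> k; apply: (Ck_coord k i smooth1_id).
have sff := smooth_partial i (smooth_partial i sf).
have mff : measurable_fun setT (partial i (partial i f)).
  exact: continuous_measurable_rV (smooth_continuous sff).
have e1 := integration_by_parts_rV i M0 sf sc bf.
have e2 := integration_by_parts_rV i M0 (smooth_partial i sf) (smoothM sc sc)
  (supp_box_partial i bf).
have z2 : (\int[mun]_x (partial i (partial i f) x * (x ord0 i * x ord0 i))%:E = 0)%E.
  have : ae_eq mun setT (fun x => ((partial i (partial i f) x) ^+ 2)%:E) (cst 0%E).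
    apply/ae_eq_integral_abs => //.
      by apply/measurable_EFinP; exact: measurable_funX.
    rewrite -[RHS]h0; apply: eq_integral => x _.
    by rewrite gee0_abs// lee_fin sqr_ge0.
  move=> ae0; rewrite -[RHS](integral0 mun setT); apply: ae_eq_integral => //.
    apply/measurable_EFinP; apply: measurable_funM => //.
    exact: continuous_measurable_rV (smooth_continuous (smoothM sc sc)).
  apply: filterS ae0 => x /(_ I)/= [/eqP]; rewrite sqrf_eq0 => /eqP -> _.
  by rewrite mul0r.
move: e2; rewrite /= z2 oppe0.
rewrite (_ : (fun x => _) = (fun x => (partial i f x * (2 * x ord0 i))%:E)); last first.
  by apply/funext => x; rewrite partial_coord_sqr.
under eq_integral do rewrite mulrCA EFinM.
have i1 := smooth_supp_box_integrable M0 (smooth_continuous (smooth_partial i sf))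
  (smooth_continuous sc) (supp_box_partial i bf).
rewrite integralZl//.
have {}e1 : (1 = - \int[mun]_x (partial i f x * x ord0 i)%:E)%E.
  by rewrite -f1 -e1 partial_coord_id; apply: eq_integral => x _; rewrite /cst mulr1.
move=> /eqP; rewrite mule_eq0 => /orP[|/eqP e20].
  by rewrite eqe pnatr_eq0.
by move: e1; rewrite e20 oppe0 => /eqP; rewrite onee_eq0.
Qed.

Lemma sum_pair (t : 'I_n -> R) (i0 i1 : 'I_n) : i0 != i1 ->
  (forall i, i != i0 -> i != i1 -> t i = 0) -> \sum_i t i = t i0 + t i1.
Proof.
move=> i01 t0; rewrite (bigD1 i0)//= (bigD1 i1) 1?eq_sym//=.
by rewrite big1 ?addr0// => i /andP[]; exact: t0.
Qed.

(** The field is the rotated gradient of a bump [psi] in the plane of [i0] and [i1]: its only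
    nonzero diagonal derivatives are mixed second derivatives of [psi] with opposite signs. *)
Lemma extremal_field (Omega : set 'rV[R]_n) (x0 : 'rV[R]_n) (i0 i1 : 'I_n) :
  i0 != i1 -> open Omega -> Omega x0 ->
  exists (K : set 'rV[R]_n) (v : 'rV[R]_n -> 'rV[R]_n),
    [/\ compact K, K `<=` Omega, forall i, smooth (fun x => v x ord0 i),
        forall x, ~ K x -> v x = 0 &
    [/\ forall x, \tr (grad_mx v x) = 0,
        (sqnorm mun setT (grad_mx v) < +oo)%E &
        sqnorm mun setT (grad_mx v) != 0%E]].
Proof.
move=> i01 oO Ox0.
have [r /= r0 rO] : exists2 r : R, 0 < r & ball x0 r `<=` Omega.
  by apply/nbhs_ballP; exact: open_nbhs_nbhs.
(* At least 1, as [bump_like_mollifier] requires, and larger than 1/r, so that the support box of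
   half-width 1/N fits in the ball. *)
pose N : R := 1 + 2 / r.
have N1 : 1 <= N by rewrite lerDl divr_ge0// ltW.
have N0 : 0 < N by apply: lt_le_trans N1.
have Nr : N^-1 < r.
  rewrite -[r]invrK ltf_pV2 ?posrE ?invr_gt0//.
  have : 0 < r^-1 by rewrite invr_gt0.
  by rewrite /N; lra.
pose e (i : 'I_n) := mollifier N : R -> R.
have be i : bump_like (e i) by exact: bump_like_mollifier.
pose K := [set x : 'rV[R]_n | forall i, x0 ord0 i - N^-1 <= x ord0 i <= x0 ord0 i + N^-1].
have cK : compact K by exact: compact_box.
have KO : K `<=` Omega.
  move=> x Kx; apply: rO => /=; split=> // i j; rewrite (ord1 i).
  have /andP[h1 h2] := Kx j; rewrite /ball/= ltr_norml; apply/andP; split; lra.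
pose psi x := tensor_kernel e (x0, x).
have spsi : smooth psi by have [] := test_tensor_kernel_snd x0 be.
have psi0 x : ~ K x -> psi x = 0.
  move=> /existsNP[i hi]; rewrite /psi /tensor_kernel (bigD1 i)//= /e mollifier_eq0 ?mul0r//; last exact: ltW.
  rewrite leNgt; apply/negP => lt1; apply: hi.
  move: lt1; rewrite mulrC -ltr_pdivlMr// div1r ltr_norml => /andP[? ?]; apply/andP; split; lra.
have psi1 : (\int[mun]_x (psi x)%:E = 1)%E.
  rewrite (integral_prod_coord (h := fun i t => mollifier N (t - x0 ord0 i)) (c := fun=> 1)).
  - by rewrite big1.
  - move=> i; have mm : measurable_fun setT (mollifier N).
      by apply: continuous_measurable_fun; apply: smooth1_continuous; exact: smooth1_mollifier.
    by apply: (measurableT_comp mm); apply: measurable_funB.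
  - by move=> i t; apply: mollifier_ge0; exact: ltW.
  - by move=> i; exact: mollifier_integral.
have dC : partial i0 (partial i1 psi) = partial i1 (partial i0 psi).
  have E i : partial i psi = fun x => tensor_kernel (derive_at i e) (x0, x).
    by apply/funext => x; exact: partial_tensor_kernel_snd.
  have b i := bump_like_derive_at i be.
  by rewrite !E; apply/funext => x; rewrite !partial_tensor_kernel_snd// derive_atC.
pose v x : 'rV[R]_n := \row_i (if i == i0 then partial i1 psi x
                               else if i == i1 then - partial i0 psi x else 0).
have v_i0 : (fun x => v x ord0 i0) = partial i1 psi.
  by apply/funext => x; rewrite mxE eqxx.
have v_i1 : (fun x => v x ord0 i1) = (fun x => - partial i0 psi x).
  by apply/funext => x; rewrite mxE eq_sym (negbTE i01) eqxx.
have v_i i : i != i0 -> i != i1 -> (fun x => v x ord0 i) = cst 0.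
  by move=> /negbTE ii0 /negbTE ii1; apply/funext => x; rewrite mxE ii0 ii1.
have sv i : smooth (fun x => v x ord0 i).
  have [->|ii0] := eqVneq i i0; first by rewrite v_i0; exact: smooth_partial.
  have [->|ii1] := eqVneq i i1.
    rewrite v_i1 (_ : (fun x => _) = (fun x => (-1) * partial i0 psi x)).
      by apply: smoothZ; exact: smooth_partial.
    by apply/funext => x; rewrite mulN1r.
  by have -> := v_i i ii0 ii1; exact: (smooth_cst 0).
have v0 x : ~ K x -> v x = 0.
  move=> Kx; apply/rowP => i; rewrite [RHS]mxE mxE.
  rewrite (partial_eq0_off i1 cK psi0 Kx) (partial_eq0_off i0 cK psi0 Kx).
  by rewrite oppr0 !if_same.
have [M [M0 hM]] := compact_supp_box cK.
have [_ [mG Goo] _] := W12_smooth_field (D := setT) sv cK (fun _ _ => I) v0.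
exists K, v; split; [exact: cK|exact: KO|exact: sv|exact: v0|split].
- move=> x; rewrite /mxtrace (sum_pair i01) => [|i ii0 ii1]; last first.
    by rewrite mxE (v_i i ii0 ii1) partial_cst.
  rewrite !mxE v_i0 v_i1 dC.
  have d0 : derivable (partial i0 psi) x (delta_mx ord0 i1).
    exact: diff_derivable (smooth_differentiable x (smooth_partial i0 spsi)).
  have -> : partial i1 (fun x => - partial i0 psi x) x = - partial i1 (partial i0 psi) x.
    exact: deriveN d0.
  exact: subrr.
- exact/L2norm_lty.
(* The entry (i0, i1) of the gradient is the pure second derivative of [psi] along [i1], and it
   alone keeps the norm from vanishing. *)
- have := second_partial_integral_neq0 i1 M0 spsi (hM _ psi0) psi1.
  apply: contra_neq => G0; apply/eqP; rewrite eq_le; apply/andP; split; last first.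
    by apply: integral_ge0 => x _; rewrite lee_fin sqr_ge0.
  rewrite -[leRHS]G0; apply: le_trans (sqnorm_entry_le i0 i1 mG).
  by under [leRHS]eq_integral do rewrite mxE v_i0.
Qed.

End extremal_field.

Section normalized_field.
Context {R : realType} {n : nat}.
Notation mun := (lebesgue_rV R n).

Lemma sqnormZ (c : R) (F : 'rV[R]_n -> 'M[R]_n) :
  (forall i j, measurable_fun setT (fun x => F x i j)) ->
  (sqnorm mun setT (fun x => c *: F x) = (c ^+ 2)%:E * sqnorm mun setT F)%E.
Proof.
move=> mF; rewrite /sqnorm -ge0_integralZl ?lee_fin ?sqr_ge0//; first last.
- by move=> x _; rewrite lee_fin mxdot_ge0.
- apply/measurable_EFinP; under eq_fun do rewrite mxdotE.
  by apply: measurable_sum => k; apply: measurable_sum => l; apply: measurable_funM; exact: mF.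
apply: eq_integral => x _; rewrite -EFinM !mxdotE; congr EFin.
rewrite mulr_sumr; apply: eq_bigr => i _; rewrite mulr_sumr; apply: eq_bigr => j _.
by rewrite !mxE; ring.
Qed.

Lemma sympartZ (c : R) (A : 'M[R]_n) : sympart (c *: A) = c *: sympart A.
Proof. by apply/matrixP => i j; rewrite !mxE; ring. Qed.

Lemma sympart_measurable (F : 'rV[R]_n -> 'M[R]_n) :
  (forall i j, measurable_fun setT (fun x => F x i j)) ->
  forall i j, measurable_fun setT (fun x => sympart (F x) i j).
Proof.
move=> mF i j; under eq_fun do rewrite !mxE.
by apply: measurable_funM => //; apply: measurable_funD; exact: mF.
Qed.

Lemma grad_mxZ (c : R) (v : 'rV[R]_n -> 'rV[R]_n) x :
  (forall i, smooth (fun x => v x ord0 i)) ->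
  grad_mx (fun x => c *: v x) x = c *: grad_mx v x.
Proof.
move=> sv; apply/matrixP => i j; rewrite !mxE.
have d : derivable (fun x => v x ord0 i) x (delta_mx ord0 j).
  exact: diff_derivable (smooth_differentiable x (sv i)).
rewrite (_ : (fun y => _) = (fun y => c *: v y ord0 i)).
  exact: (deriveZ c d).
by apply/funext => y; rewrite mxE.
Qed.

(** For a solenoidal field [korn_identity] has no trace term, so rescaling the symmetric part to
    norm one makes the squared norm of the gradient exactly 2. *)
Lemma normalized_extremal_field (Omega : set 'rV[R]_n) (x0 : 'rV[R]_n) (i0 i1 : 'I_n) :
  i0 != i1 -> open Omega -> Omega x0 ->
  exists (K : set 'rV[R]_n) (v : 'rV[R]_n -> 'rV[R]_n),
    [/\ compact K, K `<=` Omega, forall i, smooth (fun x => v x ord0 i),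
        forall x, ~ K x -> v x = 0 &
        sqnorm mun setT (fun x => sympart (grad_mx v x)) = 1%E /\
        sqnorm mun setT (grad_mx v) = 2%:E].
Proof.
move=> i01 oO Ox0.
have [K [v [cK KO sv v0 [tr0 Gfin Gneq0]]]] := extremal_field i01 oO Ox0.
have [Lv LG wG] := W12_smooth_field (D := setT) sv cK (fun _ _ => I) v0.
have mG := LG.1.
have := korn_identity Lv LG wG.
rewrite (_ : (\int[mun]_x (\tr (grad_mx v x) ^+ 2)%:E = 0)%E) ?adde0; last first.
  by apply: integral0_eq => x _; rewrite tr0 expr0n.
set S := sqnorm mun setT (fun x => sympart (grad_mx v x)) => SG.
have S0 : (0 <= S)%E by exact: sqnorm_ge0.
(* Since 2 S is the squared norm of the gradient, finite and nonzero, S can be divided by. *)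
have [s s0 Ss] : exists2 s, 0 < s & S = s%:E.
  move: SG S0 Gfin Gneq0; case: S => [s| |] //.
    move=> <-; rewrite lee_fin -EFinM eqe mulf_eq0 pnatr_eq0/= => s0 _ sn0.
    by exists s => //; rewrite lt_def sn0.
  by rewrite gt0_muley// => <-; rewrite ltxx.
pose c := (Num.sqrt s)^-1.
have c2 : c ^+ 2 = s^-1 by rewrite exprVn sqr_sqrtr// ltW.
exists K, (fun x => c *: v x); split; [exact: cK|exact: KO| | |].
- move=> i; rewrite (_ : (fun x => _) = (fun x => c * v x ord0 i)).
    exact: smoothZ.
  by apply/funext => x; rewrite mxE.
- by move=> x Kx; rewrite v0// scaler0.
- have -> : grad_mx (fun x => c *: v x) = (fun x => c *: grad_mx v x).
    by apply/funext => x; exact: grad_mxZ.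
  split.
    under eq_fun do rewrite sympartZ.
    rewrite sqnormZ; last exact: sympart_measurable.
    by rewrite -/S Ss c2 -EFinM mulVf// gt_eqF.
  by rewrite sqnormZ// -SG Ss c2 -!EFinM mulrCA mulVf ?mulr1// gt_eqF.
Qed.

End normalized_field.

(** * Bounds for the two Korn constants *)

Section korn_constants.
Context {R : realType} {n : nat}.
Notation mun := (lebesgue_rV R n).

Lemma L2norm1_sqnorm (D : set 'rV[R]_n) (F : 'rV[R]_n -> 'M[R]_n) :
  L2norm mun D F = 1%E <-> sqnorm mun D F = 1%E.
Proof. by have := L2norm_fin_sqnorm mun D F ler01; rewrite sqrtr1 => h; split; apply h. Qed.

Lemma kappa_space_le : (kappa_space R n <= (Num.sqrt 2)%:E)%E.
Proof.
apply: ge_ereal_sup => _ [u [G [[Lu LG wG] /L2norm1_sqnorm S1 ->]]].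
have := korn_le Lu LG wG; rewrite S1 mule1 => G2.
by rewrite L2normE (_ : (Num.sqrt 2)%:E = sqrte 2%:E)%E// lee_sqrt// sqnorm_ge0.
Qed.

Lemma kappa_space_ge (i0 i1 : 'I_n) : i0 != i1 ->
  ((Num.sqrt 2)%:E <= kappa_space R n)%E.
Proof.
move=> i01; apply: ereal_sup_ubound.
have [K [v [cK _ sv v0 [S1 G2]]]] := normalized_extremal_field i01 openT (I : setT (0 : 'rV[R]_n)).
exists v, (grad_mx v); split.
- exact: W12_smooth_field sv cK (fun _ _ => I) v0.
- exact/L2norm1_sqnorm.
- by apply/esym/L2norm_fin_sqnorm.
Qed.

Lemma sqnorm_shift_ge (D K : set 'rV[R]_n) (v : 'rV[R]_n -> 'rV[R]_n) (A : 'M[R]_n) :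
  measurable D -> (forall i, smooth (fun x => v x ord0 i)) -> compact K -> K `<=` D ->
  (forall x, ~ K x -> v x = 0) ->
  (sqnorm mun D (grad_mx v) <= sqnorm mun D (fun x => (grad_mx v x - A)%R))%E.
Proof.
move=> mD sv cK KD v0; set G := grad_mx v.
have [_ LG _] := W12_smooth_field (D := setT) sv cK (fun _ _ => I) v0.
have mG := LG.1.
have G0 x : ~ D x -> G x = 0 by exact: (grad_mx_off cK KD v0).
have iG i j : mun.-integrable setT (fun x => (G x i j)%:E) by exact: (integrable_grad_mx sv cK v0).
have iGG i j : mun.-integrable setT (fun x => (G x i j * G x i j)%:E).
  exact: sqint_integrableM (L2_sqint LG i j) (L2_sqint LG i j).
(* This is (G_ij - A_ij)^2 without the constant A_ij^2. It lies below the square, vanishes off [D]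
   like G, and has the integral of G_ij^2 because the linear term integrates to zero. *)
pose a i j x := G x i j * G x i j + - (2 * A i j) * G x i j.
have ia i j : mun.-integrable setT (EFin \o a i j).
  rewrite (_ : EFin \o a i j = (fun x => (G x i j * G x i j)%:E + (- (2 * A i j))%:E * (G x i j)%:E)%E).
    exact: (integrableD measurableT (iGG i j) (integrableZl measurableT _ (iG i j))).
  by apply/funext => x /=; rewrite -EFinM -EFinD.
have fE : (\int[mun]_x (\sum_i \sum_j a i j x)%:E = sqnorm mun setT G)%E.
  rewrite (integral_sum2 ia) /sqnorm.
  under [RHS]eq_integral do rewrite mxdotE.
  rewrite (integral_sum2 (a := fun i j x => G x i j * G x i j)); last exact: iGG.
  apply: eq_bigr => i _; apply: eq_bigr => j _.
  under eq_integral do rewrite EFinD [X in (_ + X)%E]EFinM.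
  rewrite integralD//; last exact: (integrableZl measurableT _ (iG i j)).
  rewrite integralZl// (integral_grad_mx_eq0 (D := setT) sv cK (fun _ _ => I) v0).
  by rewrite mule0 adde0.
have if_ : mun.-integrable setT (fun x => (\sum_i \sum_j a i j x)%:E).
  under eq_fun do rewrite -sumEFin.
  apply: integrable_sum => //= i _; under eq_fun do rewrite -sumEFin.
  by apply: integrable_sum => //= j _; exact: ia.
have f0 x : ~ D x -> (\sum_i \sum_j a i j x)%:E = 0%E.
  move=> Dx; rewrite big1// => i _; rewrite big1// => j _.
  by rewrite /a G0// mxE !mulr0 addr0.
rewrite (sqnorm_supp mun G0) -fE (integral_supp f0).
have GAE x k l : (G x - A) k l = G x k l - A k l by rewrite mxE; congr (_ + _); rewrite mxE.
have mGA : measurable_fun setT (fun x => mxdot (G x - A) (G x - A)).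
  under eq_fun do rewrite mxdotE.
  apply: measurable_sum => k; apply: measurable_sum => l; under eq_fun do rewrite !GAE.
  have mk : measurable_fun setT (fun x => G x k l - A k l) by apply: measurable_funB; [exact: mG|exact: measurable_cst].
  exact: measurable_funM.
(* Finiteness supplies the integrability of the larger side that [le_integral] asks for; an infinite
   right-hand side is trivial. *)
have [fin|] := ltP (sqnorm mun D (fun x => (G x - A)%R)) +oo%E; last first.
  by rewrite leye_eq => /eqP ->; rewrite leey.
apply: le_integral => //.
- by apply: (integrableS measurableT mD) => //.
- apply/integrableP; split; first by apply/measurable_EFinP; exact: measurable_funTS.
  apply: le_lt_trans fin; rewrite le_eqVlt; apply/orP; left; apply/eqP.
  by apply: eq_integral => x _; rewrite gee0_abs// lee_fin mxdot_ge0.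
- move=> x _; rewrite lee_fin mxdotE; apply: ler_sum => i _; apply: ler_sum => j _.
  rewrite /a GAE -subr_ge0.
  rewrite (_ : _ - _ = A i j ^+ 2) ?sqr_ge0//; ring.
Qed.

Lemma L2norm_cst0 d (T : measurableType d) (mu : {measure set T -> \bar R}) p q D
    (F : T -> 'M[R]_(p, q)) : (forall x, D x -> F x = 0) -> L2norm mu D F = 0%E.
Proof.
move=> F0; have E : sqnorm mu D F = 0%:E%E.
  apply: integral0_eq => x Dx; rewrite F0// mxdotE big1// => i _.
  by rewrite big1// => j _; rewrite mxE mul0r.
by rewrite L2normE E /= sqrtr0.
Qed.

(** The field is smooth on all of R^n, so the constant sequence computes its trace, which is zero:
    [K] lies in the open set [Omega], and the frontier excludes the interior. *)
Lemma tangential_compact_field (Omega K : set 'rV[R]_n) (v : 'rV[R]_n -> 'rV[R]_n) :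
  open Omega -> K `<=` Omega -> (forall i, smooth (fun x => v x ord0 i)) ->
  (forall x, ~ K x -> v x = 0) -> tangential Omega v (grad_mx v).
Proof.
move=> oO KO sv v0; exists (fun=> 0).
  split.
    split; first by move=> i j; exact: measurable_cst.
    by rewrite L2norm_cst0// ltry.
  exists (fun=> v); split.
  - by move=> _ i; exact: sv.
  - rewrite (_ : (fun k => _) = cst 0%E); first exact: cvg_cst.
    by apply/funext => k; rewrite L2norm_cst0// => x _; rewrite subrr.
  - rewrite (_ : (fun k => _) = cst 0%E); first exact: cvg_cst.
    by apply/funext => k; rewrite L2norm_cst0// => x _; rewrite subrr.
  - rewrite (_ : (fun k => _) = cst 0%E); first exact: cvg_cst.
    apply/funext => k; rewrite L2norm_cst0// => x [_ Ox].
    by rewrite v0 ?subrr// => /KO Kx; apply: Ox; move: oO x Kx; rewrite openE.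
apply: aeW => x nu _; rewrite mxdotE big1// => i _.
by rewrite big1// => j _; rewrite mxE mul0r.
Qed.

Lemma kappa_ge (Omega : set 'rV[R]_n) (i0 i1 : 'I_n) : i0 != i1 ->
  open Omega -> Omega !=set0 -> ((Num.sqrt 2)%:E <= kappa Omega)%E.
Proof.
move=> i01 oO [x0 Ox0]; apply: ereal_sup_ubound.
have [K [v [cK KO sv v0 [S1 G2]]]] := normalized_extremal_field i01 oO Ox0.
have S1O : sqnorm mun Omega (fun x => sympart (grad_mx v x)) = 1%E.
  rewrite sqnorm_supp// => x Ox; rewrite (grad_mx_off cK KO v0 Ox).
  by apply/matrixP => i j; rewrite !mxE addr0 mulr0.
have G2O : sqnorm mun Omega (grad_mx v) = 2%:E.
  by rewrite sqnorm_supp// => x Ox; exact: (grad_mx_off cK KO v0 Ox).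
have nG : L2norm mun Omega (grad_mx v) = (Num.sqrt 2)%:E by exact/L2norm_fin_sqnorm.
exists v, (grad_mx v); split.
- exact: W12_smooth_field sv cK KO v0.
- exact: tangential_compact_field oO KO sv v0.
- exact/L2norm1_sqnorm.
- split.
    (* The minimum in [kappa] has to be attained: the zero matrix belongs to [L_Omega], with a =
       0. *)
    exists 0; last by rewrite -nG; congr L2norm; apply/funext => x; rewrite subr0.
    split; first by rewrite trmx0 oppr0.
    exists 0 => x nu _; rewrite trmx0 mulmx0 addr0 mxdotE big1// => i _.
    by rewrite big1// => j _; rewrite mxE mul0r.
  move=> _ [A _ <-]; rewrite -nG; apply: L2norm_le.
  exact: sqnorm_shift_ge (measurable_rV_open oO) sv cK KO v0.
Qed.

End korn_constants.

Unset Implicit Arguments.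

Theorem theorem1p1 (R : realType) (n : nat) (Omega : set 'rV[R]_n)
  (n_ge2 : (2 <= n)%N)
  (Omega_open : open Omega)
  (Omega_nonempty : Omega !=set0)
  (Omega_bounded : bounded_set Omega)
  (Omega_connected : connected Omega)
  (Omega_lipschitz : lipschitz_boundary Omega) :
  (kappa_space R n <= kappa Omega)%E /\
  kappa_space R n = (Num.sqrt 2)%:E.
Proof.
(* The coordinates 0 and 1 span the plane that carries the stream-function field. *)
have [i0 [i1 i01]] : exists i0 i1 : 'I_n, i0 != i1.
  by exists (Ordinal (ltnW n_ge2)), (Ordinal n_ge2).
have kE : kappa_space R n = (Num.sqrt 2)%:E.
  by apply/eqP; rewrite eq_le kappa_space_le (kappa_space_ge i01).
by split; rewrite kE//; exact: kappa_ge i01 Omega_open Omega_nonempty.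
Qed.
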